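(* Let $M_t$ be the position at time $t$ of the rightmost particle in a standard binary branching Brownian motion (branching rate $1$) started from one particle at $0$, and let $m(t) := \sup\{x\in\mathbb{R} : \mathbb{P}(M_t\le x)\le 1/2\}$. Then $$m(t) = \sqrt{2}\,t - \frac{3}{2\sqrt 2}\log t + O(1) \qquad\text{as } t\to\infty,$$ i.e. the quantity $m(t) - \sqrt2\, t + \frac{3}{2\sqrt2}\log t$ remains bounded as $t\to\infty$.
   Context: Branching Brownian motion (BBM): the process begins with one particle at $0$ at time $0$, which moves like a standard one-dimensional Brownian motion until an independent exponentially distributed time with parameter $1$. At this time it dies and is replaced, at its current position, by two new particles which, relative to their birth time and position, behave like independent copies of their parent (moving as Brownian motions and branching at rate $1$ into two copies of themselves). $\mathbb{P}$ is the law of this process. $N(t)$ denotes the set of particles alive at time $t$; for $v\in N(t)$, $X_v(t)$ is the position of $v$ at time $t$. Define $M_t=\max_{v\in N(t)}X_v(t)$. *)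

(* Defs.v *)
From HB Require Import structures.
From mathcomp Require Import all_boot all_order all_algebra.
From mathcomp Require Import all_classical all_reals all_analysis.

Set Implicit Arguments.
Unset Strict Implicit.
Unset Printing Implicit Defensive.

Import Order.TTheory GRing.Theory Num.Theory.
Import numFieldNormedType.Exports.

Local Open Scope classical_set_scope.
Local Open Scope ring_scope.

Section Independence.
Context {d : measure_display} {T : measurableType d} {R : realType}.
Variable P : probability T R.

(* [F] is meant to be a family of sigma-algebras; for general set systems the
   product rule below is weaker than independence of the generated ones. *)
Definition mutually_independent (I : choiceType) (F : I -> set_system T) :=
  forall (s : seq I) (A : I -> set T), uniq s ->
    (forall i, i \in s -> F i (A i)) ->
    P (\bigcap_(i in [set` s]) A i) = (\prod_(i <- s) P (A i))%E.

Definition sigma_rv (X : T -> R) : set_system T :=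
  preimage_set_system setT X measurable.

(* Only the nonnegative times of a process are relevant, here and below. *)
Definition sigma_process (B : R -> T -> R) : set_system T :=
  <<s \bigcup_(t in `[0, +oo[) sigma_rv (B t) >>.

End Independence.

Section BranchingBrownianMotion.
Context {d : measure_display} {T : measurableType d} {R : realType}.
Variable P : probability T R.

Record standard_brownian_motion (B : R -> {RV P >-> R}) : Prop := {
  bm_start : forall w, B 0 w = 0 ;
  bm_continuous : forall w, {within `[0, +oo[, continuous (fun t : R => B t w)} ;
  bm_gaussian : forall s t : R, 0 <= s -> s < t ->
    forall A : set R, measurable A ->
    pushforward P (B t \- B s) A = normal_prob 0 (Num.sqrt (t - s)) A ;
  (* Covers finite lists of times, since [t_] may be eventually constant. *)
  bm_independent : forall t_ : nat -> R,
    0 <= t_ 0%N -> {homo t_ : i j / (i <= j)%N >-> i <= j} ->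
    mutually_independent P (fun i => sigma_rv (B (t_ i.+1) \- B (t_ i)))
}.

(* Particles carry Ulam-Harris labels: the initial particle is [::], and the
   two children of u are [rcons u false] and [rcons u true], so the strict
   ancestors of u are the prefixes [take i u] with i < size u.  Particle u has
   lifetime [tau u], and [B u s] is its displacement from its birthplace at
   age s. *)
Record branching_brownian_motion
    (tau : seq bool -> {RV P >-> R}) (B : seq bool -> R -> {RV P >-> R}) :
    Prop := {
  (* Imposed everywhere, not just almost surely: [B u] is unconstrained at
     negative ages, and [position] evaluates it at age [tau u]. *)
  bbm_lifetime_ge0 : forall u w, 0 <= tau u w ;
  bbm_lifetime : forall u (A : set R), measurable A ->
    distribution P (tau u) A = exponential_prob 1 A ;
  bbm_motion : forall u, standard_brownian_motion (B u) ;
  bbm_independent : mutually_independent P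
    (fun i : (seq bool + seq bool)%type =>
       match i with
       | inl u => sigma_rv (tau u)
       | inr u => sigma_process (fun s => B u s)
       end)
}.

Variables (tau : seq bool -> {RV P >-> R}) (B : seq bool -> R -> {RV P >-> R}).

Definition birth_time (u : seq bool) (w : T) : R :=
  \sum_(i < size u) tau (take i u) w.

Definition alive (t : R) (w : T) : set (seq bool) :=
  [set u | birth_time u w <= t < birth_time u w + tau u w].

(* Meaningful for u in [alive t w]. *)
Definition position (u : seq bool) (t : R) (w : T) : R :=
  \sum_(i < size u) B (take i u) (tau (take i u) w) w
  + B u (t - birth_time u w) w.

(* Almost surely [alive t w] is finite and nonempty for t >= 0, and the
   supremum is then a maximum. *)
Definition rightmost (t : R) (w : T) : \bar R :=
  ereal_sup [set (position u t w)%:E | u in alive t w].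

Definition median (t : R) : R :=
  sup [set x : R | (P [set w | rightmost t w <= x%:E] <= (2^-1)%:E)%E].

End BranchingBrownianMotion.

(* Main.v *)
(* Conditioning on the first branching, u(t, x) = P(M_t > x) satisfies a
   renewal equation, whence, with G_h the heat semigroup,
     e^h G_h u - (e^2h - e^h) G_h (u^2) <= u(t + h) <= e^h G_h u
   (the left inequality for h <= 1/4).  These are tested on explicit barriers built
   from Gaussians, on which G_h acts in closed form.  Let lam = sqrt 2,
   ell t = 3/(2 lam) ln t and z = x - lam t + ell t.  With h = 1/4,
   eps e^(-lam z) e^(-(z - ell)^2/2t) (z - 6 + e^(-z) - e^(-2z))_+ stays below u:
   the linear term gains from the drift of ell, the exponentials absorb the
   quadratic loss and the cutoff.  With h = 1, a large multiple of
   e^(-150/sqrt t) e^(-a z - z^2/2s) (z - e^(-z) + 2 e^(-2z)), with a close to lam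
   and s = t + sqrt t, stays above u in front of the frontier.  Hence u(t, .) is
   bounded below at lam t - ell t, is amplified from there to 1/2 in a bounded time,
   and is less than 1/2 at lam t - ell t + O(1). *)
Require Import Defs.
From HB Require Import structures.
From mathcomp Require Import all_boot all_order all_algebra.
From mathcomp Require Import all_classical all_reals all_analysis.
From mathcomp Require Import measurable_realfun.
From mathcomp Require Import ring lra.

Set Implicit Arguments.
Unset Strict Implicit.
Unset Printing Implicit Defensive.

Import Order.TTheory GRing.Theory Num.Theory.
Import numFieldNormedType.Exports.

Local Open Scope classical_set_scope.
Local Open Scope ring_scope.

(** * Independence and integration *)

(** Beyond measurability and monotonicity in x, no regularity of u is at hand, so instead of
    differentiating the F-KPP equation the two one-step inequalities serve as comparison principle,
    and a barrier is carried forward by induction on time steps. The exponent 3/2 is 1/2 + 1.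
    Averaging e^(-x^2/2t) over a step h lowers its height by (t/(t+h))^(1/2), and recentring shrinks
    a linear profile z to tz/(t+h); the product decays like t^(-3/2), and lam ell t = (3/2) ln t
    offsets it. A linear profile alone is balanced and leaves no room for errors. Averaging over
    variance v multiplies e^(-z) by e^(v/2): added to z this term makes a subsolution, subtracted
    from z a supersolution, and e^(-2z), with the opposite sign, controls the profile at negative z.
    Both barriers work only at large times, so they are compared with the process at shifted times:
    the lower one with time t + 1, where a single Brownian path already has a wider tail, the upper
    one with time t - b. *)

Section independence_integral.
Local Open Scope ereal_scope.
Context d d1 d2 (T : measurableType d) (Y : measurableType d1)
  (Z : measurableType d2) (R : realType) (P : probability T R).

(** The joint law of [X] and [V] is the product of their laws, and Tonelli freezes [X] while
    integrating over [V]. In [integral_split] the space [Z] is [T] itself with a smaller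
    sigma-algebra. *)
Lemma indep_integral (X : T -> Y) (V : T -> Z) (f : (Y * Z)%type -> \bar R) :
  measurable_fun setT X -> measurable_fun setT V ->
  (forall A B, measurable A -> measurable B ->
     P (X @^-1` A `&` V @^-1` B) = P (X @^-1` A) * P (V @^-1` B)) ->
  measurable_fun setT f -> (forall p, 0 <= f p) ->
  \int[P]_w f (X w, V w) = \int[P]_w \int[P]_w' f (X w, V w').
Proof.
move=> mX mV XV mf f0.
pose X' : {mfun T >-> Y} := HB.pack X (isMeasurableFun.Build _ _ _ _ _ mX).
pose V' : {mfun T >-> Z} := HB.pack V (isMeasurableFun.Build _ _ _ _ _ mV).
have mXV : measurable_fun setT (fun w => (X w, V w)).
  exact: measurable_fun_pair.
pose XV' : {mfun T >-> (Y * Z)%type} :=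
  HB.pack (fun w => (X w, V w)) (isMeasurableFun.Build _ _ _ _ _ mXV).
transitivity (\int[distribution P XV']_p f p).
  by rewrite ge0_integral_distribution.
transitivity (\int[distribution P X' \x distribution P V']_p f p).
  apply: eq_measure_integral => A mA _; apply/esym.
  by apply: product_measure_unique => // B C mB mC; exact: XV.
rewrite fubini_tonelli1// ge0_integral_distribution; last 2 first.
- exact: measurable_fun_fubini_tonelli_F.
- by move=> y; apply: integral_ge0.
apply: eq_integral => w _ /=; rewrite /fubini_F ge0_integral_distribution//.
exact: measurableT_comp.
Qed.

End independence_integral.

Section density.
Local Open Scope ereal_scope.
Context d (T : measurableType d) (R : realType).
Variables (mu nu : {measure set T -> \bar R}) (p : T -> R).
Hypotheses (mp : measurable_fun setT p) (p0 : forall x, (0 <= p x)%R).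
Hypothesis nuE : forall A, measurable A -> nu A = \int[mu]_(x in A) (p x)%:E.

Import HBNNSimple.

Lemma ge0_integral_density (f : T -> \bar R) :
  measurable_fun setT f -> (forall x, 0 <= f x) ->
  \int[nu]_x f x = \int[mu]_x (f x * (p x)%:E).
Proof.
move=> mf f0.
have sfE (g : {nnsfun T >-> R}) :
    \int[nu]_x (g x)%:E = \int[mu]_x ((g x)%:E * (p x)%:E).
  under eq_integral do rewrite fimfunE -fsumEFin//.
  rewrite ge0_integral_fsum//; last 2 first.
  - by move=> y; exact/measurable_EFinP/measurable_funM.
  - by move=> y x _; rewrite nnfun_muleindic_ge0.
  under [RHS]eq_integral.
    move=> x _; rewrite fimfunE -fsumEFin// ge0_mule_fsuml; last first.
      by move=> r; rewrite nnfun_muleindic_ge0.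
    over.
  rewrite ge0_integral_fsum//; last 2 first.
  - move=> y; apply: emeasurable_funM => //; last exact/measurable_EFinP.
    exact/measurable_EFinP/measurable_funM.
  - by move=> y x _; rewrite mule_ge0 ?nnfun_muleindic_ge0 ?lee_fin.
  apply: eq_fsbigr => r; rewrite inE => -[x _ <-].
  under [RHS]eq_integral do rewrite EFinM -muleA.
  under eq_integral do rewrite EFinM.
  have m1 : measurable_fun setT (fun y => (\1_(g @^-1` [set g x]) y)%:E : \bar R).
    exact/measurable_EFinP.
  rewrite !ge0_integralZl_EFin//=; last 2 first.
  - by move=> y _; rewrite mule_ge0 ?lee_fin.
  - by apply: emeasurable_funM => //; exact/measurable_EFinP.
  congr (_ * _); rewrite integral_indic// setIT nuE//.
  rewrite integral_mkcond; apply: eq_integral => y _.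
  by rewrite patchE indicE; case: ifPn; rewrite ?mul1e ?mul0e.
pose f_ := nnsfun_approx measurableT mf.
have f_cvg x : limn (fun n => (f_ n x)%:E) = f x.
  by apply/cvg_lim => //; apply: cvg_nnsfun_approx.
transitivity (limn (fun n => \int[nu]_x (f_ n x)%:E)).
  rewrite -monotone_convergence//.
  - by apply: eq_integral => y _; rewrite f_cvg.
  - by move=> n; exact/measurable_EFinP.
  - by move=> n y _; rewrite lee_fin.
  - by move=> y _ m n mn; rewrite lee_fin; exact/lefP/nd_nnsfun_approx.
transitivity (limn (fun n => \int[mu]_x ((f_ n x)%:E * (p x)%:E))).
  by congr (limn _); apply/funext => n; exact: sfE.
rewrite -monotone_convergence//.
- apply: eq_integral => y _; apply/cvg_lim => //; apply: cvgeZr => //.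
  by apply: cvg_nnsfun_approx.
- move=> n; apply: emeasurable_funM => //; exact/measurable_EFinP.
- by move=> n y _; rewrite mule_ge0 ?lee_fin.
- move=> y _ m n mn; rewrite lee_wpmul2r ?lee_fin//.
  exact/lefP/nd_nnsfun_approx.
Qed.

End density.

Section translation.
Local Open Scope ereal_scope.
Context {R : realType}.
Local Notation mu := (@lebesgue_measure R).

Lemma lebesgue_measure_translate (h : R) (A : set R) : measurable A ->
  pushforward mu ((fun x : R => (x + h)%R) : _ -> measurableTypeR R) A = mu A.
Proof.
move=> mA; apply/esym/lebesgue_measure_unique => //=.
  exact: measurable_funD.
move=> mh _ [[a b]] _ <-.
rewrite /pushforward (_ : _ @^-1` _ = `](a - h)%R, (b - h)%R]%classic).
  rewrite !lebesgue_measure_itv/= !lte_fin ltrD2r -!EFinB.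
  by case: ifP => // _; congr (_%:E); ring.
by apply/seteqP; split => x /=; rewrite !in_itv/= ltrBlDr lerBrDr.
Qed.

Lemma ge0_integral_translate (h : R) (f : R -> \bar R) :
  measurable_fun setT f -> (forall x, 0 <= f x) ->
  \int[mu]_x f x = \int[mu]_x f (x + h)%R.
Proof.
move=> mf f0.
pose g : R -> measurableTypeR R := fun x => (x + h)%R.
have mg : measurable_fun setT g by exact: measurable_funD.
transitivity (\int[pushforward mu g]_x f x).
  by apply: eq_measure_integral => //= A mA AS; exact/esym/lebesgue_measure_translate.
by rewrite ge0_integral_pushforward.
Qed.

End translation.

(** * Joint measurability of continuous processes *)

Section joint_measurability.
Context d (T : measurableType d) (R : realType).

(** The process is sampled at the first multiple of 1/(n+1) beyond the current time, a countable
    choice and hence measurable; continuity gives the limit. [T] stays arbitrary so that smaller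
    sigma-algebras are covered too. *)
Lemma measurable_continuous_process (X : R -> T -> R) :
  (forall t : R, 0 <= t -> measurable_fun setT (X t)) ->
  (forall w, {within `[0%R, +oo[, continuous (X ^~ w)}) ->
  measurable_fun [set: R * T] (fun p => X (Num.max p.1 0) p.2).
Proof.
move=> mX cX.
pose k n (t : R) := Num.truncn (n.+1%:R * Num.max t 0).
pose q n (t : R) : R := (k n t).+1%:R / n.+1%:R.
apply: (@measurable_fun_cvg _ _ _ _ (fun n p => X (q n p.1) p.2)).
  move=> n _ A mA; rewrite setTI.
  rewrite (_ : _ @^-1` _ = \bigcup_j ([set p : R * T | k n p.1 = j] `&`
      [set p : R * T | A (X (j.+1%:R / n.+1%:R)%R p.2)])); last first.
    apply/seteqP; split => [[t w] /= At|[t w] [j _] /= [<-]//].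
    by exists (k n t).
  apply: bigcupT_measurable => j; apply: measurableI.
    rewrite (_ : [set _ | _] =
      (fun p : R * T => n.+1%:R * Num.max p.1 0)%R @^-1` `[j%:R, j.+1%:R[%classic).
      rewrite -[X in measurable X]setTI.
      have : measurable_fun setT (fun p : R * T => n.+1%:R * Num.max p.1 0).
        by apply: measurable_funM => //; apply: measurable_maxr.
      exact.
    apply/seteqP; split => [[t w]|[t w]] /=; rewrite in_itv/= /k.
      by move=> <-; rewrite truncn_itv// mulr_ge0// le_max lexx orbT.
    by move=> /truncn_def.
  rewrite -[X in measurable X]setTI.
  have : measurable_fun setT (fun p : R * T => X (j.+1%:R / n.+1%:R) p.2).
    apply: measurableT_comp => //; apply: mX; exact: divr_ge0.
  exact.
move=> [t w] _ /=.
set t' := Num.max t 0.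
have t'0 : 0 <= t' by rewrite /t' le_max lexx orbT.
have qt : q n t @[n --> \oo] --> t'.
  apply/cvgrPdist_lt => e e0; near=> n.
  have /andP[k1 k2] : (k n t)%:R <= n.+1%:R * t' < (k n t).+1%:R.
    by apply: truncn_itv; rewrite mulr_ge0.
  have qE : q n t * n.+1%:R = (k n t).+1%:R by rewrite divfK.
  have en : 1 < e * n.+1%:R.
    rewrite mulrC -ltr_pdivrMr// div1r; near: n.
    have [m em] : exists m, e^-1 < m%:R.
      by exists (Num.truncn e^-1).+1; exact: truncnS_gt.
    exists m => //= n /= mn; apply: (lt_le_trans em).
    by rewrite ler_nat (leq_trans mn).
  have n0 : 0 < n.+1%:R :> R by [].
  rewrite -natr1 in qE k2.
  rewrite ltr_norml; apply/andP; split.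
    rewrite -(ltr_pM2r n0); nra.
  rewrite -(ltr_pM2r n0); nra.
have q0 n : 0 <= q n t by exact: divr_ge0.
have := cX w; move=> /subspace_continuousP /(_ t').
rewrite /= in_itv/= t'0 => /(_ erefl) cXt.
apply: cvg_trans cXt => A /=.
move=> /qt; rewrite /nbhs/= /fmap/=; apply: filterS => n /=.
by apply; rewrite in_itv/= q0.
Unshelve. all: by end_near. Qed.

End joint_measurability.

(** * Independence of disjoint groups of sigma-algebras *)

Section grouping.
Context d (T : measurableType d) (R : realType) (P : probability T R).
Local Open Scope ereal_scope.

(** As functions of [A] both sides are finite measures, [P] restricted to [B] and a multiple of [P];
    they agree on the pi-system [G], hence on what it generates. *)
Lemma g_sigma_indep1 (G : set_system T) (B : set T) :
  G `<=` measurable -> setI_closed G -> G setT -> measurable B ->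
  (forall A, G A -> P (A `&` B) = P A * P B) ->
  forall A, <<s G >> A -> P (A `&` B) = P A * P B.
Proof.
move=> mG GI GT mB GB A sA.
have PB0 : (0 <= fine (P B))%R by exact: fine_ge0.
have PBE : (fine (P B))%:E = P B by rewrite fineK// fin_num_measure.
rewrite -PBE muleC.
apply: (g_sigma_algebra_measure_unique G mG (fun=> setT) _ _
  (mrestr P mB) (mscale (NngNum PB0) P)) => //.
- by rewrite bigcup_const//; exists 0%N.
- by move=> C GC; rewrite [LHS]GB//= /mscale/= PBE muleC.
- by move=> _; rewrite /mrestr/= (le_lt_trans (probability_le1 _ _))// ?ltry//; exact: measurableI.
Qed.

Lemma g_sigma_indep (G1 G2 : set_system T) :
  G1 `<=` measurable -> G2 `<=` measurable ->
  setI_closed G1 -> setI_closed G2 -> G1 setT -> G2 setT ->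
  (forall A B, G1 A -> G2 B -> P (A `&` B) = P A * P B) ->
  forall A B, <<s G1 >> A -> <<s G2 >> B -> P (A `&` B) = P A * P B.
Proof.
move=> mG1 mG2 I1 I2 T1 T2 G12 A B sA sB.
have mB : measurable B.
  exact: (smallest_sub (@sigma_algebra_measurable _ T) mG2).
apply: (g_sigma_indep1 mG1) => // C G1C.
rewrite setIC muleC; apply: (g_sigma_indep1 mG2) => //; first exact: mG1.
by move=> D G2D; rewrite setIC muleC G12.
Qed.

Variables (I : choiceType) (F : I -> set_system T).
Hypothesis FI : forall i, setI_closed (F i).
Hypothesis Fm : forall i, F i `<=` measurable.
Hypothesis indF : mutually_independent P F.

(* The pi-system of finite intersections generating the sigma-algebra of [J]. *)
Let cyl (J : set I) : set_system T :=
  [set C | exists s A, [/\ uniq s, forall i, i \in s -> J i,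
     forall i, i \in s -> F i (A i) & C = \bigcap_(i in [set` s]) A i]].

Let cylT J : cyl J setT.
Proof. by exists [::], (fun=> setT); split => //; rewrite set_nil bigcap_set0. Qed.

Let cylI J : setI_closed (cyl J).
Proof.
move=> _ _ [s [A [us Js Fs ->]]] [r [B [ur Jr Fr ->]]].
(* An index of both lists carries the intersection of its two sets, so that it occurs only once. *)
exists (undup (s ++ r)), (fun i => (if i \in s then A i else setT) `&`
   (if i \in r then B i else setT)); split.
- exact: undup_uniq.
- by move=> i; rewrite mem_undup mem_cat => /orP[/Js|/Jr].
- move=> i; rewrite mem_undup mem_cat.
  case: ifPn => si; case: ifPn => ri //= _.
  + by apply: FI; [exact: Fs|exact: Fr].
  + by rewrite setIT; exact: Fs.
  + by rewrite setTI; exact: Fr.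
- apply/seteqP; split => w.
    move=> [As Br] i /=; rewrite mem_undup mem_cat => _; split.
      by case: ifPn => // si; exact: As.
    by case: ifPn => // ri; exact: Br.
  move=> H; split => i /= si.
    have /H[] : [set` undup (s ++ r)] i by rewrite /= mem_undup mem_cat si.
    by rewrite si.
  have /H[] : [set` undup (s ++ r)] i by rewrite /= mem_undup mem_cat si orbT.
  by rewrite si.
Qed.

Let cylm J : cyl J `<=` measurable.
Proof.
move=> _ [s [A [us Js Fs ->]]]; apply: fin_bigcap_measurable => // i /= si.
exact/Fm/Fs.
Qed.

(** Cylinders over disjoint index sets concatenate to a cylinder with a duplicate-free index list,
    to which mutual independence applies; cylinders form pi-systems, so [g_sigma_indep] extends the
    product rule. *)
Lemma mutually_independent_split (J1 J2 : set I) :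
  J1 `&` J2 = set0 ->
  forall A B, <<s \bigcup_(i in J1) F i >> A -> <<s \bigcup_(i in J2) F i >> B ->
  P (A `&` B) = P A * P B.
Proof.
move=> J12 A B sA sB.
have Fcyl J : \bigcup_(i in J) F i `<=` cyl J.
  move=> C [i Ji FC]; exists [:: i], (fun=> C); split => //.
  - by move=> j; rewrite inE => /eqP->.
  - by move=> j; rewrite inE => /eqP->.
  - apply/seteqP; split => [w Cw j _//|w]; apply; exact: mem_head.
apply: (@g_sigma_indep (cyl J1) (cyl J2)) => //; last 2 first.
- by move: sA; apply: sub_smallest2r => //; exact: Fcyl.
- by move: sB; apply: sub_smallest2r => //; exact: Fcyl.
move=> _ _ [s [C [us Js Fs ->]]] [r [D [ur Jr Fr ->]]].
have dsr i : i \in s -> i \in r -> False.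
  by move=> /Js J1i /Jr J2i; have : (J1 `&` J2) i by []; rewrite J12.
have usr : uniq (s ++ r).
  rewrite cat_uniq us ur andbT /=; apply/hasPn => i ri.
  by apply/negP => si; exact: (dsr i).
pose E i := if i \in s then C i else D i.
have Es i : i \in s -> E i = C i by rewrite /E => ->.
have Er i : i \in r -> E i = D i.
  by move=> ri; rewrite /E; case: ifPn => // si; case: (dsr i).
rewrite (indF us Fs) (indF ur Fr).
rewrite (_ : _ `&` _ = \bigcap_(i in [set` s ++ r]) E i); last first.
  apply/seteqP; split => [w [Cw Dw] i /=|w Ew].
    by rewrite mem_cat => /orP[si|ri]; [rewrite Es//; exact: Cw|rewrite Er//; exact: Dw].
  split => i /= si; first by rewrite -(Es _ si); apply: Ew; rewrite /= mem_cat si.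
  by rewrite -(Er _ si); apply: Ew; rewrite /= mem_cat si orbT.
rewrite (indF usr); last first.
  move=> i; rewrite mem_cat => /orP[si|ri]; first by rewrite Es//; exact: Fs.
  by rewrite Er//; exact: Fr.
rewrite big_cat/=; congr (_ * _).
  by apply: eq_big_seq => i si; rewrite Es.
by apply: eq_big_seq => i ri; rewrite Er.
Qed.

End grouping.

Section lebesgue_density.
Context {R : realType}.
Local Open Scope ereal_scope.

Lemma ge0_integral_lebesgue_density (nu : {measure set R -> \bar R}) (p : R -> R)
    (f : R -> \bar R) :
  measurable_fun setT p -> (forall x, (0 <= p x)%R) ->
  (forall A, measurable A -> nu A = \int[lebesgue_measure]_(x in A) (p x)%:E) ->
  measurable_fun setT f -> (forall x, 0 <= f x) ->
  \int[nu]_x f x = \int[lebesgue_measure]_x (f x * (p x)%:E).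
Proof.
move=> mp p0 nuE mf f0.
(* [lebesgue_measure] lives on [measurableTypeR R] and [nu] on [R]; the pushforward along the
   identity puts both on the same space. *)
pose i : measurableTypeR R -> R := id.
have mi : measurable_fun setT i by move=> _ A mA; rewrite setTI.
pose mi_mixin := isMeasurableFun.Build _ _ _ _ i mi.
pose i' : {mfun measurableTypeR R >-> R} := HB.pack i mi_mixin.
have mfp : measurable_fun setT (fun x => f x * (p x)%:E).
  by apply: emeasurable_funM => //; exact/measurable_EFinP.
transitivity (\int[pushforward (@lebesgue_measure R) i]_x (f x * (p x)%:E)).
  apply: (@ge0_integral_density _ _ _
    (pushforward (@lebesgue_measure R) i) nu p) => // A mA.
  rewrite nuE// ge0_integral_pushforward//.
    by apply/measurable_funTS/measurable_EFinP.
  by move=> x _; rewrite lee_fin.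
by rewrite ge0_integral_pushforward// => x _; rewrite mule_ge0// lee_fin.
Qed.

End lebesgue_density.

(** * Renewal equation for the rightmost particle *)

(* Sees only the particles of generation less than [n] and recurses on the first
   branching, so that the renewal equation can be read off; the times are
   truncated at 0 because [B u] is unconstrained at negative ages. *)
Fixpoint below {T : Type} {R : realType} (n : nat) (tau : seq bool -> T -> R)
    (B : seq bool -> R -> T -> R) (t x : R) (w : T) : bool :=
  if n is n'.+1 then
    if t < tau [::] w then B [::] (Num.max t 0) w <= x
    else let s := tau [::] w in let y := B [::] (Num.max s 0) w in
      below n' (fun u => tau (false :: u)) (fun u => B (false :: u)) (t - s) (x - y) w
      && below n' (fun u => tau (true :: u)) (fun u => B (true :: u)) (t - s) (x - y) w
  else true.

Section measurable_below.
Context d d' (T : measurableType d) (S : measurableType d') (R : realType).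

Lemma measurable_below n (tau : seq bool -> T -> R) (B : seq bool -> R -> T -> R)
    (t x : S -> R) (w : S -> T) :
  (forall u, measurable_fun setT (tau u)) ->
  (forall u, measurable_fun [set: R * T] (fun p => B u (Num.max p.1 0) p.2)) ->
  measurable_fun setT t -> measurable_fun setT x -> measurable_fun setT w ->
  measurable_fun setT (fun p => below n tau B (t p) (x p) (w p)).
Proof.
elim: n tau B t x => [//|n IH] tau B t x mtau mB mt mx mw /=.
have mtw : measurable_fun setT (fun p => tau [::] (w p)) by exact: measurableT_comp.
have mBw (r : S -> R) : measurable_fun setT r ->
    measurable_fun setT (fun p => B [::] (Num.max (r p) 0) (w p)).
  move=> mr; apply: (measurableT_comp (mB [::])  (g := fun p => (r p, w p))).
  exact: measurable_fun_pair.
apply: measurable_fun_ifT; first exact: measurable_fun_ltr.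
  by apply: measurable_fun_ler => //; exact: mBw.
by apply: measurable_and; apply: IH => //;
  apply: measurable_funB => //; exact: mBw.
Qed.

End measurable_below.

Section below_alive.
Context d (T : measurableType d) (R : realType) (P : probability T R).
Variables (tau : seq bool -> {RV P >-> R}) (B : seq bool -> R -> {RV P >-> R}).
Hypothesis tau0 : forall u w, 0 <= tau u w.

Let sub b := fun u => tau (b :: u).
Let Bsub b := fun u => B (b :: u).

Lemma birth_time_nil w : birth_time tau [::] w = 0.
Proof. by rewrite /birth_time big_ord0. Qed.

Lemma birth_time_cons b u w :
  birth_time tau (b :: u) w = tau [::] w + birth_time (sub b) u w.
Proof. by rewrite /birth_time/= big_ord_recl. Qed.

Lemma birth_time_ge0 u w : 0 <= birth_time tau u w.
Proof. exact: sumr_ge0. Qed.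

Lemma position_cons b u t w :
  position tau B (b :: u) t w =
  B [::] (tau [::] w) w + position (sub b) (Bsub b) u (t - tau [::] w) w.
Proof.
by rewrite /position/= big_ord_recl/= birth_time_cons opprD !addrA.
Qed.

End below_alive.

Lemma belowP d (T : measurableType d) (R : realType) (P : probability T R) n
    (tau : seq bool -> {RV P >-> R}) (B : seq bool -> R -> {RV P >-> R}) t x w :
  (forall u w, 0 <= tau u w) -> 0 <= t ->
  reflect (forall u, (size u < n)%N -> alive tau t w u -> position tau B u t w <= x)
    (below n (fun u => tau u) (fun u => B u) t x w).
Proof.
elim: n tau B t x => [|n IH] tau B t x tau0 t0 /=; first by constructor.
case: ltP => [tt|tt].
  apply: (iffP idP) => [Btx [|b u] _|/(_ [::] isT)].
  - by move=> _; rewrite /position big_ord0 birth_time_nil add0r subr0 -(max_idPl t0).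
  - rewrite /alive/= birth_time_cons => /andP[le1 _].
    have := le_lt_trans le1 tt; rewrite gtrDl.
    by rewrite ltNge birth_time_ge0// => ? ?; exact: tau0.
  - rewrite /position big_ord0 birth_time_nil add0r subr0 (max_idPl t0); apply.
    by rewrite /alive/= birth_time_nil add0r t0.
have ts : 0 <= t - tau [::] w by rewrite subr_ge0.
rewrite (max_idPl (tau0 [::] w)).
set y := B [::] (tau [::] w) w.
have aliveE b u : alive tau t w (b :: u) <-> alive (fun u => tau (b :: u)) (t - tau [::] w) w u.
  by rewrite /alive/= birth_time_cons lerBrDl ltrBlDl !addrA.
apply: (iffP andP).
  move=> [/IH H0 /IH H1] [|b u] /=.
    by move=> _; rewrite /alive/= birth_time_nil add0r ltNge tt andbF.
  rewrite ltnS => un /aliveE al; rewrite position_cons -lerBrDl.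
  by case: b al => al; [apply: H1|apply: H0].
move=> H; split; apply/IH => //= u un al; rewrite lerBrDl.
  by rewrite -(position_cons tau B false); apply: H => //; exact/aliveE.
by rewrite -(position_cons tau B true); apply: H => //; exact/aliveE.
Qed.

Lemma ge0_integral_bool d (T : measurableType d) (R : realType)
    (mu : {measure set T -> \bar R}) (b : T -> bool) :
  measurable_fun setT b ->
  (\int[mu]_w ((b w)%:R : R)%:E = mu [set w | b w])%E.
Proof.
move=> mb; rewrite -[in RHS](setIT [set w | b w]) -integral_indic//=.
  by apply: eq_integral => w _; rewrite indicE mem_setE.
by rewrite -[X in measurable X]setTI; exact: mb.
Qed.

Section bbm.
Context d (T : measurableType d) (R : realType) (P : probability T R).

Definition bbm_sigma (tau : seq bool -> {RV P >-> R})
    (B : seq bool -> R -> {RV P >-> R}) (i : (seq bool + seq bool)%type) :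
    set_system T :=
  match i with
  | inl u => sigma_rv (tau u)
  | inr u => sigma_process (fun s => B u s)
  end.

Section one_system.
Variables (tau : seq bool -> {RV P >-> R}) (B : seq bool -> R -> {RV P >-> R}).
Hypothesis hB : branching_brownian_motion tau B.
Local Notation F := (bbm_sigma tau B).
Local Notation gen J := (\bigcup_(i in J) F i).

(** Prefixing labels by [b] is injective, so independence passes to the subfamily; events are
    transported along the left inverse [g]. *)
Lemma sub_bbm b :
  branching_brownian_motion (fun u => tau (b :: u)) (fun u => B (b :: u)).
Proof.
split.
- by move=> u w; exact: bbm_lifetime_ge0 hB _ _.
- by move=> u; exact: bbm_lifetime hB _.
- by move=> u; exact: bbm_motion hB _.
- move=> s A us FA.
  pose h (i : (seq bool + seq bool)%type) : (seq bool + seq bool)%type :=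
    match i with inl u => inl (b :: u) | inr u => inr (b :: u) end.
  pose g (i : (seq bool + seq bool)%type) : (seq bool + seq bool)%type :=
    match i with inl u => inl (behead u) | inr u => inr (behead u) end.
  have hK : cancel h g by case.
  have := bbm_independent hB (s := map h s) (A := A \o g).
  rewrite map_inj_uniq; last exact: can_inj hK.
  move=> /(_ us)/=; rewrite big_map.
  under eq_bigr do rewrite hK.
  move=> <-.
    congr (P _); apply/seteqP; split => w Aw i /=.
      by move=> /mapP[j js ->]; rewrite hK; exact: Aw.
    move=> si; have := Aw (h i); rewrite /= hK; apply.
    by apply/mapP; exists i.
  move=> i /mapP[j js ->]; rewrite hK; have := FA _ js.
  by case: j {js}.
Qed.

Lemma bbm_sigma_measurable i : F i `<=` measurable.
Proof.
have mrv (X : {RV P >-> R}) : sigma_rv X `<=` measurable.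
  by move=> _ [A mA <-]; exact: measurable_funP.
case: i => u //=; apply: smallest_sub; first exact: sigma_algebra_measurable.
by move=> A [t _]; exact: mrv.
Qed.

Lemma bbm_sigmaI i : setI_closed (F i).
Proof.
case: i => u /=.
  move=> _ _ [A mA <-] [A' mA' <-]; exists (A `&` A'); first exact: measurableI.
  by rewrite !setTI preimage_setI.
move=> A A' sA sA'; rewrite /sigma_process in sA sA' *.
exact: (@measurableI _ (g_sigma_algebraType _) A A').
Qed.

Lemma measurable_lifetime J u : J (inl u) ->
  measurable_fun [set: g_sigma_algebraType (gen J)] (tau u).
Proof.
move=> Ju _ A mA; apply: sub_sigma_algebra; exists (inl u) => //.
by exists A.
Qed.

Lemma measurable_motion J u t : J (inr u) -> 0 <= t ->
  measurable_fun [set: g_sigma_algebraType (gen J)] (B u t).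
Proof.
move=> Ju t0 _ A mA; apply: sub_sigma_algebra; exists (inr u) => //=.
apply: sub_sigma_algebra; exists t; first by rewrite /= in_itv/= t0.
by exists A.
Qed.

(** The outcome is measured by the sigma-algebra of the group [J] alone, jointly with the age; this
    lets [integral_split] freeze a lifetime from another group and insert it as the age. *)
Lemma measurable_motion2 J u : J (inr u) ->
  measurable_fun [set: R * g_sigma_algebraType (gen J)]
    (fun p => B u (Num.max p.1 0) p.2).
Proof.
move=> Ju.
apply: (@measurable_continuous_process _ (g_sigma_algebraType (gen J)) R
  (fun t w => B u t w)).
  by move=> t t0; exact: measurable_motion.
by move=> w; exact: bm_continuous (bbm_motion hB u) w.
Qed.

Lemma measurable_motion2T u :
  measurable_fun [set: R * T] (fun p => B u (Num.max p.1 0) p.2).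
Proof.
apply: (measurable_continuous_process (X := fun t w => B u t w)).
  by move=> t t0; exact: measurable_funP.
by move=> w; exact: bm_continuous (bbm_motion hB u) w.
Qed.

Lemma gen_measurable J (A : set T) : <<s gen J >> A -> measurable A.
Proof.
apply: smallest_sub; first exact: sigma_algebra_measurable.
by move=> C [i _]; exact: bbm_sigma_measurable.
Qed.

Lemma bbm_split J1 J2 A C : J1 `&` J2 = set0 -> <<s gen J1 >> A ->
  <<s gen J2 >> C -> P (A `&` C) = (P A * P C)%E.
Proof.
move=> J12; apply: mutually_independent_split => //.
- exact: bbm_sigmaI.
- exact: bbm_sigma_measurable.
- exact: bbm_independent hB.
Qed.

Lemma integral_split J1 J2 d' (Y : measurableType d') (X : T -> Y)
    (f : (Y * g_sigma_algebraType (gen J2))%type -> \bar R) :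
  J1 `&` J2 = set0 ->
  measurable_fun [set: g_sigma_algebraType (gen J1)] X ->
  measurable_fun setT f -> (forall p, 0 <= f p)%E ->
  (\int[P]_w f (X w, w) = \int[P]_w \int[P]_w' f (X w, w'))%E.
Proof.
move=> J12 mX mf f0.
apply: (@indep_integral _ _ _ _ _ (g_sigma_algebraType (gen J2)) _ P X id) => //.
- by move=> _ A mA; apply: (@gen_measurable J1); exact: mX.
- by move=> _ A mA; rewrite setTI preimage_id; exact: (@gen_measurable J2).
- move=> A C mA mC; apply: (bbm_split J12); last exact: mC.
  by rewrite -[_ @^-1` _]setTI; exact: mX.
Qed.

End one_system.
End bbm.

(** * Decomposition at the first branching *)

Section renewal.
Context d (T : measurableType d) (R : realType) (P : probability T R).
Local Open Scope ereal_scope.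

Lemma measurable_natb d' (S : measurableType d') (b : S -> bool) :
  measurable_fun setT b -> measurable_fun setT (fun w => ((b w)%:R : R)%:E).
Proof.
move=> mb; apply/measurable_EFinP.
rewrite (_ : (fun _ => _) = (fun q => if b q then 1%R else 0%R)); last first.
  by apply/funext => q; case: (b q).
exact: measurable_fun_ifT.
Qed.

Definition tail n (tau : seq bool -> {RV P >-> R}) (B : seq bool -> R -> {RV P >-> R})
    (t x : R) : R :=
  fine (P [set w | ~~ below n (fun u => tau u) (fun u => B u) t x w]).

Lemma measurable_belowT n (tau : seq bool -> {RV P >-> R})
    (B : seq bool -> R -> {RV P >-> R}) :
  branching_brownian_motion tau B ->
  measurable_fun setT (fun p : R * R * T =>
    below n (fun u => tau u) (fun u => B u) p.1.1 p.1.2 p.2).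
Proof.
move=> hB; apply: measurable_below => //.
- by move=> u; exact: (measurable_motion2T hB).
- by apply: measurableT_comp.
- by apply: measurableT_comp.
Qed.

Lemma measurable_below_set n (tau : seq bool -> {RV P >-> R})
    (B : seq bool -> R -> {RV P >-> R}) t x :
  branching_brownian_motion tau B ->
  measurable [set w | below n (fun u => tau u) (fun u => B u) t x w].
Proof.
move=> hB; rewrite -[X in measurable X]setTI.
have : measurable_fun setT (fun w => below n (fun u => tau u) (fun u => B u) t x w).
  apply: measurable_below => //.
  by move=> u; exact: (measurable_motion2T hB).
exact.
Qed.

Lemma tailE n (tau : seq bool -> {RV P >-> R}) (B : seq bool -> R -> {RV P >-> R}) t x :
  branching_brownian_motion tau B ->
  (tail n tau B t x)%:E =
    P [set w | ~~ below n (fun u => tau u) (fun u => B u) t x w].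
Proof.
move=> hB; rewrite fineK// fin_num_measure//.
rewrite (_ : [set _ | _] =
  ~` [set w | below n (fun u => tau u) (fun u => B u) t x w]).
  by apply: measurableC; exact: measurable_below_set.
by apply/seteqP; split => w /= /negP.
Qed.

Lemma tailC n (tau : seq bool -> {RV P >-> R}) (B : seq bool -> R -> {RV P >-> R}) t x :
  branching_brownian_motion tau B ->
  P [set w | below n (fun u => tau u) (fun u => B u) t x w] =
  (1 - tail n tau B t x)%R%:E.
Proof.
move=> hB; rewrite EFinB tailE//.
rewrite (_ : [set w | ~~ _] =
  ~` [set w | below n (fun u => tau u) (fun u => B u) t x w]).
  rewrite probability_setC; last exact: measurable_below_set.
  rewrite oppeB ?fin_num_adde_defl// ?addeA ?subee ?add0e//.
  by rewrite ?fin_numN fin_num_measure//; exact: measurable_below_set.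
by apply/seteqP; split => w /= /negP.
Qed.

Lemma tail01 n (tau : seq bool -> {RV P >-> R}) (B : seq bool -> R -> {RV P >-> R}) t x :
  branching_brownian_motion tau B -> (0 <= tail n tau B t x <= 1)%R.
Proof.
move=> hB; rewrite fine_ge0//= -lee_fin tailE//.
apply: probability_le1.
rewrite (_ : [set _ | _] =
  ~` [set w | below n (fun u => tau u) (fun u => B u) t x w]).
  by apply: measurableC; exact: measurable_below_set.
by apply/seteqP; split => w /= /negP.
Qed.

Lemma measurable_tail n (tau : seq bool -> {RV P >-> R})
    (B : seq bool -> R -> {RV P >-> R}) :
  branching_brownian_motion tau B ->
  measurable_fun setT (fun p : R * R => tail n tau B p.1 p.2).
Proof.
move=> hB; apply/measurable_EFinP.
rewrite (_ : EFin \o _ = (fun p : R * R => \int[P]_w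
   ((~~ below n (fun u => tau u) (fun u => B u) p.1 p.2 w)%:R : R)%:E)).
  apply: (@measurable_fun_fubini_tonelli_F _ _ _ _ _ P (fun q : R * R * T =>
   ((~~ below n (fun u => tau u) (fun u => B u) q.1.1 q.1.2 q.2)%:R : R)%:E)) => //.
  by apply: measurable_natb; apply: measurable_neg; exact: measurable_belowT.
apply/funext => p /=; rewrite tailE// ge0_integral_bool//.
apply: measurable_neg; apply: measurable_below => //.
by move=> u; exact: (measurable_motion2T hB).
Qed.

(** Independence is used three times: the root lifetime against everything else, then, for a frozen
    lifetime, the root motion against the two subtrees, then one subtree against the other. *)
Lemma renewal_split n (tau : seq bool -> {RV P >-> R})
    (B : seq bool -> R -> {RV P >-> R}) t x :
  branching_brownian_motion tau B -> (0 <= t)%R ->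
  (tail n.+1 tau B t x)%:E = \int[P]_w
    if (t < tau [::] w)%R then P [set w' | (x < B [::] t w')%R]
    else \int[P]_w' (1 -
      (1 - tail n (fun u => tau (false :: u)) (fun u => B (false :: u))
             (t - tau [::] w) (x - B [::] (tau [::] w) w')) *
      (1 - tail n (fun u => tau (true :: u)) (fun u => B (true :: u))
             (t - tau [::] w) (x - B [::] (tau [::] w) w')))%R%:E.
Proof.
move=> hB t0; rewrite tailE// -ge0_integral_bool; last first.
  apply: measurable_neg; apply: measurable_below => //.
  by move=> u; exact: (measurable_motion2T hB).
pose J1 : set (seq bool + seq bool)%type := [set inl [::]].
pose J2 : set (seq bool + seq bool)%type := ~` J1.
pose S2 := g_sigma_algebraType (\bigcup_(i in J2) bbm_sigma tau B i).
pose f (p : R * S2) := ((~~ (if (t < p.1)%R then (B [::] (Num.max t 0) p.2 <= x)%R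
  else let y := B [::] (Num.max p.1 0)%R p.2 in
   below n (fun u => tau (false :: u)) (fun u => B (false :: u)) (t - p.1) (x - y) p.2
   && below n (fun u => tau (true :: u)) (fun u => B (true :: u)) (t - p.1) (x - y) p.2))%:R : R)%:E.
have mB2 : measurable_fun [set: R * S2] (fun p => B [::] (Num.max p.1 0)%R p.2).
  exact: (measurable_motion2 hB).
have mbel b : measurable_fun [set: R * S2] (fun p => below n (fun u => tau (b :: u))
   (fun u => B (b :: u)) (t - p.1) (x - B [::] (Num.max p.1 0)%R p.2) p.2).
  apply: (@measurable_below _ _ S2) => //.
  - by move=> u; apply: measurable_lifetime.
  - by move=> u; apply: (measurable_motion2 hB).
  - exact: measurable_funB.
  - exact: measurable_funB.
transitivity (\int[P]_w f (tau [::] w, w)) => //.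
rewrite (@integral_split _ _ _ _ _ _ hB J1 J2 _ _ (tau [::]) f (setICr _)) //; last 3 first.
- exact: measurable_lifetime.
- apply: measurable_natb; apply: measurable_neg; apply: measurable_fun_ifT.
  + exact: measurable_fun_ltr.
  + apply: measurable_fun_ler => //.
    have mBt : measurable_fun [set: S2] (B [::] (Num.max t 0%R)).
      by apply: measurable_motion; rewrite // le_max lexx orbT.
    exact: (measurableT_comp mBt (@measurable_snd _ _ R S2)).
  + by apply: measurable_and.
- by move=> p; rewrite /f lee_fin ler0n.
apply: eq_integral => w _; rewrite /f/=.
case: ltP => tt.
  rewrite (max_idPl t0) ge0_integral_bool.
    by congr (P _); apply/seteqP; split => w' /=; rewrite ltNge.
  by apply: measurable_neg; apply: measurable_fun_ler => //; exact: measurable_funP.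
have s0 : (0 <= tau [::] w)%R by exact: (bbm_lifetime_ge0 hB).
rewrite (max_idPl s0).
set s := tau [::] w in tt s0 *.
pose J3 : set (seq bool + seq bool)%type := [set inr [::]].
pose Js b : set (seq bool + seq bool)%type :=
  [set i | exists u, i = inl (b :: u) \/ i = inr (b :: u)].
pose J4 := Js false `|` Js true.
pose S4 := g_sigma_algebraType (\bigcup_(i in J4) bbm_sigma tau B i).
have J4b b u : J4 (inl (b :: u)) /\ J4 (inr (b :: u)).
  by split; case: b; [right|left|right|left]; exists u; [left|left|right|right].
pose g (p : R * S4) := ((~~ (
   below n (fun u => tau (false :: u)) (fun u => B (false :: u)) (t - s) (x - p.1) p.2
   && below n (fun u => tau (true :: u)) (fun u => B (true :: u)) (t - s) (x - p.1) p.2))%:R : R)%:E.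
transitivity (\int[P]_w' g (B [::] s w', w')) => //.
have J34 : J3 `&` J4 = set0 by apply/seteqP; split => // i [/= ->] [] [u []].
rewrite (@integral_split _ _ _ _ _ _ hB J3 J4 _ _ (B [::] s) g J34) //; last 3 first.
- exact: measurable_motion.
- apply: measurable_natb; apply: measurable_neg; apply: measurable_and;
  (apply: (@measurable_below _ _ S4) => //;
    [by move=> u; apply: measurable_lifetime; exact: (J4b _ u).1
    |by move=> u; apply: (measurable_motion2 hB); exact: (J4b _ u).2
    |exact: measurable_funB]).
- by move=> p; rewrite /g lee_fin ler0n.
apply: eq_integral => w' _; rewrite /g/=.
set y := B [::] s w'.
have mbT b : measurable [set w0 | below n (fun u => tau (b :: u)) (fun u => B (b :: u))
   (t - s) (x - y) w0].
  exact: (measurable_below_set _ _ _ (sub_bbm hB b)).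
rewrite ge0_integral_bool; last first.
  by apply: measurable_neg; apply: measurable_and; apply: (measurable_fun_bool true);
    rewrite setTI; exact: mbT.
pose A b := [set w0 | below n (fun u => tau (b :: u)) (fun u => B (b :: u))
   (t - s) (x - y) w0].
rewrite (_ : [set w0 | _] = ~` (A false `&` A true)); last first.
  apply/seteqP; split => w0 /=; first by move=> /negP H [b1 b2]; apply: H; rewrite b1.
  by move=> H; apply/negP => /andP.
transitivity (1 - P (A false `&` A true)).
  by apply: probability_setC; apply: measurableI; exact: mbT.
have Jft : Js false `&` Js true = set0.
  by apply/seteqP; split => // i [[u +] [u']]; case: i => i [] // [->] [].
rewrite (@bbm_split _ _ _ _ _ _ hB (Js false) (Js true) _ _ Jft); last 2 first.
- have : measurable_fun [set: g_sigma_algebraType (\bigcup_(i in Js false) bbm_sigma tau B i)]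
    (fun w => below n (fun u => tau (false :: u)) (fun u => B (false :: u)) (t - s) (x - y) w).
    apply: (@measurable_below _ _ (g_sigma_algebraType (\bigcup_(i in Js false) bbm_sigma tau B i))) => //.
    + by move=> u; apply: measurable_lifetime; exists u; left.
    + by move=> u; apply: (measurable_motion2 hB); exists u; right.
  by move=> /(_ measurableT [set true] I); rewrite setTI.
- have : measurable_fun [set: g_sigma_algebraType (\bigcup_(i in Js true) bbm_sigma tau B i)]
    (fun w => below n (fun u => tau (true :: u)) (fun u => B (true :: u)) (t - s) (x - y) w).
    apply: (@measurable_below _ _ (g_sigma_algebraType (\bigcup_(i in Js true) bbm_sigma tau B i))) => //.
    + by move=> u; apply: measurable_lifetime; exists u; left.
    + by move=> u; apply: (measurable_motion2 hB); exists u; right.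
  by move=> /(_ measurableT [set true] I); rewrite setTI.
have PA b : P (A b) = (1 - tail n (fun u => tau (b :: u)) (fun u => B (b :: u))
    (t - s) (x - y))%R%:E.
  by rewrite tailC//; exact: sub_bbm.
by rewrite !PA.
Qed.

End renewal.

Section law.
Context d (T : measurableType d) (R : realType) (P : probability T R).
Local Open Scope ereal_scope.

Lemma brownian_law (b : R -> {RV P >-> R}) (t : R) (A : set R) :
  standard_brownian_motion b -> (0 < t)%R -> measurable A ->
  distribution P (b t) A = normal_prob 0 (Num.sqrt t) A.
Proof.
move=> hb t0 mA; rewrite -[t in RHS]subr0 -(bm_gaussian hb (lexx _) t0 mA).
rewrite /distribution /pushforward; congr (P _).
by apply/funext => w /=; rewrite (bm_start hb) subr0.
Qed.

Lemma brownian_eq_law (b c : R -> {RV P >-> R}) (t : R) (f : R -> \bar R) :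
  standard_brownian_motion b -> standard_brownian_motion c -> (0 <= t)%R ->
  measurable_fun setT f -> (forall x, 0 <= f x) ->
  \int[P]_w f (b t w) = \int[P]_w f (c t w).
Proof.
move=> hb hc; rewrite le_eqVlt => /predU1P[<-|t0] mf f0.
  by apply: eq_integral => w _; rewrite (bm_start hb) (bm_start hc).
rewrite -[LHS](ge0_integral_distribution (b t) mf f0).
rewrite -[RHS](ge0_integral_distribution (c t) mf f0).
apply: eq_measure_integral => A mA _.
by rewrite [LHS](brownian_law hb)// [RHS](brownian_law hc).
Qed.

Lemma brownian_ge0_integral (b : R -> {RV P >-> R}) (t : R) (f : R -> \bar R) :
  standard_brownian_motion b -> (0 < t)%R ->
  measurable_fun setT f -> (forall x, 0 <= f x) ->
  \int[P]_w f (b t w) =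
  \int[lebesgue_measure]_y (f y * (normal_pdf 0 (Num.sqrt t) y)%:E).
Proof.
move=> hb t0 mf f0.
rewrite -[LHS](ge0_integral_distribution (b t) mf f0).
apply: ge0_integral_lebesgue_density => //.
- exact: measurable_normal_pdf.
- by move=> x; exact: normal_pdf_ge0.
- by move=> A mA; rewrite [LHS](brownian_law hb).
Qed.

End law.

Lemma integral_exp_tail {R : realType} (t : R) :
  (\int[lebesgue_measure]_(s in `[t, +oo[) (expR (- s))%:E = (expR (- t))%:E)%E.
Proof.
rewrite (@ge0_continuous_FTC2y _ _ (fun s => - expR (- s)) _ 0).
- by rewrite EFinN oppeK add0e.
- by move=> s _; exact: expR_ge0.
- apply: continuous_subspaceT => s; apply: continuous_comp; last exact: continuous_expR.
  exact: (@continuousN _ R^o).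
- by rewrite -oppr0; apply: cvgN; exact: cvgr_expR.
- by move=> s _; exact: ex_derive.
- apply: cvg_at_right_filter; apply: cvgN.
  apply: continuous_comp; last exact: continuous_expR.
  exact: (@continuousN _ R^o).
- move=> s _; rewrite derive1E.
  by rewrite derive_val; rewrite /GRing.scale/= mulrN1 opprK.
Qed.

Section renewal_equation.
Context d (T : measurableType d) (R : realType) (P : probability T R).
Variables (tau : seq bool -> {RV P >-> R}) (B : seq bool -> R -> {RV P >-> R}).
Hypothesis hB : branching_brownian_motion tau B.
Local Open Scope ereal_scope.
Local Notation mu := (@lebesgue_measure R).

Definition root_motion (s : R) (w : T) : R := B [::] (Num.max s 0%R) w.
Local Notation W := root_motion.

Lemma measurable_root_motion2 : measurable_fun setT (fun p : R * T => W p.1 p.2).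
Proof. exact: (measurable_motion2T hB). Qed.

Lemma measurable_root_motion s : measurable_fun setT (W s).
Proof. exact: measurable_funP. Qed.

Local Notation tl n := (tail n tau B).

Definition branch (a : R) : R := (1 - (1 - a) * (1 - a))%R.

Lemma branch01 a : (0 <= a <= 1)%R -> (0 <= branch a <= 1)%R.
Proof. by move=> /andP[a0 a1]; rewrite /branch; apply/andP; split; nra. Qed.

Lemma measurable_branch : measurable_fun setT branch.
Proof.
by apply: measurable_funB => //; apply: measurable_funM; exact: measurable_funB.
Qed.

Lemma measurable_motion_average (f : R -> R -> R) (t x : R) :
  measurable_fun setT (fun p : R * R => f p.1 p.2) ->
  (forall t x, (0 <= f t x)%R) ->
  measurable_fun setT (fun s : R => \int[P]_w (f (t - s) (x - W s w))%:E).
Proof.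
move=> mf f0.
apply: (@measurable_fun_fubini_tonelli_F _ _ _ _ _ P (fun q : R * T =>
  (f (t - q.1) (x - W q.1 q.2))%:E)).
  2: by move=> q; rewrite lee_fin.
apply/measurable_EFinP.
apply: (measurableT_comp mf (g := fun q : R * T => ((t - q.1)%R, (x - W q.1 q.2)%R))).
apply: measurable_fun_pair; first exact: measurable_funB.
apply: measurable_funB => //; exact: measurable_root_motion2.
Qed.

Let Phi n t x s := if (t < s)%R then P [set w | (x < W t w)%R]
  else \int[P]_w (branch (tl n (t - s) (x - W s w)))%:E.

Let Phi_measurable n t x : measurable_fun setT (Phi n t x).
Proof.
apply: measurable_fun_ifT => //; first exact: measurable_fun_ltr.
apply: (measurable_motion_average (f := fun t x => branch (tl n t x))).
  exact: (measurableT_comp measurable_branch (measurable_tail n hB)).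
by move=> a b; have /andP[] := branch01 (tail01 n a b hB).
Qed.

Let Phi_ge0 n t x s : 0 <= Phi n t x s.
Proof.
rewrite /Phi; case: ifP => // _; apply: integral_ge0 => w _; rewrite lee_fin.
by case/andP: (branch01 (tail01 n (t - s) (x - W s w) hB)).
Qed.

(** The left-hand side allows any branching Brownian motion, the right-hand side only mentions the
    reference system: root lifetime and root motion enter through their prescribed laws alone. *)
Let tail_density n :
  (forall (tau' : seq bool -> {RV P >-> R}) (B' : seq bool -> R -> {RV P >-> R}) t x,
    branching_brownian_motion tau' B' -> (0 <= t)%R ->
    tail n tau' B' t x = tl n t x) ->
  forall (tau' : seq bool -> {RV P >-> R}) (B' : seq bool -> R -> {RV P >-> R}) t x,
    branching_brownian_motion tau' B' -> (0 <= t)%R ->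
  (tail n.+1 tau' B' t x)%:E =
    \int[mu]_s (Phi n t x s * (exponential_pdf 1 s)%:E).
Proof.
move=> IH tau' B' t x hB' t0; rewrite renewal_split//.
transitivity (\int[P]_w Phi n t x (tau' [::] w)).
  apply: eq_integral => w _; rewrite /Phi; case: ltP => tt.
    rewrite -[LHS]ge0_integral_bool; last first.
      by apply: measurable_fun_ltr => //; exact: measurable_funP.
    rewrite -[RHS]ge0_integral_bool; last first.
      by apply: measurable_fun_ltr => //; exact: measurable_root_motion.
    rewrite /W (max_idPl t0).
    apply: (brownian_eq_law (f := fun y => (((x < y)%R)%:R : R)%:E)) => //.
    - exact: (bbm_motion hB').
    - exact: (bbm_motion hB).
    - by apply: measurable_natb; exact: measurable_fun_ltr.
  have s0 := bbm_lifetime_ge0 hB' [::] w.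
  rewrite /W (max_idPl s0).
  have ts : (0 <= t - tau' [::] w)%R by rewrite subr_ge0.
  transitivity (\int[P]_w' (branch (tl n (t - tau' [::] w) (x - B' [::] (tau' [::] w) w')))%:E).
    apply: eq_integral => w' _; rewrite /branch.
    by rewrite !IH//; exact: sub_bbm.
  apply: (brownian_eq_law (f := fun y => (branch (tl n (t - tau' [::] w) (x - y)))%:E)) => //.
  - exact: (bbm_motion hB').
  - exact: (bbm_motion hB).
  - apply/measurable_EFinP/(measurableT_comp measurable_branch).
    apply: (measurableT_comp (measurable_tail n hB) (g := fun y : R =>
      ((t - tau' [::] w)%R, (x - y)%R))).
    by apply: measurable_fun_pair => //; exact: measurable_funB.
  - by move=> y; rewrite lee_fin; case/andP: (branch01 (tail01 n (t - tau' [::] w) (x - y) hB)).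
rewrite -[LHS](ge0_integral_distribution (tau' [::])) //.
apply: ge0_integral_lebesgue_density => //.
- exact: measurable_exponential_pdf.
- by move=> s; exact: exponential_pdf_ge0.
- exact: (bbm_lifetime hB').
Qed.

(** The two subtrees are branching Brownian motions of their own; equality of tails closes the
    renewal equation on a single function. *)
Lemma tail_law n (tau' : seq bool -> {RV P >-> R})
    (B' : seq bool -> R -> {RV P >-> R}) t x : branching_brownian_motion tau' B' ->
  (0 <= t)%R -> tail n tau' B' t x = tl n t x.
Proof.
elim: n tau' B' t x => [//|n IH] tau' B' t x hB' t0.
by apply: EFin_inj; rewrite !(tail_density IH).
Qed.

Lemma renewal n t x : (0 <= t)%R ->
  (tl n.+1 t x)%:E = (expR (- t))%:E * P [set w | (x < W t w)%R] +
   \int[mu]_(s in `[0%R, t]) ((expR (- s))%:E *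
       \int[P]_w (branch (tl n (t - s) (x - W s w)))%:E).
Proof.
move=> t0; rewrite (tail_density (@tail_law n))//.
have mPe : measurable_fun setT (fun s => Phi n t x s * (exponential_pdf 1 s)%:E).
  apply: emeasurable_funM => //; apply/measurable_EFinP.
  exact: measurable_exponential_pdf.
have Pe0 s : 0 <= Phi n t x s * (exponential_pdf 1 s)%:E.
  by rewrite mule_ge0// lee_fin exponential_pdf_ge0.
rewrite -(setUv [set` `]-oo, t]]) ge0_integral_setU//=; last 3 first.
- exact: measurableC.
- by rewrite setUv.
- exact/disj_setPCl.
rewrite addeC; congr (_ + _).
  rewrite setCitvl.
  transitivity (\int[mu]_(s in `]t, +oo[) (P [set w | (x < W t w)%R] *
      (exponential_pdf 1 s)%:E)).
    by apply: eq_integral => s; rewrite inE/= in_itv/= andbT /Phi => ->.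
  have mE : measurable_fun setT (fun s : R => (exponential_pdf 1 s)%:E).
    by apply/measurable_EFinP; exact: measurable_exponential_pdf.
  rewrite ge0_integralZl//; last 2 first.
  - exact: measurable_funTS.
  - by move=> s _; rewrite lee_fin exponential_pdf_ge0.
  rewrite muleC; congr (_ * _).
  rewrite -(integral_exp_tail t) -integral_itv_obnd_cbnd//; last first.
    by apply/measurable_EFinP/measurable_funTS/measurableT_comp.
  apply: eq_integral => s; rewrite inE/= in_itv/= andbT => ts.
  by rewrite exponential_pdfE ?mul1r ?mulN1r// (le_trans t0)// ltW.
(* The exponential density vanishes at negative ages, which cuts []-oo, t]] down to [[0, t]]. *)
rewrite integral_mkcond [RHS]integral_mkcond; apply: eq_integral => s _.
rewrite !patchE !mem_setE !in_itv/=; case: (leP s t) => st; rewrite ?andbF//= andbT.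
case: leP => s0.
  by rewrite exponential_pdfE// mul1r mulN1r muleC /Phi ltNge st.
by rewrite lt0_exponential_pdf// mule0.
Qed.

End renewal_equation.

(** * Passage to all generations *)

Section survival.
Context d (T : measurableType d) (R : realType) (P : probability T R).
Variables (tau : seq bool -> {RV P >-> R}) (B : seq bool -> R -> {RV P >-> R}).
Hypothesis hB : branching_brownian_motion tau B.
Local Open Scope ereal_scope.
Local Notation mu := (@lebesgue_measure R).
Local Notation W := (root_motion B).
Local Notation tl n := (tail n tau B).

Lemma belowS (n : nat) (tau' : seq bool -> T -> R) (B' : seq bool -> R -> T -> R)
    (t x : R) w : below n.+1 tau' B' t x w =
  if (t < tau' [::] w)%R then (B' [::] (Num.max t 0) w <= x)%R
  else let s := tau' [::] w in let y := B' [::] (Num.max s 0%R) w in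
    below n (fun u => tau' (false :: u)) (fun u => B' (false :: u)) (t - s) (x - y) w
    && below n (fun u => tau' (true :: u)) (fun u => B' (true :: u)) (t - s) (x - y) w.
Proof. by []. Qed.

Lemma below_succ (n : nat) (tau' : seq bool -> T -> R) (B' : seq bool -> R -> T -> R)
    (t x : R) w : below n.+1 tau' B' t x w -> below n tau' B' t x w.
Proof.
elim: n tau' B' t x => [//|n IH] tau' B' t x.
rewrite (belowS n.+1) (belowS n).
by case: ifP => // _ /andP[/IH b1 /IH b2]; apply/andP.
Qed.

Lemma below_le (n : nat) (tau' : seq bool -> T -> R) (B' : seq bool -> R -> T -> R)
    (t x y : R) w : (x <= y)%R -> below n tau' B' t x w -> below n tau' B' t y w.
Proof.
elim: n tau' B' t x y => [//|n IH] tau' B' t x y xy /=.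
case: ifP => [_ /le_trans|_ /andP[b1 b2]]; first exact.
by apply/andP; split; [apply: IH b1|apply: IH b2]; rewrite lerB.
Qed.

Let above n t x := [set w | ~~ below n (fun u => tau u) (fun u => B u) t x w].

(** Labels are finite words, so a particle above [x] is seen by some truncation; as the union is
    increasing, the renewal equation passes to it by monotone convergence. *)
Definition surv (t x : R) : R := fine (P (\bigcup_n above n t x)).

Let above_measurable n t x : measurable (above n t x).
Proof.
rewrite (_ : above n t x =
  ~` [set w | below n (fun u => tau u) (fun u => B u) t x w]).
  by apply: measurableC; exact: measurable_below_set.
by apply/seteqP; split => w /= /negP.
Qed.

Let above_nd t x : nondecreasing_seq (fun n => above n t x).
Proof.
by apply/nondecreasing_seqP => n; apply/subsetPset => w; apply: contra; exact: below_succ.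
Qed.

Lemma survE t x : (surv t x)%:E = P (\bigcup_n above n t x).
Proof. by rewrite fineK// fin_num_measure//; exact: bigcupT_measurable. Qed.

Lemma tail_cvg t x : tl n t x @[n --> \oo] --> surv t x.
Proof.
have : P (above n t x) @[n --> \oo] --> P (\bigcup_n above n t x).
  by apply: nondecreasing_cvg_mu => //; exact: bigcupT_measurable.
rewrite -survE => /fine_cvgP[_]; exact.
Qed.

Lemma tail_nd t x : nondecreasing_seq (fun n => tl n t x).
Proof.
move=> m n mn; rewrite -lee_fin !tailE//; apply: le_measure; rewrite ?inE; try exact: above_measurable.
exact/subsetPset/above_nd.
Qed.

Lemma surv01 t x : (0 <= surv t x <= 1)%R.
Proof.
by rewrite fine_ge0//= -lee_fin survE probability_le1//; exact: bigcupT_measurable.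
Qed.

Lemma measurable_surv : measurable_fun setT (fun p : R * R => surv p.1 p.2).
Proof.
apply: (measurable_fun_cvg (h := fun n p => tl n p.1 p.2)).
  by move=> n; exact: measurable_tail.
by move=> p _; exact: tail_cvg.
Qed.

Lemma surv_noninc t x y : (x <= y)%R -> (surv t y <= surv t x)%R.
Proof.
move=> xy; rewrite -lee_fin !survE le_measure ?inE//; try exact: bigcupT_measurable.
by apply: subset_bigcup => n _ w; apply: contra; exact: below_le.
Qed.

Lemma measurable_rightmost_set t x : (0 <= t)%R ->
  P [set w | rightmost tau B t w <= x%:E] = (1 - surv t x)%R%:E.
Proof.
move=> t0; rewrite EFinB survE.
rewrite (_ : [set _ | _] = ~` \bigcup_n above n t x).
  by apply: probability_setC; exact: bigcupT_measurable.
rewrite setC_bigcup; apply/seteqP; split => w /=.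
  move=> Mx n _; rewrite /above /= => /negP; apply.
  apply/belowP => //; first exact: (bbm_lifetime_ge0 hB).
  move=> u _ ua; rewrite -lee_fin (le_trans _ Mx)//.
  by apply: ereal_sup_ubound; exists u.
move=> H; apply: ge_ereal_sup => _ [u ua <-]; rewrite lee_fin.
have hp := @belowP _ _ _ P (size u).+1 tau B t x w (bbm_lifetime_ge0 hB) t0.
by have /negP := H (size u).+1 I; rewrite negbK => /hp; exact.
Qed.

Lemma renewal_surv t x : (0 <= t)%R ->
  (surv t x)%:E = (expR (- t))%:E * P [set w | (x < W t w)%R] +
   \int[mu]_(s in `[0%R, t]) ((expR (- s))%:E *
       \int[P]_w (branch (surv (t - s) (x - W s w)))%:E).
Proof.
move=> t0.
(* Monotonicity of [branch] on [0, 1] makes both integrands nondecreasing in the generation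
   bound. *)
have branch_nd (a b : R) : (0 <= a)%R -> (a <= b)%R -> (b <= 1)%R -> (branch a <= branch b)%R.
  by rewrite /branch => *; nra.
have tl0 n r y : (0 <= tl n r y)%R by case/andP: (tail01 n r y hB).
have tl1 n r y : (tl n r y <= 1)%R by case/andP: (tail01 n r y hB).
have br0 n r y : (0 <= branch (tl n r y))%R by case/andP: (branch01 (tail01 n r y hB)).
have mtl n : measurable_fun setT (fun s : R =>
    \int[P]_w (branch (tl n (t - s) (x - W s w)))%:E).
  apply: (measurable_motion_average hB (f := fun t x => branch (tl n t x))) => //.
  exact: (measurableT_comp (@measurable_branch R) (measurable_tail n hB)).
have mx s : measurable_fun setT (fun w => (x - W s w)%R).
  by apply: measurable_funB => //; exact: measurable_root_motion.
have mbr n s : measurable_fun setT (fun w => (branch (tl n (t - s) (x - W s w)))%:E).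
  apply/measurable_EFinP/(measurableT_comp (@measurable_branch R)).
  apply: (measurableT_comp (measurable_tail n hB) (g := fun w => ((t - s)%R, (x - W s w)%R))).
  exact: measurable_fun_pair.
have br_cvg s w : (branch (tl n (t - s) (x - W s w)))%:E @[n --> \oo] -->
    (branch (surv (t - s) (x - W s w)))%:E.
  apply: cvg_EFin; first by near=> n.
  have h := @tail_cvg (t - s)%R (x - W s w)%R.
  by rewrite /branch; apply: cvgB; [exact: cvg_cst|apply: cvgM; apply: cvgB => //; exact: cvg_cst].
have int_cvg s : \int[P]_w (branch (tl n (t - s) (x - W s w)))%:E @[n --> \oo] -->
    \int[P]_w (branch (surv (t - s) (x - W s w)))%:E.
  rewrite (_ : \int[P]_w _ = \int[P]_w limn (fun n =>
    (branch (tl n (t - s) (x - W s w)))%:E)); last first.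
    by apply: eq_integral => w _; apply/esym/cvg_lim.
  apply: cvg_monotone_convergence => //.
  - by move=> n w _; rewrite lee_fin.
  - by move=> w _ m n mn; rewrite lee_fin branch_nd//; exact: tail_nd.
have L : (tl n.+1 t x)%:E @[n --> \oo] --> (surv t x)%:E.
  apply: cvg_EFin; first by near=> n.
  by have := @tail_cvg t x; rewrite -(cvg_shiftn 1); under eq_fun do rewrite addn1.
move: L; under eq_fun do rewrite (renewal hB)//.
move=> L; apply: (cvg_unique _ L); first exact: ereal_hausdorff.
apply: cvgeD.
- rewrite ge0_adde_def// inE.
    by rewrite mule_ge0// lee_fin expR_ge0.
  apply: integral_ge0 => s _; rewrite mule_ge0 ?lee_fin ?expR_ge0//.
  apply: integral_ge0 => w _; rewrite lee_fin.
  by case/andP: (branch01 (surv01 (t - s)%R (x - W s w)%R)).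
- exact: cvg_cst.
rewrite (_ : \int[mu]_(s in _) _ = \int[mu]_(s in `[0%R, t]) limn (fun n =>
   (expR (- s))%:E * \int[P]_w (branch (tl n (t - s) (x - W s w)))%:E)); last first.
  apply: eq_integral => s _; apply/esym/cvg_lim => //.
  by apply: cvgeZl => //; exact: int_cvg.
apply: cvg_monotone_convergence => //.
- move=> n; apply: measurable_funTS; apply: emeasurable_funM; last exact: mtl.
  by apply/measurable_EFinP/measurableT_comp => //; exact: measurableT_comp.
- move=> n s _; rewrite mule_ge0 ?lee_fin ?expR_ge0//.
  by apply: integral_ge0 => w _; rewrite lee_fin.
- move=> s _ m n mn; rewrite lee_wpmul2l ?lee_fin ?expR_ge0//.
  apply: ge0_le_integral => //.
  - by move=> w _; rewrite lee_fin.
  - by move=> w _; rewrite lee_fin branch_nd//; exact: tail_nd.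
Unshelve. all: by end_near. Qed.

Lemma root_motion0 w : W 0 w = 0%R.
Proof. by rewrite /root_motion maxxx (bm_start (bbm_motion hB _)). Qed.

Lemma root_motion_semigroup (s t : R) (f : R -> \bar R) :
  (0 <= s)%R -> (0 <= t)%R -> measurable_fun setT f -> (forall x, 0 <= f x) ->
  \int[P]_w \int[P]_w' f (W s w + W t w')%R = \int[P]_w f (W (s + t)%R w).
Proof.
move=> s0; rewrite le_eqVlt => /predU1P[<-|t0] mf f0.
  apply: eq_integral => w _; rewrite addr0.
  under eq_integral do rewrite root_motion0 addr0.
  by rewrite integral_cst//; rewrite [X in _ * X](@probability_setT _ _ _ P) mule1.
have st : (0 <= s + t)%R by rewrite addr_ge0// ltW.
have hb := bbm_motion hB [::].
pose b r := B [::] r.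
pose D0 : T -> R := (b (s + t) \- b s)%R.
have mD : measurable_fun setT D0.
  by apply: measurable_funB; exact: measurable_funP.
pose D : {mfun T >-> R} := HB.pack D0 (isMeasurableFun.Build _ _ _ _ _ mD).
have WE r : (0 <= r)%R -> W r = b r :> (T -> R).
  by move=> r0; apply/funext => w; rewrite /root_motion (max_idPl r0).
rewrite !WE// ?(ltW t0)//.
transitivity (\int[P]_w f (b s w + D w)%R); last first.
  by apply: eq_integral => w _; rewrite /D/= addrC subrK.
transitivity (\int[P]_w \int[P]_w' f (b s w + D w')%R).
  apply: eq_integral => w _.
  have mfs : measurable_fun setT (fun y => f (b s w + y)%R).
    by apply: measurableT_comp => //; exact: measurable_funD.
  rewrite -[LHS](ge0_integral_distribution (b t) mfs)//.
  rewrite -[RHS](ge0_integral_distribution D mfs)//.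
  apply: eq_measure_integral => A mA _; rewrite [LHS](brownian_law hb)//.
  have := bm_gaussian hb s0 (t := (s + t)%R) _ mA.
  by rewrite ltrDl => /(_ t0); rewrite addrAC subrr add0r => h; exact: (esym h).
apply/esym; apply: (@indep_integral _ _ _ _ _ _ _ P (b s) D (fun p => f (p.1 + p.2)%R)) => //.
- move=> A C mA mC.
  (* The times are 0, s, s + t, s + t, and so on; increments 0 and 1 are [b s] and [D]. *)
  pose t_ (i : nat) : R := if i is i'.+1 then (if i' is _.+1 then (s + t)%R else s) else 0%R.
  have tnd : {homo t_ : i j / (i <= j)%N >-> (i <= j)%R}.
    by move=> [|[|i]] [|[|j]] //= _; rewrite lerDl ltW.
  pose A_ (i : nat) := if i is 0%N then b s @^-1` A else D @^-1` C.
  have bE : b s = (B [::] (t_ 1%N) \- B [::] (t_ 0%N))%R :> (T -> R).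
    by apply/funext => w /=; rewrite (bm_start hb) subr0.
  have := bm_independent hb (t_ := t_) (lexx _) tnd (s := [:: 0%N; 1%N]) (A := A_) isT.
  rewrite !big_cons big_nil mule1 => <-.
    congr (P _); apply/seteqP; split => [w [h1 h2] i /=|w H].
      by rewrite !inE => /orP[/eqP->|/eqP->].
    by split; [apply: (H 0%N)|apply: (H 1%N)].
  move=> i; rewrite !inE => /orP[/eqP->|/eqP->] /=.
    by exists A => //; rewrite setTI; exact: (congr1 (fun g => g @^-1` A) (esym bE)).
  by exists C => //; rewrite setTI.
- by apply: measurableT_comp => //; exact: measurable_funD.
Qed.

End survival.

(** * Markov inequalities for solutions of the renewal equation *)

Section markov.
Context d (T : measurableType d) (R : realType) (P : probability T R).
Variables (W : R -> T -> R) (u : R -> R -> R).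
Local Open Scope ereal_scope.
Local Notation mu := (@lebesgue_measure R).
Hypothesis mW2 : measurable_fun setT (fun p : R * T => W p.1 p.2).
Hypothesis mW : forall s, measurable_fun setT (W s).
Hypothesis WD : forall (s t : R) (f : R -> \bar R),
  (0 <= s)%R -> (0 <= t)%R -> measurable_fun setT f -> (forall x, 0 <= f x) ->
  \int[P]_w \int[P]_w' f (W s w + W t w')%R = \int[P]_w f (W (s + t)%R w).
Hypothesis mu2 : measurable_fun setT (fun p : R * R => u p.1 p.2).
Hypothesis u01 : forall t x, (0 <= u t x <= 1)%R.
Hypothesis u_renewal : forall t x, (0 <= t)%R ->
  (u t x)%:E = (expR (- t))%:E * P [set w | (x < W t w)%R] +
   \int[mu]_(s in `[0%R, t]) ((expR (- s))%:E *
       \int[P]_w (branch (u (t - s) (x - W s w)))%:E).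

Let br t x : R := branch (u t x).

Let br01 t x : (0 <= br t x <= 1)%R. Proof. exact: branch01. Qed.

Let br0 t x : 0 <= (br t x)%:E.
Proof. by rewrite lee_fin; case/andP: (br01 t x). Qed.

Let mbr2 : measurable_fun setT (fun p : R * R => br p.1 p.2).
Proof. exact: (measurableT_comp (@measurable_branch R) mu2). Qed.

Let mbr t : measurable_fun setT (br t).
Proof.
exact: (@measurable_fun_pair2 _ _ _ _ _ _ _ t mbr2).
Qed.

Let mint d' (S : measurableType d') (a b c : S -> R) :
  measurable_fun setT a -> measurable_fun setT b -> measurable_fun setT c ->
  measurable_fun setT (fun q => \int[P]_w (br (a q) (b q - W (c q) w))%:E).
Proof.
move=> ma mb mc.
apply: (@measurable_fun_fubini_tonelli_F _ _ _ _ _ P (fun q : S * T =>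
  (br (a q.1) (b q.1 - W (c q.1) q.2))%:E)) => //.
apply/measurable_EFinP.
apply: (measurableT_comp mbr2 (g := fun q : S * T =>
  (a q.1, (b q.1 - W (c q.1) q.2)%R))).
apply: measurable_fun_pair; first exact: measurableT_comp.
apply: measurable_funB; first exact: measurableT_comp.
apply: (measurableT_comp mW2 (g := fun q : S * T => (c q.1, q.2))).
by apply: measurable_fun_pair => //; exact: measurableT_comp.
Qed.

Let mexp d' (S : measurableType d') (c : S -> R) :
  measurable_fun setT c -> measurable_fun setT (fun q => (expR (c q))%:E).
Proof. by move=> mc; apply/measurable_EFinP/measurableT_comp. Qed.

(** The Markov property at age [h], extracted from the renewal equation alone: branchings after age
    [h] are shifted back by [h], and the semigroup law with Tonelli reassembles them into e^(-h) G_h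
    of the renewal equation at time [t]. *)
Lemma markov_duhamel t h x : (0 <= t)%R -> (0 <= h)%R ->
  (u (t + h) x)%:E = (expR (- h))%:E * \int[P]_w (u t (x - W h w))%:E +
   \int[mu]_(s in `[0%R, h]) ((expR (- s))%:E *
       \int[P]_w (branch (u (t + h - s) (x - W s w)))%:E).
Proof.
move=> t0 h0; have th0 : (0 <= t + h)%R by exact: addr_ge0.
rewrite u_renewal//.
pose f (s : R) := (expR (- s))%:E * \int[P]_w (br (t + h - s) (x - W s w))%:E.
have f0 s : 0 <= f s.
  by rewrite mule_ge0 ?lee_fin ?expR_ge0//; exact: integral_ge0.
have mf : measurable_fun setT f.
  apply: emeasurable_funM; first by apply: mexp => //; exact: measurableT_comp.
  by apply: mint => //; exact: measurable_funB.
rewrite -/f.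
have -> : \int[mu]_(s in `[0%R, (t + h)%R]) f s =
    \int[mu]_(s in `[0%R, h]) f s + \int[mu]_(s in `]h, (t + h)%R]) f s.
  have -> : `[0%R, (t + h)%R]%classic = `[0%R, h]%classic `|` `]h, (t + h)%R]%classic.
    by rewrite -itv_bndbnd_setU// ?bnd_simp// lerDr.
  apply: ge0_integral_setU => //; first exact: measurable_funTS.
  apply/disj_setPS => s [] /=; rewrite !in_itv/= => /andP[_ sh] /andP[hs _].
  by have := lt_le_trans hs sh; rewrite ltxx.
rewrite addeA addeAC; congr (_ + _).
have -> : \int[mu]_(s in `]h, (t + h)%R]) f s = \int[mu]_(s in `[0%R, t]) f (s + h)%R.
  rewrite -[RHS]integral_itv_obnd_cbnd; last first.
    by apply: measurable_funTS; apply: measurableT_comp => //; exact: measurable_funD.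
  rewrite [LHS]integral_mkcond [RHS]integral_mkcond.
  rewrite (ge0_integral_translate h).
  - apply: eq_integral => s _; rewrite !patchE !mem_setE !in_itv/=.
    by rewrite ltrDr lerD2r.
  - by apply/(measurable_restrict _ _ _).1 => //; exact: measurable_funTS.
  - by move=> s; rewrite patchE; case: ifP.
transitivity ((expR (- h))%:E * \int[P]_w ((expR (- t))%:E *
    P [set w' | (x - W h w < W t w')%R] +
    \int[mu]_(s in `[0%R, t]) ((expR (- s))%:E *
       \int[P]_w' (br (t - s) (x - W h w - W s w'))%:E))); last first.
  by congr (_ * _); apply: eq_integral => w _; rewrite -u_renewal.
have mPW : measurable_fun setT (fun w => P [set w' | (x - W h w < W t w')%R]).
  rewrite (_ : (fun _ => _) = (fun w => \int[P]_w' ((x - W h w < W t w')%R%:R : R)%:E)).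
    apply: (@measurable_fun_fubini_tonelli_F _ _ _ _ _ P (fun q : T * T =>
      ((x - W h q.1 < W t q.2)%R%:R : R)%:E)) => //.
    apply: measurable_natb; apply: measurable_fun_ltr.
      by apply: measurable_funB => //; exact: measurableT_comp.
    exact: measurableT_comp.
  by apply/funext => w; rewrite ge0_integral_bool//; exact: measurable_fun_ltr.
(* The integrand on the product space, extended by 0 outside [0, t], so that the two integrals can
   be exchanged. *)
pose g (q : T * measurableTypeR R) : \bar R := if (0 <= q.2 <= t)%R then (expR (- q.2))%:E *
       \int[P]_w' (br (t - q.2) (x - W h q.1 - W q.2 w'))%:E else 0.
have g0 q : 0 <= g q.
  rewrite /g; case: ifP => // _.
  by rewrite mule_ge0 ?lee_fin ?expR_ge0//; exact: integral_ge0.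
have mg : measurable_fun setT g.
  apply: measurable_fun_ifT => //.
    by apply: measurable_and; apply: measurable_fun_ler => //; exact: measurable_snd.
  apply: emeasurable_funM.
    by apply: mexp => //; apply: measurableT_comp => //; exact: measurable_snd.
  apply: mint => //.
    by apply: measurable_funB => //; exact: measurable_snd.
  apply: measurable_funB => //.
  exact: (measurableT_comp (mW h) measurable_fst).
have gE w : \int[mu]_(s in `[0%R, t]) ((expR (- s))%:E *
       \int[P]_w' (br (t - s) (x - W h w - W s w'))%:E) = \int[mu]_s g (w, s).
  rewrite integral_mkcond; apply: eq_integral => s _.
  by rewrite patchE mem_setE in_itv/= /g/=.
under [in RHS]eq_integral do rewrite gE.
rewrite ge0_integralD//; last 4 first.
- by move=> w _; rewrite mule_ge0 ?lee_fin ?expR_ge0.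
- by apply: emeasurable_funM => //.
- by move=> w _; exact: integral_ge0.
- exact: (@measurable_fun_fubini_tonelli_F _ _ _ _ _ mu g mg g0).
rewrite ge0_muleDr; last 2 first.
- by apply: integral_ge0 => w _; rewrite mule_ge0 ?lee_fin ?expR_ge0.
- by apply: integral_ge0 => w _; exact: integral_ge0.
congr (_ + _).
  rewrite ge0_integralZl_EFin ?expR_ge0// muleA -EFinM -expRD opprD addrC.
  congr (_ * _).
  have -> : P [set w | (x < W (t + h)%R w)%R] = \int[P]_w ((x < W (h + t)%R w)%R%:R : R)%:E.
    by rewrite ge0_integral_bool; [rewrite addrC|exact: measurable_fun_ltr].
  rewrite -(WD (f := fun y => ((x < y)%R%:R : R)%:E))//.
    apply: eq_integral => w _.
    rewrite -[RHS]ge0_integral_bool; last exact: measurable_fun_ltr.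
    by apply: eq_integral => w' _; rewrite ltrBlDl.
  by apply: measurable_natb; exact: measurable_fun_ltr.
have -> : \int[P]_w \int[mu]_s g (w, s) = \int[mu]_s \int[P]_w g (w, s).
  exact: (@fubini_tonelli _ _ _ _ _ P mu g mg g0).
have mgG := @measurable_fun_fubini_tonelli_G _ _ _ _ _ P g mg g0.
transitivity (\int[mu]_s ((expR (- h))%:E * \int[P]_w g (w, s))); last first.
  apply: ge0_integralZl_EFin; [exact: measurableT| |exact: mgG|exact: expR_ge0].
  by move=> s _; apply: integral_ge0 => w _; exact: g0.
rewrite [LHS]integral_mkcond; apply: eq_integral => s _.
rewrite patchE mem_setE in_itv/= /g/=; case: ifPn => [/andP[s0 st]|_]; last first.
  by rewrite integral0 mule0.
have mbx : measurable_fun setT (fun y : R => (br (t - s) (x - y))%:E).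
  by apply/measurable_EFinP/measurableT_comp => //; exact: measurable_funB.
rewrite ge0_integralZl_EFin ?expR_ge0//; last 2 first.
- by move=> w _; exact: integral_ge0.
- apply: mint => //; exact: measurable_funB.
have E : (t + h - (s + h) = t - s)%R by rewrite opprD addrACA subrr addr0.
rewrite /f E muleA -EFinM -expRD -opprD; congr (_ * _); first by rewrite addrC.
rewrite [(s + h)%R]addrC.
apply: (etrans (esym (WD h0 s0 mbx (fun y => br0 _ _)))).
by apply: eq_integral => w _; apply: eq_integral => w' _; rewrite opprD addrA.
Qed.

End markov.

(** * The heat semigroup on bounded measurable functions *)

Section average.
Context d (T : measurableType d) (R : realType) (P : probability T R).
Variables (W : R -> T -> R).
Hypothesis mW2 : measurable_fun setT (fun p : R * T => W p.1 p.2).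
Hypothesis mW : forall s, measurable_fun setT (W s).
Hypothesis WD : forall (s t : R) (f : R -> \bar R),
  0 <= s -> 0 <= t -> measurable_fun setT f -> (forall x, 0 <= f x)%E ->
  (\int[P]_w \int[P]_w' f (W s w + W t w')%R = \int[P]_w f (W (s + t)%R w))%E.

Definition bounded_meas (f : R -> R) :=
  measurable_fun setT f /\ exists M, forall x, `|f x| <= M.

(** This is G_s; the sign in [x - W s w] is there because [x] is a threshold that the descendants
    have to exceed. *)
Definition avg (s : R) (f : R -> R) (x : R) : R :=
  (\int[P]_w f (x - W s w))%R.

Lemma bounded_measD f g : bounded_meas f -> bounded_meas g ->
  bounded_meas (fun x => f x + g x).
Proof.
move=> [mf [M fM]] [mg [N gN]]; split; first exact: measurable_funD.
by exists (M + N) => x; rewrite (le_trans (ler_normD _ _))// lerD.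
Qed.

Lemma bounded_measZ c f : bounded_meas f -> bounded_meas (fun x => c * f x).
Proof.
move=> [mf [M fM]]; split; first exact: measurable_funM.
by exists (`|c| * M) => x; rewrite normrM ler_wpM2l.
Qed.

Lemma bounded_meas_cst c : bounded_meas (cst c).
Proof. by split; [exact: measurable_cst|exists `|c|]. Qed.

Lemma bounded_meas_sqr f : bounded_meas f -> bounded_meas (fun x => f x ^+ 2).
Proof.
move=> [mf [M fM]]; split; first exact: measurable_funX.
by exists (M ^+ 2) => x; rewrite normrX lerXn2r// nnegrE (le_trans _ (fM x)).
Qed.

Lemma avg_integrable s f x : bounded_meas f ->
  P.-integrable setT (EFin \o (fun w => f (x - W s w))).
Proof.
move=> [mf [M fM]]; apply: measurable_bounded_integrable => //.
- by rewrite -ge0_fin_numE// fin_num_measure.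
- by apply: measurableT_comp => //; exact: measurable_funB.
- by exists M; split=> [|y My w _ /=]; [exact: num_real|exact: le_trans (fM _) (ltW My)].
Qed.

Lemma avgE s f x : bounded_meas f ->
  (avg s f x)%:E = (\int[P]_w (f (x - W s w))%:E)%E.
Proof.
move=> bf; rewrite /avg /Rintegral fineK//.
by apply: integrable_fin_num => //; exact: avg_integrable.
Qed.

Lemma avg_le s f g x : bounded_meas f -> bounded_meas g ->
  (forall y, f y <= g y) -> avg s f x <= avg s g x.
Proof. by move=> bf bg fg; apply: le_Rintegral => //; exact: avg_integrable. Qed.

Lemma avgZ s c f x : bounded_meas f -> avg s (fun y => c * f y) x = c * avg s f x.
Proof. by move=> bf; rewrite /avg RintegralZl//; exact: avg_integrable. Qed.

Lemma avgD s f g x : bounded_meas f -> bounded_meas g ->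
  avg s (fun y => f y + g y) x = avg s f x + avg s g x.
Proof. by move=> bf bg; rewrite /avg RintegralD//; exact: avg_integrable. Qed.

Lemma avg_cst s c x : avg s (cst c) x = c.
Proof.
by rewrite /avg Rintegral_cst//= probability_setT/= mulr1.
Qed.

Lemma avg_bnd s f x a b : bounded_meas f -> (forall y, a <= f y <= b) ->
  a <= avg s f x <= b.
Proof.
move=> bf fab; rewrite -{1}(avg_cst s a x) -[X in _ <= _ <= X](avg_cst s b x).
by rewrite !avg_le//; try exact: bounded_meas_cst; move=> y; case/andP: (fab y).
Qed.

Lemma bounded_meas_avg t f : bounded_meas f -> (forall y, 0 <= f y) ->
  bounded_meas (avg t f).
Proof.
move=> bf f0; split; last first.
  have [_ [M fM]] := bf; exists M => x.
  have /andP[a0 aM] : 0 <= avg t f x <= M.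
    by apply: avg_bnd => // y; rewrite f0 (le_trans (ler_norm _)).
  by rewrite ger0_norm.
apply/measurable_EFinP.
rewrite (_ : EFin \o _ = (fun x => \int[P]_w (f (x - W t w))%:E)%E); last first.
  by apply/funext => x /=; rewrite avgE.
apply: (@measurable_fun_fubini_tonelli_F _ _ _ _ _ P (fun q : R * T =>
  (f (q.1 - W t q.2))%:E)).
  apply/measurable_EFinP/measurableT_comp; first by case: bf.
  by apply: measurable_funB => //; exact: measurableT_comp.
by move=> q; rewrite lee_fin.
Qed.

Lemma avg_semigroup s t f x : 0 <= s -> 0 <= t -> bounded_meas f ->
  (forall y, 0 <= f y) -> avg s (avg t f) x = avg (s + t) f x.
Proof.
move=> s0 t0 bf f0; have bt := bounded_meas_avg t bf f0. apply: EFin_inj; rewrite !avgE//.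
under eq_integral do rewrite avgE//.
have mf : measurable_fun setT (fun y : R => (f (x - y))%:E).
  apply/measurable_EFinP/measurableT_comp; first by case: bf.
  exact: measurable_funB.
have f0' y : (0 <= (f (x - y))%:E)%E by rewrite lee_fin.
apply: (etrans _ (WD s0 t0 mf f0')).
by apply: eq_integral => w _; apply: eq_integral => w' _; rewrite opprD addrA.
Qed.

Lemma avg_sqr s f x : bounded_meas f -> avg s f x ^+ 2 <= avg s (fun y => f y ^+ 2) x.
Proof.
move=> bf; set m := avg s f x.
have bf2 := bounded_meas_sqr bf.
have : 0 <= avg s (fun y => f y ^+ 2 + (m ^+ 2 + (- (2 * m)) * f y)) x.
  apply: Rintegral_ge0 => w _.
  by rewrite (_ : _ + _ = (f (x - W s w) - m) ^+ 2) ?sqr_ge0//; ring.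
rewrite avgD//; last first.
  by apply: bounded_measD; [exact: bounded_meas_cst|exact: bounded_measZ].
rewrite avgD; [|exact: bounded_meas_cst|exact: bounded_measZ].
by rewrite (avg_cst s (m ^+ 2)) avgZ// -/m => h; nra.
Qed.

End average.

Section exponential_primitive.
Context {R : realType}.
Local Notation mu := (@lebesgue_measure R).
Variables (a b c : R).

(** In Duhamel's formula the main terms contribute multiples of e^(-2s) and e^(-3s), the latter from
    the quadratic loss, and the remainder of the iteration a constant. *)
Let F (s : R) := a * expR (- 2 * s) + b * expR (- 3 * s) + c * s.
Let f (s : R) := - 2 * a * expR (- 2 * s) - 3 * b * expR (- 3 * s) + c.

Let cexp (k : R) : continuous (fun s : R => expR (k * s)).
Proof.
move=> s; apply: continuous_comp; last exact: continuous_expR.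
by apply: cvgM; [exact: cvg_cst|exact: cvg_id].
Qed.

Let cF : continuous F.
Proof.
move=> s; apply: cvgD; [apply: cvgD|];
  by apply: cvgM; [exact: cvg_cst|try exact: cexp; exact: cvg_id].
Qed.

Let cf : continuous f.
Proof.
move=> s; apply: cvgD; last exact: cvg_cst.
by apply: cvgB; apply: cvgM; try exact: cvg_cst; exact: cexp.
Qed.

Let dF (s : R) : is_derive s (1 : R) (F : R -> R) (f s : R).
Proof.
rewrite /F /f; apply: is_derive_eq.
rewrite /GRing.scale/=; ring.
Qed.

Let int_f (h : R) : 0 < h -> (\int[mu]_(s in `[0%R, h]) (f s)%:E = (F h - F 0)%R%:E)%E.
Proof.
move=> h0; rewrite (@continuous_FTC2 _ f F)//.
- exact: continuous_subspaceT.
- split=> [s _||]; first exact: ex_derive.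
  + by apply: cvg_at_right_filter; exact: cF.
  + by apply: cvg_at_left_filter; exact: cF.
- by move=> s _; rewrite derive1E; exact: derive_val.
Qed.

Let intf h : mu.-integrable `[0%R, h] (EFin \o f).
Proof.
apply: continuous_compact_integrable; first exact: segment_compact.
exact: continuous_subspaceT.
Qed.

Let bnd_integrable h (g : R -> R) M : measurable_fun setT g ->
  (forall s, 0 <= s <= h -> 0 <= g s <= M) -> mu.-integrable `[0%R, h] (EFin \o g).
Proof.
move=> mg gM; apply: measurable_bounded_integrable => //.
- by rewrite [X in (X < _)%E](lebesgue_measure_itv `[0, h]%R)/=; case: ifP => _; rewrite ltry.
- exact: measurable_funTS.
- exists M; split=> [|y My s /=]; first exact: num_real.
  by rewrite in_itv/= => /gM/andP[g0 gle]; rewrite ger0_norm// (le_trans gle)// ltW.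
Qed.

Lemma integral_ge_primitive (h : R) (g : R -> R) (M : R) : 0 < h -> measurable_fun setT g ->
  (forall s, 0 <= s <= h -> 0 <= g s <= M) ->
  (forall s, 0 <= s <= h -> f s <= g s) ->
  ((F h - F 0)%R%:E <= \int[mu]_(s in `[0%R, h]) (g s)%:E)%E.
Proof.
move=> h0 mg gM fg; rewrite -int_f//; apply: le_integral => //.
- exact: (bnd_integrable mg gM).
- by move=> s; rewrite inE/= in_itv/= lee_fin => /fg.
Qed.

Lemma integral_le_primitive (h : R) (g : R -> R) (M : R) : 0 < h -> measurable_fun setT g ->
  (forall s, 0 <= s <= h -> 0 <= g s <= M) ->
  (forall s, 0 <= s <= h -> g s <= f s) ->
  (\int[mu]_(s in `[0%R, h]) (g s)%:E <= (F h - F 0)%R%:E)%E.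
Proof.
move=> h0 mg gM fg; rewrite -int_f//; apply: le_integral => //.
- exact: (bnd_integrable mg gM).
- by move=> s; rewrite inE/= in_itv/= lee_fin => /fg.
Qed.

End exponential_primitive.

(** * The two one-step inequalities *)

Section markov_inequalities.
Context d (T : measurableType d) (R : realType) (P : probability T R).
Variables (W : R -> T -> R) (u : R -> R -> R).
Hypothesis mW2 : measurable_fun setT (fun p : R * T => W p.1 p.2).
Hypothesis mW : forall s, measurable_fun setT (W s).
Hypothesis WD : forall (s t : R) (f : R -> \bar R),
  0 <= s -> 0 <= t -> measurable_fun setT f -> (forall x, 0 <= f x)%E ->
  (\int[P]_w \int[P]_w' f (W s w + W t w')%R = \int[P]_w f (W (s + t)%R w))%E.
Hypothesis W0 : forall w, W 0 w = 0.
Hypothesis mu2 : measurable_fun setT (fun p : R * R => u p.1 p.2).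
Hypothesis u01 : forall t x, 0 <= u t x <= 1.
Hypothesis duhamel : forall t h x, 0 <= t -> 0 <= h ->
  ((u (t + h) x)%:E = (expR (- h))%:E * \int[P]_w (u t (x - W h w))%:E +
   \int[lebesgue_measure]_(s in `[0%R, h]) ((expR (- s))%:E *
       \int[P]_w (branch (u (t + h - s) (x - W s w)))%:E))%E.

Local Notation G := (avg P W).

Lemma bounded_meas_u t : bounded_meas (u t).
Proof.
split; first exact: (@measurable_fun_pair2 _ _ _ _ _ _ _ t mu2).
by exists 1 => x; have /andP[u0 u1] := u01 t x; rewrite ger0_norm.
Qed.

Let u0 t x : 0 <= u t x. Proof. by case/andP: (u01 t x). Qed.
Let u1 t x : u t x <= 1. Proof. by case/andP: (u01 t x). Qed.

Let bounded_meas_br t : bounded_meas (fun y => branch (u t y)).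
Proof.
split.
  by apply: (measurableT_comp (@measurable_branch R)); case: (bounded_meas_u t).
by exists 1 => x; have /andP[b0 b1] := branch01 (u01 t x); rewrite ger0_norm.
Qed.

Let A t h x s := expR (- s) * G s (fun y => branch (u (t + h - s) y)) x.

Let mA t h x : measurable_fun setT (A t h x).
Proof.
apply: measurable_funM.
  by apply: measurableT_comp => //; exact: measurableT_comp.
apply/measurable_EFinP.
rewrite (_ : EFin \o _ = (fun s => \int[P]_w
  (branch (u (t + h - s) (x - W s w)))%:E)%E); last first.
  by apply/funext => s /=; rewrite avgE.
apply: (@measurable_fun_fubini_tonelli_F _ _ _ _ _ P (fun q : R * T =>
  (branch (u (t + h - q.1) (x - W q.1 q.2)))%:E)).
  apply/measurable_EFinP/(measurableT_comp (@measurable_branch R)).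
  apply: (measurableT_comp mu2 (g := fun q : R * T => (t + h - q.1, x - W q.1 q.2))).
  by apply: measurable_fun_pair; exact: measurable_funB.
by move=> q; rewrite lee_fin; case/andP: (branch01 (u01 (t + h - q.1) (x - W q.1 q.2))).
Qed.

Let A01 t h x s : 0 <= s <= h -> 0 <= A t h x s <= 1.
Proof.
move=> /andP[s0 _].
have /andP[g0 g1] : 0 <= G s (fun y => branch (u (t + h - s) y)) x <= 1.
  by apply: avg_bnd => // y; exact: branch01.
rewrite /A mulr_ge0 ?expR_ge0//= mulr_ile1 ?expR_ge0//.
by rewrite -expR0 ler_expR oppr_le0.
Qed.

Let duhamelR t h x : 0 <= t -> 0 <= h ->
  ((u (t + h) x)%:E = (expR (- h) * G h (u t) x)%:E +
   \int[lebesgue_measure]_(s in `[0%R, h]) (A t h x s)%:E)%E.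
Proof.
move=> t0 h0; rewrite duhamel// EFinM avgE//; last exact: bounded_meas_u.
by congr (_ + _)%E; apply: eq_integral => s _; rewrite /A EFinM avgE.
Qed.

Lemma avg0 f x : G 0 f x = f x.
Proof.
rewrite /avg; under eq_Rintegral do rewrite W0 subr0.
by rewrite Rintegral_cst//= probability_setT/= mulr1.
Qed.

Let G01 t h x : 0 <= G h (u t) x <= 1.
Proof. by apply: avg_bnd => //; exact: bounded_meas_u. Qed.

Let GG f s h x : bounded_meas f -> (forall y, 0 <= f y) -> 0 <= s -> s <= h ->
  G s (G (h - s) f) x = G h f x.
Proof. by move=> bf f0 s0 sh; rewrite (avg_semigroup mW WD) ?subr_ge0// addrC subrK. Qed.

(* Iterating Duhamel's formula halves the remainder. *)
Let upper_rem k (t h x : R) : 0 <= t -> 0 <= h <= 1 / 4 ->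
  u (t + h) x <= expR h * G h (u t) x + 2 ^- k.
Proof.
elim: k t h x => [|k IH] t h x t0 /andP[h0 h4].
  rewrite expr0 invr1 (le_trans (u1 _ _))// lerDr mulr_ge0 ?expR_ge0//.
  by case/andP: (G01 t h x).
move: h0; rewrite le_eqVlt => /predU1P[<-|h0].
  by rewrite addr0 expR0 mul1r avg0 lerDl.
set g := G h (u t) x; set dl : R := 2 ^- k.
have dl0 : 0 <= dl by rewrite /dl invr_ge0.
rewrite -lee_fin duhamelR// ?(ltW h0)//.
apply: (le_trans (leeD2l _ (@integral_le_primitive R (- (expR h * g)) 0 (2 * dl)
   h (A t h x) 1 h0 (mA t h x) (@A01 t h x) _))).
  move=> s /andP[s0 sh]; rewrite mulr0 mul0r subr0.
  have hs0 : 0 <= h - s by rewrite subr_ge0.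
  have hs4 : 0 <= h - s <= 1 / 4 by rewrite hs0/= (le_trans _ h4)// gerBl.
  have bG : bounded_meas (G (h - s) (u t)).
    by apply: (bounded_meas_avg P mW); [exact: bounded_meas_u|exact: u0].
  have le1 : G s (fun y => branch (u (t + h - s) y)) x <=
      2 * (expR (h - s) * g) + 2 * dl.
    rewrite /g -(GG x (bounded_meas_u t) (u0 t) s0 sh).
    rewrite mulrA -(avgZ P mW)// -[X in _ <= _ + X](avg_cst P W s _ x) -(avgD P mW)//; last 2 first.
    - exact: bounded_measZ.
    - exact: bounded_meas_cst.
    apply: (avg_le P mW) => //.
      by apply: bounded_measD; [exact: bounded_measZ|exact: bounded_meas_cst].
    move=> y; have := IH t (h - s) y t0 hs4; rewrite addrA.
    have := u0 (t + h - s) y; rewrite /branch -/dl /=.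
    set v := u _ _; set z := G _ _ _; set e := expR _; nra.
  rewrite /A.
  apply: (le_trans (ler_wpM2l (expR_ge0 _) le1)).
  rewrite mulrDr; apply: lerD; last first.
    rewrite ler_piMl// ?mulr_ge0// -expR0 ler_expR oppr_le0//.
  rewrite (_ : expR (- 2 * s) = expR (- s) * expR (- s)); last by rewrite -expRD; congr expR; ring.
  by rewrite expRD le_eqVlt; apply/orP; left; apply/eqP; ring.
rewrite -EFinD lee_fin !mul0r !addr0 !mulr0 expR0.
have E1 : expR (- h) * g = expR h * g * expR (- 2 * h).
  by rewrite mulrAC -expRD; congr (expR _ * _); ring.
(* This is where [h <= 1 / 4] enters: the doubling at a branching turns the error [dl] into
   [2 * dl * h], at most half of [dl]. *)
have : 2 * dl * h <= 2 ^- k.+1.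
  rewrite exprS invfM -/dl; nra.
rewrite E1; nra.
Qed.

Lemma le_of_pow2_gap (a b c : R) : (forall k : nat, a <= b + c * 2 ^- k) -> a <= b.
Proof.
move=> H; have : (fun k : nat => b + c * 2 ^- k) @ \oo --> b + c * 0.
  apply: cvgD; first exact: cvg_cst.
  apply: cvgM; first exact: cvg_cst.
  under eq_fun do rewrite -exprVn.
  by apply: cvg_expr; rewrite ger0_norm ?invr_ge0// invf_lt1 ?ltr1n.
rewrite mulr0 addr0 => cb; rewrite -(cvg_lim (@Rhausdorff R) cb).
by apply: limr_ge; [exact: cvgP cb|exact: nearW].
Qed.

Lemma markov_upper_small (t h x : R) : 0 <= t -> 0 <= h <= 1 / 4 ->
  u (t + h) x <= expR h * G h (u t) x.
Proof.
move=> t0 h4; apply: (@le_of_pow2_gap _ _ 1) => k.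
by rewrite mul1r; exact: upper_rem.
Qed.

(** Since [branch a] is 2a - a^2, the induction hypothesis bounds the linear part and
    [markov_upper_small] with Jensen's inequality the square; after multiplication by e^(-s) the
    bound integrates exactly to the claim. *)
Let lower_rem k (t h x : R) : 0 <= t -> 0 <= h <= 1 / 4 ->
  expR h * G h (u t) x - (expR (2 * h) - expR h) * G h (fun y => u t y ^+ 2) x
  <= u (t + h) x + 2 * 2 ^- k.
Proof.
have bu2 t' := bounded_meas_sqr (bounded_meas_u t').
have u20 t' y : 0 <= u t' y ^+ 2 by exact: sqr_ge0.
elim: k t h x => [|k IH] t h x t0 /andP[h0 h4].
  have /andP[g0 g1] := G01 t h x.
  have /andP[q0 q1] : 0 <= G h (fun y => u t y ^+ 2) x <= 1.
    by apply: avg_bnd => // y; rewrite u20/= exprn_ile1.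
  have e2 : expR h <= 2.
    have := expR_ge1Dx (- h); rewrite expRN => e1.
    have eh := expR_gt0 h.
    have : (1 - h) * expR h <= 1.
      by rewrite -ler_pdivlMr// div1r.
    nra.
  have e12 : expR h <= expR (2 * h) by rewrite ler_expR; lra.
  have := u0 (t + h) x; have eh := expR_gt0 h.
  rewrite expr0 invr1; nra.
move: h0; rewrite le_eqVlt => /predU1P[<-|h0].
  rewrite !mulr0 expR0 subrr mul0r subr0 mul1r avg0 addr0 lerDl.
  by rewrite mulr_ge0// invr_ge0.
set g := G h (u t) x; set q := G h (fun y => u t y ^+ 2) x.
set dl : R := 2 * 2 ^- k.
have dl0 : 0 <= dl by rewrite /dl mulr_ge0// invr_ge0.
rewrite -lee_fin [leRHS]EFinD duhamelR// ?(ltW h0)//.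
apply: (le_trans _ (leeD2r _ (leeD2l _ (@integral_ge_primitive R
   (- (expR h * g) - expR h * q) (expR (2 * h) * q) (- 2 * dl)
   h (A t h x) 1 h0 (mA t h x) (@A01 t h x) _)))).
  rewrite -!EFinD lee_fin !mulr0 expR0.
  have E1 : expR (- h) = expR h * expR (- 2 * h).
    by rewrite -expRD; congr expR; ring.
  have E2 : expR (2 * h) * expR (- 3 * h) = expR h * expR (- 2 * h).
    by rewrite -!expRD; congr expR; ring.
  have : 2 * dl * h <= 2 * 2 ^- k.+1.
    rewrite exprS invfM -/dl; rewrite /dl in dl0 *; nra.
  have E3 : expR (2 * h) * q * expR (- 3 * h) = expR h * expR (- 2 * h) * q.
    by rewrite mulrAC E2.
  have E4 : expR (- h) * g = expR h * expR (- 2 * h) * g by rewrite E1.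
  rewrite -/g E3 E4 => dlh; rewrite -subr_ge0.
  set G1 := 2 * 2 ^- k.+1 in dlh *.
  rewrite (_ : _ - _ = G1 - 2 * dl * h); first by rewrite subr_ge0.
  by ring.
move=> s /andP[s0 sh].
have hs0 : 0 <= h - s by rewrite subr_ge0.
have hs4 : 0 <= h - s <= 1 / 4 by rewrite hs0/= (le_trans _ h4)// gerBl.
have bG : bounded_meas (G (h - s) (u t)).
  by apply: (bounded_meas_avg P mW); [exact: bounded_meas_u|exact: u0].
have bG2 : bounded_meas (G (h - s) (fun y => u t y ^+ 2)).
  by apply: (bounded_meas_avg P mW); [exact: bu2|exact: u20].
set e1 := expR (h - s); set e2 := expR (2 * (h - s)).
have ge1 : 2 * e1 * g + ((2 * e1 - 3 * e2) * q - 2 * dl) <=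
    G s (fun y => branch (u (t + h - s) y)) x.
  rewrite /g -(GG x (bounded_meas_u t) (u0 t) s0 sh).
  rewrite /q -(GG x (bu2 t) (u20 t) s0 sh).
  rewrite -!(avgZ P mW)// -[X in _ + (_ + X)](avg_cst P W s _ x).
  rewrite -(avgD P mW); [|exact: bounded_measZ|exact: bounded_meas_cst].
  rewrite -(avgD P mW); last 2 first.
  - exact: bounded_measZ.
  - by apply: bounded_measD; [exact: bounded_measZ|exact: bounded_meas_cst].
  apply: (avg_le P mW) => //.
    apply: bounded_measD; first exact: bounded_measZ.
    by apply: bounded_measD; [exact: bounded_measZ|exact: bounded_meas_cst].
  move=> y /=; have := IH t (h - s) y t0 hs4.
  have := markov_upper_small y t0 hs4.
  have := avg_sqr P mW (h - s) y (bounded_meas_u t).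
  rewrite addrA /branch -/dl -/e1 -/e2.
  have := u0 (t + h - s) y.
  have e0 : 0 < e1 by exact: expR_gt0.
  have E : e2 = e1 ^+ 2 by rewrite /e2 /e1 expr2 -expRD; congr expR; ring.
  set v := u (t + h - s) y; set z := G _ (u t) _; set z2 := G _ _ _.
  move=> v0 zz vz iv.
  have : v ^+ 2 <= e2 * z2.
    rewrite E (le_trans (_ : v ^+ 2 <= (e1 * z) ^+ 2))//.
      by rewrite lerXn2r// nnegrE// (le_trans v0).
    by rewrite exprMn ler_wpM2l// sqr_ge0.
  lra.
rewrite /A; apply: (le_trans _ (ler_wpM2l (expR_ge0 _) ge1)).
have E1 : expR (- s) * e1 = expR h * expR (- 2 * s).
  by rewrite /e1 -!expRD; congr expR; ring.
have E2 : expR (- s) * e2 = expR (2 * h) * expR (- 3 * s).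
  by rewrite /e2 -!expRD; congr expR; ring.
have es : expR (- s) <= 1 by rewrite -expR0 ler_expR oppr_le0.
have := expR_ge0 (- s) => es0.
rewrite (_ : expR (- s) * _ = 2 * (expR (- s) * e1) * g +
  ((2 * (expR (- s) * e1) - 3 * (expR (- s) * e2)) * q - 2 * (dl * expR (- s)))); last by ring.
rewrite E1 E2; have : dl * expR (- s) <= dl by rewrite ler_piMr.
lra.
Qed.

(** The meaning is Bonferroni's inequality: for the number N of particles at time [h], E N = e^h and
    E N(N-1)/2 = e^(2h) - e^h, and a product of two values is at most the mean of their squares. *)
Lemma markov_lower (t h x : R) : 0 <= t -> 0 <= h <= 1 / 4 ->
  expR h * G h (u t) x - (expR (2 * h) - expR h) * G h (fun y => u t y ^+ 2) x
  <= u (t + h) x.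
Proof.
by move=> t0 h4; apply: (@le_of_pow2_gap _ _ 2) => k; exact: lower_rem.
Qed.

(** A first moment bound, e^h being the mean number of particles. It is linear in [u], so steps of
    length at most 1/4 compose. *)
Lemma markov_upper (t h x : R) : 0 <= t -> 0 <= h ->
  u (t + h) x <= expR h * G h (u t) x.
Proof.
move=> t0 h0.
have [n hn] : exists n : nat, h <= n%:R / 4.
  exists (Num.truncn (4 * h)).+1; rewrite ler_pdivlMr// mulrC ltW//.
  exact: truncnS_gt.
elim: n h h0 x hn => [|n IH] h h0 x hn.
  have -> : h = 0 by apply/eqP; rewrite eq_le h0 andbT; move: hn; rewrite mul0r.
  by rewrite addr0 expR0 mul1r avg0.
have [h4|h4] := leP h (1 / 4); first by apply: markov_upper_small; rewrite // h0.
have h'0 : 0 <= h - 1 / 4 by lra.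
rewrite -[in t + h](subrK (1 / 4) h) addrA.
apply: (le_trans (markov_upper_small _ _ _)); [lra|lra|].
have h'n : h - 1 / 4 <= n%:R / 4 by rewrite -natr1 in hn; lra.
have bG : bounded_meas (G (h - 1 / 4) (u t)).
  by apply: (bounded_meas_avg P mW); [exact: bounded_meas_u|exact: u0].
apply: (@le_trans _ _ (expR (1 / 4) * G (1 / 4) (fun y => expR (h - 1 / 4) *
    G (h - 1 / 4) (u t) y) x)).
  rewrite ler_wpM2l ?expR_ge0//; apply: (avg_le P mW).
  - exact: bounded_meas_u.
  - exact: bounded_measZ.
  - by move=> y; exact: IH.
rewrite (avgZ P mW)// GG//; [|exact: bounded_meas_u|exact: ltW].
by rewrite mulrA -expRD addrC subrK.
Qed.

End markov_inequalities.

(** * Gaussian averages *)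

Section gaussian_means.
Context {R : realType}.
Local Notation mu := (@lebesgue_measure R).
Implicit Types (m v l k c x y : R) (g : R -> R).

Definition gaussian m v y := expR (- (y - m) ^+ 2 / (2 * v)) / Num.sqrt (2 * pi * v).

(** A relation, so that integrability and value travel together and closed forms are built by
    combination. *)
Definition gauss_mean m v g l :=
  mu.-integrable setT (fun y => (g y * gaussian m v y)%:E) /\
  (\int[mu]_y (g y * gaussian m v y)%:E = l%:E)%E.

Lemma gaussianE m v y : 0 < v -> normal_pdf m (Num.sqrt v) y = gaussian m v y.
Proof.
move=> v0; have s0 : Num.sqrt v != 0 by rewrite sqrtr_eq0 -ltNge.
rewrite normal_pdfE// /normal_fun /normal_peak /gaussian sqr_sqrtr ?ltW//.
rewrite mulrC -(mulr_natl v 2); congr (_ * (Num.sqrt _)^-1).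
by rewrite -mulr_natl; ring.
Qed.

Lemma gaussian_ge0 m v y : 0 <= gaussian m v y.
Proof. by rewrite divr_ge0 ?expR_ge0. Qed.

Lemma gauss_mean1 m v : 0 < v -> gauss_mean m v (fun=> 1) 1.
Proof.
move=> v0; have s0 : Num.sqrt v != 0 by rewrite sqrtr_eq0 -ltNge.
have E : (fun y => (1 * gaussian m v y)%:E) = EFin \o normal_pdf m (Num.sqrt v).
  by apply/funext => y /=; rewrite mul1r gaussianE.
split; first by rewrite E; exact: integrable_normal_pdf.
by rewrite E; exact: integral_normal_pdf.
Qed.

Lemma gauss_mean_eq m v g g' l l' : gauss_mean m v g l -> g =1 g' -> l = l' ->
  gauss_mean m v g' l'.
Proof. by move=> H /funext <- <-. Qed.

Lemma gauss_meanD m v g g' l l' : gauss_mean m v g l -> gauss_mean m v g' l' ->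
  gauss_mean m v (fun y => g y + g' y) (l + l').
Proof.
move=> [ig eg] [ig' eg'].
have E : (fun y => ((g y + g' y) * gaussian m v y)%:E) =
  ((fun y => (g y * gaussian m v y)%:E) \+ (fun y => (g' y * gaussian m v y)%:E))%E.
  by apply/funext => y; rewrite mulrDl.
split; first by rewrite E; exact: integrableD.
by rewrite E integralD// eg eg'.
Qed.

Lemma gauss_meanZ m v c g l : gauss_mean m v g l -> gauss_mean m v (fun y => c * g y) (c * l).
Proof.
move=> [ig eg].
have E : (fun y => (c * g y * gaussian m v y)%:E) =
  (fun y => c%:E * (g y * gaussian m v y)%:E)%E.
  by apply/funext => y; rewrite -mulrA.
split; first by rewrite E; exact: integrableZl.
by rewrite E integralZl// eg.
Qed.

Lemma gauss_mean_le m v g g' l l' : gauss_mean m v g l -> gauss_mean m v g' l' ->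
  (forall y, g y <= g' y) -> l <= l'.
Proof.
move=> [ig eg] [ig' eg'] gg; rewrite -lee_fin -eg -eg'; apply: le_integral => //.
by move=> y _; rewrite lee_fin ler_wpM2r// gaussian_ge0.
Qed.

(** Change of measure: the weight [w] carries one Gaussian density to a multiple of another. *)
Lemma gauss_mean_tilt m v m' v' g (w : R -> R) l c :
  (forall y, w y * gaussian m v y = c * gaussian m' v' y) ->
  gauss_mean m' v' g l -> gauss_mean m v (fun y => w y * g y) (c * l).
Proof.
move=> H /(gauss_meanZ c)[ig eg].
have E : (fun y => (w y * g y * gaussian m v y)%:E) =
  (fun y => (c * g y * gaussian m' v' y)%:E).
  by apply/funext => y; rewrite mulrAC H mulrAC.
by split; rewrite E.
Qed.

Lemma gauss_mean_exp m v k : 0 < v ->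
  gauss_mean m v (fun y => expR (k * y)) (expR (k * m + k ^+ 2 * v / 2)).
Proof.
move=> v0; apply: (gauss_mean_eq (gauss_mean_tilt (w := fun y => expR (k * y))
   (c := expR (k * m + k ^+ 2 * v / 2)) _ (gauss_mean1 (m + k * v) v0))) => [y|y|].
- rewrite /gaussian !mulrA -!expRD; congr (expR _ / _).
  by field; rewrite gt_eqF.
- by rewrite mulr1.
- by rewrite mulr1.
Qed.

Lemma integrable_gauss_id m v : 0 < v ->
  mu.-integrable setT (fun y => (y * gaussian m v y)%:E).
Proof.
move=> v0.
have H := gauss_meanD (gauss_mean_exp m 1 v0) (gauss_mean_exp m (-1) v0).
apply: (le_integrable _ _ _ H.1) => //.
  apply/measurable_EFinP/measurable_funM => //.
  rewrite (_ : gaussian m v = normal_pdf m (Num.sqrt v)); first exact: measurable_normal_pdf.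
  by apply/funext => y; rewrite gaussianE.
move=> y _; rewrite /= lee_fin !normrM ler_wpM2r// mul1r mulN1r.
rewrite [leRHS]ger0_norm ?addr_ge0 ?expR_ge0//.
have := expR_ge1Dx y; have := expR_ge1Dx (- y).
have := expR_gt0 y; have := expR_gt0 (- y).
by have [y0|y0] := ger0P y; lra.
Qed.

(* From [1 + k y <= e^(k y)] and the exponential moments, letting [k] tend to 0. *)
Lemma gauss_mean_id m v : 0 < v -> gauss_mean m v id m.
Proof.
move=> v0; have ii := integrable_gauss_id m v0.
have [e H] : exists e, gauss_mean m v (fun y => y - m) e.
  suff [e] : exists e, gauss_mean m v id e.
    move=> /gauss_meanD/(_ (gauss_meanZ (- m) (gauss_mean1 m v0))) H.
    by eexists; apply: (gauss_mean_eq H) => // y; rewrite mulr1.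
  exists (fine (\int[mu]_y (y * gaussian m v y)%:E)%E); split => //.
  by rewrite fineK//; exact: integrable_fin_num.
suff e0 : e = 0.
  rewrite e0 in H; apply: (gauss_mean_eq (gauss_meanD H (gauss_meanZ m (gauss_mean1 m v0)))) => [y|].
    by rewrite mulr1 subrK.
  by rewrite add0r mulr1.
have K k : 1 + k * e <= expR (k ^+ 2 * v / 2).
  have := gauss_mean_le (gauss_meanD (gauss_mean1 m v0) (gauss_meanZ k H))
    (gauss_meanZ (expR (- (k * m))) (gauss_mean_exp m k v0)).
  rewrite -expRD addrA addNr add0r; apply => y.
  by rewrite -expRD (_ : - _ + _ = k * (y - m)) ?expR_ge1Dx//; ring.
apply/eqP/negPn/negP => e0.
have e2 : 0 < e ^+ 2 by rewrite exprn_even_gt0.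
(* [k = e / D] with [D] large; then [k^2 v / 2] is below [k e / 2] *)
pose D := v + e ^+ 2 + 1.
have D0 : 0 < D by rewrite /D; nra.
have := K (e / D); set q := (e / D) ^+ 2 * v / 2.
have q0 : 0 <= q by rewrite /q divr_ge0// mulr_ge0 ?sqr_ge0// ltW.
have eq1 : e / D * e = e ^+ 2 / D by rewrite mulrAC -expr2.
have qle : q <= (e ^+ 2 / D) / 2.
  rewrite (_ : q = e ^+ 2 / D / 2 * (v / D)); last by rewrite /q; field; rewrite gt_eqF.
  by rewrite ler_piMr ?divr_ge0 ?sqr_ge0 ?ltW// ltr_pdivrMr// mul1r /D; nra.
have q1 : e ^+ 2 / D < 1 by rewrite ltr_pdivrMr// mul1r /D; nra.
have p0 : 0 < e ^+ 2 / D by rewrite divr_gt0.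
have : expR q <= (1 - q)^-1.
  rewrite -[leLHS]invrK -expRN lef_pV2 ?posrE ?expR_gt0//; last lra.
  exact: expR_ge1Dx.
rewrite eq1; set p := e ^+ 2 / D in qle q1 p0 *.
move=> h1 h2; have : (1 + p) * (1 - q) <= 1.
  rewrite -ler_pdivlMr ?div1r; last lra.
  exact: le_trans h2 h1.
nra.
Qed.


(** As a function of the step [y], the product of the two Gaussians is the Brownian bridge law of
    mean hx/(t+h) and variance th/(t+h), times a Gaussian in [x]. The square root supplies the 1/2
    of the exponent 3/2. *)
Lemma gauss_mean_bridge t h x g l : 0 < t -> 0 < h ->
  gauss_mean (h * x / (t + h)) (t * h / (t + h)) g l ->
  gauss_mean 0 h (fun y => expR (- (x - y) ^+ 2 / (2 * t)) * g y)
    (Num.sqrt (t / (t + h)) * expR (- x ^+ 2 / (2 * (t + h))) * l).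
Proof.
move=> t0 h0; have th0 : 0 < t + h by exact: addr_gt0.
apply: gauss_mean_tilt => y; rewrite /gaussian.
have -> : Num.sqrt (2 * pi * (t * h / (t + h))) =
    Num.sqrt (t / (t + h)) * Num.sqrt (2 * pi * h).
  rewrite -sqrtrM; last by rewrite divr_ge0// ltW.
  by congr Num.sqrt; field; rewrite gt_eqF.
have s0 : Num.sqrt (t / (t + h)) != 0 by rewrite sqrtr_eq0 -ltNge divr_gt0.
have s1 : Num.sqrt (2 * pi * h) != 0.
  by rewrite sqrtr_eq0 -ltNge mulr_gt0// mulr_gt0// pi_gt0.
rewrite mulrA -expRD.
transitivity (expR (- x ^+ 2 / (2 * (t + h)) + - (y - h * x / (t + h)) ^+ 2 /
    (2 * (t * h / (t + h)))) / Num.sqrt (2 * pi * h)); last first.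
  by rewrite expRD; field; rewrite s0 s1.
congr (expR _ / _); rewrite subr0; field.
by rewrite !gt_eqF.
Qed.

(** Both profiles have this shape, in the position [o - y] before the step. The factor e^(v/2) is
    the gain of either barrier, e^(2v) a loss that is small at large positions. *)
Lemma gauss_mean_form m v o a b c d : 0 < v ->
  gauss_mean m v
    (fun y => a + b * (o - y) + c * expR (- (o - y)) + d * expR (- 2 * (o - y)))
    (a + b * (o - m) + c * expR (- (o - m) + v / 2) + d * expR (- 2 * (o - m) + 2 * v)).
Proof.
move=> v0.
have H1 := gauss_meanZ (a + b * o) (gauss_mean1 m v0).
have H2 := gauss_meanZ (- b) (gauss_mean_id m v0).
have H3 := gauss_meanZ (c * expR (- o)) (gauss_mean_exp m 1 v0).
have H4 := gauss_meanZ (d * expR (- 2 * o)) (gauss_mean_exp m 2 v0).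
apply: (gauss_mean_eq (gauss_meanD (gauss_meanD (gauss_meanD H1 H2) H3) H4)) => [y|].
  rewrite -!mulrA -!expRD; congr (_ + _ * expR _ + _ * expR _); by ring.
rewrite -!mulrA -!expRD; congr (_ + _ * expR _ + _ * expR _); by field.
Qed.

End gaussian_means.

Section brownian_avg.
Context d (T : measurableType d) (R : realType) (P : probability T R).
Variables (tau : seq bool -> {RV P >-> R}) (B : seq bool -> R -> {RV P >-> R}).
Hypothesis hB : branching_brownian_motion tau B.
Local Notation W := (root_motion B).

Lemma gauss_mean_avg (h : R) (f : R -> R) (x : R) : 0 < h ->
  bounded_meas f -> (forall y, 0 <= f y) ->
  gauss_mean 0 h (fun y => f (x - y)) (avg P W h f x).
Proof.
move=> h0 bf f0.
have mfx : measurable_fun setT (fun y : R => f (x - y)).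
  by apply: measurableT_comp => //; [case: bf|exact: measurable_funB].
have E : (\int[lebesgue_measure]_y (f (x - y) * gaussian 0 h y)%:E =
    (avg P W h f x)%:E)%E.
  rewrite avgE//.
  have -> : (\int[P]_w (f (x - W h w))%:E = \int[P]_w (f (x - B [::] h w))%:E)%E.
    by apply: eq_integral => w _; rewrite /root_motion max_l// ltW.
  rewrite (brownian_ge0_integral (f := fun y => (f (x - y))%:E) (bbm_motion hB _) h0)//.
  - by apply: eq_integral => y _; rewrite -EFinM gaussianE.
  - by apply/measurable_EFinP.
  - by move=> y; rewrite lee_fin.
split => //; apply/integrableP; split.
  apply/measurable_EFinP/measurable_funM => //.
  rewrite (_ : gaussian 0 h = normal_pdf 0 (Num.sqrt h)); first exact: measurable_normal_pdf.
  by apply/funext => y; rewrite gaussianE.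
rewrite [ltLHS](_ : _ = (avg P W h f x)%:E) ?ltry// -E; apply: eq_integral => y _.
by rewrite /= ger0_norm// mulr_ge0// gaussian_ge0.
Qed.

Local Notation u := (surv tau B).

Lemma bounded_meas_surv t : bounded_meas (u t).
Proof. exact: (bounded_meas_u (measurable_surv hB) (surv01 hB)). Qed.

Let duhamel_surv (t h x : R) : 0 <= t -> 0 <= h ->
  ((u (t + h) x)%:E = (expR (- h))%:E * \int[P]_w (u t (x - W h w))%:E +
   \int[lebesgue_measure]_(s in `[0%R, h]) ((expR (- s))%:E *
       \int[P]_w (branch (u (t + h - s) (x - W s w)))%:E))%E.
Proof.
exact: (markov_duhamel (measurable_root_motion2 hB) (measurable_root_motion B)
  (root_motion_semigroup hB) (measurable_surv hB) (surv01 hB) (renewal_surv hB)).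
Qed.

Lemma surv_markov_lower (t h x : R) : 0 <= t -> 0 <= h <= 1 / 4 ->
  expR h * avg P W h (u t) x -
    (expR (2 * h) - expR h) * avg P W h (fun y => u t y ^+ 2) x <= u (t + h) x.
Proof.
exact: (markov_lower (measurable_root_motion2 hB) (measurable_root_motion B)
  (root_motion_semigroup hB) (root_motion0 hB) (measurable_surv hB) (surv01 hB)
  duhamel_surv).
Qed.

Lemma surv_markov_upper (t h x : R) : 0 <= t -> 0 <= h ->
  u (t + h) x <= expR h * avg P W h (u t) x.
Proof.
exact: (markov_upper (measurable_root_motion2 hB) (measurable_root_motion B)
  (root_motion_semigroup hB) (root_motion0 hB) (measurable_surv hB) (surv01 hB)
  duhamel_surv).
Qed.

Lemma surv_ge_root (t x : R) : 0 <= t ->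
  ((expR (- t))%:E * P [set w | x < W t w]%R <= (u t x)%:E)%E.
Proof.
move=> t0; rewrite (renewal_surv hB)// leeDl// integral_ge0// => s _.
rewrite mule_ge0 ?lee_fin ?expR_ge0// integral_ge0// => w _.
by rewrite lee_fin; case/andP: (branch01 (surv01 hB (t - s) (x - W s w))).
Qed.

Lemma surv_time0 (x : R) : 0 <= x -> u 0 x = 0.
Proof.
move=> x0; apply: EFin_inj; rewrite (renewal_surv hB)// set_interval.set_itv1.
rewrite integral_set1 adde0 (_ : [set w | _] = set0) ?measure0 ?mule0//.
by apply/seteqP; split => w //=; rewrite (root_motion0 hB) ltNge x0.
Qed.

(* [r - (e^h - 1) r^2] is nondecreasing on [0, 1] for [h = 1/4], which is why
   [surv] may be replaced by a lower bound [r] inside the nonlinearity. *)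
Lemma surv_step_lower (t x l : R) (g : R -> R) : 0 <= t ->
  (forall y, exists2 r : R, 0 <= r <= u t (x - y) & g y <= r - r ^+ 2 / 3) ->
  gauss_mean 0 (1 / 4) g l -> expR (1 / 4) * l <= u (t + 1 / 4) x.
Proof.
move=> t0 gu gl; have h4 : 0 <= (1 / 4 : R) <= 1 / 4 by lra.
have u0 y : 0 <= u t y by case/andP: (surv01 hB t y).
have u1 y : u t y <= 1 by case/andP: (surv01 hB t y).
apply: (le_trans _ (surv_markov_lower x t0 h4)).
have H4 : (0 : R) < 1 / 4 by lra.
have G1 := gauss_mean_avg x H4 (bounded_meas_surv t) u0.
have G2 := gauss_mean_avg x H4 (bounded_meas_sqr (bounded_meas_surv t))
  (fun y => sqr_ge0 _).
set e := expR (1 / 4).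
have e0 : 0 < e by exact: expR_gt0.
have e2 : expR (2 * (1 / 4)) = e ^+ 2 by rewrite /e expr2 -expRD; congr expR; ring.
(* From 1 - 1/4 <= e^(-1/4). Hence e^h - 1 <= 1/3, the coefficient of the square in the
   hypothesis. *)
have e43 : e <= 4 / 3.
  have := expR_ge1Dx (- (1 / 4 : R)); rewrite expRN -/e => h.
  rewrite -[e]invrK -[4 / 3]invrK lef_pV2 ?posrE ?invr_gt0//; lra.
have G3 := gauss_meanD G1 (gauss_meanZ (- (e - 1)) G2).
have : l <= avg P W (1 / 4) (u t) x +
    - (e - 1) * avg P W (1 / 4) (fun y => u t y ^+ 2) x.
  apply: (gauss_mean_le gl G3) => y.
  have [r /andP[r0 rv] gr] := gu y; apply: (le_trans gr).
  have := u1 (x - y); set v := u t (x - y) in rv *; move=> v1.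
  have : 0 <= (v - r) * (1 - (v + r) / 3) by rewrite mulr_ge0 ?subr_ge0//; lra.
  have : (e - 1) * v ^+ 2 <= v ^+ 2 / 3.
    by rewrite mulrC ler_wpM2l ?sqr_ge0//; lra.
  lra.
rewrite e2 -(ler_pM2l e0); set q := avg _ _ _ _ _; set q' := avg _ _ _ _ _; lra.
Qed.

Lemma surv_step_upper (t h x l : R) (g : R -> R) : 0 <= t -> 0 < h ->
  (forall y, u t (x - y) <= g y) ->
  gauss_mean 0 h g l -> u (t + h) x <= expR h * l.
Proof.
move=> t0 h0 ug gl; apply: (le_trans (surv_markov_upper _ _ _)) => //; first exact: ltW.
rewrite ler_wpM2l ?expR_ge0//; apply: (gauss_mean_le _ gl ug).
apply: gauss_mean_avg => //; first exact: bounded_meas_surv.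
by move=> y; case/andP: (surv01 hB t y).
Qed.

End brownian_avg.

(** * Lower bound *)

Section elementary.
Context {R : realType}.
Implicit Types (t h x y z : R).

Definition lam : R := Num.sqrt 2.
Definition ell t : R := 3 / (2 * lam) * ln t.

Lemma lam_sqr : lam ^+ 2 = 2 :> R.
Proof. by rewrite sqr_sqrtr. Qed.

Lemma lam_bounds : 7 / 5 <= (lam : R) <= 3 / 2.
Proof.
have l0 : 0 <= lam :> R by rewrite sqrtr_ge0.
have l2 := @lam_sqr; apply/andP; split; rewrite leNgt; apply/negP => h; nra.
Qed.

Lemma lam_ell t : lam * ell t = 3 / 2 * ln t.
Proof.
by have /andP[l1 _] := lam_bounds; rewrite /ell; field; rewrite gt_eqF//; lra.
Qed.

Lemma ell_coef : 1 <= 3 / (2 * (lam : R)) <= 15 / 14.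
Proof.
have /andP[l1 l2] := lam_bounds.
rewrite ler_pdivlMr; last lra.
by rewrite ler_pdivrMr; lra.
Qed.

Lemma le_ell t t' : 0 < t -> t <= t' -> ell t <= ell t'.
Proof.
move=> t0 tt'; have /andP[c1 _] := ell_coef.
by rewrite /ell ler_wpM2l ?ler_ln ?posrE//; lra.
Qed.

Lemma expR_ge_sqr x : 0 <= x -> (1 + x / 2) ^+ 2 <= expR x.
Proof.
move=> x0; rewrite [in leRHS](_ : x = 2%:R * (x / 2)); last by field.
by rewrite expRM_natl lerXn2r ?nnegrE ?expR_ge0 ?expR_ge1Dx// addr_ge0// divr_ge0.
Qed.

Lemma expR_le_inv x : x < 1 -> expR x <= (1 - x)^-1.
Proof.
move=> x1; rewrite -[leLHS]invrK -expRN lef_pV2 ?posrE ?expR_gt0 ?subr_gt0//.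
exact: expR_ge1Dx.
Qed.

Lemma ln_ratio_le t h : 0 < t -> 0 <= h -> ln (t + h) - ln t <= h / t.
Proof.
move=> t0 h0; have th0 : 0 < t + h by lra.
rewrite -ln_div ?posrE// mulrDl divff ?gt_eqF//; apply: le_ln1Dx.
by rewrite (lt_le_trans (ltrN10 _))// divr_ge0// ltW.
Qed.

Lemma ln_ratio_ge t h : 0 < t -> 0 <= h -> h / (t + h) <= ln (t + h) - ln t.
Proof.
move=> t0 h0; have th0 : 0 < t + h by lra.
rewrite -[leRHS]opprB lerNr -ln_div ?posrE//.
rewrite (_ : t / (t + h) = 1 + - (h / (t + h))); last by field; rewrite gt_eqF.
apply: le_ln1Dx; rewrite ltrN2 ltr_pdivrMr//; lra.
Qed.

Lemma ln_le_sqrt t : 0 < t -> ln t <= 2 * Num.sqrt t.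
Proof.
move=> t0; have s0 : 0 < Num.sqrt t by rewrite sqrtr_gt0.
rewrite -[in leLHS](sqr_sqrtr (ltW t0)) lnXn// -[ln _ *+ 2]mulr_natl ler_wpM2l// ltW//.
exact: ln_sublinear.
Qed.

Lemma sqrt_ratio t h : 0 < t -> 0 <= h ->
  Num.sqrt (t / (t + h)) = expR ((ln t - ln (t + h)) / 2).
Proof.
move=> t0 h0; have th0 : 0 < t + h by lra.
apply/eqP; rewrite -(@eqrXn2 _ 2)// ?expR_ge0// sqr_sqrtr ?divr_ge0// 1?ltW//.
by rewrite -expRM_natr divfK// -ln_div ?posrE// lnK// posrE divr_gt0.
Qed.

End elementary.

Section lower_barrier.
Context {R : realType}.
Implicit Types (t h x y z c e : R).

(** The term -e^(-2z) prevails at negative z and, as e^(-z) - e^(-2z) <= 1/4, the positive part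
    lives on z > 23/4, where all exponentials are small. *)
Definition lower_profile z : R := z - 6 + expR (- z) - expR (- 2 * z).

Lemma expRM2 z : expR (- 2 * z) = expR (- z) ^+ 2.
Proof. by rewrite -expRM_natl; congr expR; ring. Qed.

Lemma lower_profile_le z : lower_profile z <= z - 23 / 4.
Proof. rewrite /lower_profile expRM2; have := sqr_ge0 (expR (- z) - 1 / 2); nra. Qed.

(** Where the profile is positive, lam >= 7/5 splits the weight into e^(-z) e^(-2z/5), and z^2
    e^(-2z/5) <= 25; the quadratic loss is thus at most 25/3000 of c e^(-z), below 1/64. *)
Lemma lower_pointwise c e z : 0 <= c <= e * expR (- lam * z) -> 0 <= e <= 1 / 1000 ->
  c * (lower_profile z - 1 / 64 * expR (- z)) <=
  c * Num.max (lower_profile z) 0 - (c * Num.max (lower_profile z) 0) ^+ 2 / 3.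
Proof.
move=> /andP[c0 cz] /andP[e0 e1]; have ez := expR_gt0 (- z).
have [Hneg|Hpos] := leP (lower_profile z) 0.
  by rewrite mulr0 expr0n/= mul0r subr0 mulr_ge0_le0//; lra.
rewrite exprMn expr2 -!mulrA -mulrBr ler_wpM2l// lerD2l lerN2.
have z6 : 23 / 4 < z by have := lower_profile_le z; lra.
have Hz : lower_profile z ^+ 2 <= z ^+ 2.
  by rewrite lerXn2r ?nnegrE//; have := lower_profile_le z; lra.
have /andP[l1 _] := @lam_bounds R.
have c1 : c <= e * (expR (- z) * expR (- (2 / 5 * z))).
  apply: (le_trans cz); rewrite ler_wpM2l// -expRD ler_expR; nra.
have z2 : z ^+ 2 * expR (- (2 / 5 * z)) <= 25.
  rewrite expRN ler_pdivrMr ?expR_gt0//.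
  have /expR_ge_sqr : 0 <= 2 / 5 * z by lra.
  nra.
have : c * lower_profile z ^+ 2 <= e * (expR (- z) * expR (- (2 / 5 * z))) * z ^+ 2.
  by rewrite ler_pM// sqr_ge0.
have : e * expR (- z) * (z ^+ 2 * expR (- (2 / 5 * z))) <= e * expR (- z) * 25.
  by rewrite ler_wpM2l// mulr_ge0// ltW.
have : e * expR (- z) <= 1 / 1000 * expR (- z) by rewrite ler_wpM2r// ltW.
move: ez z2 c0 c1 e0 e1 cz Hz; set E := expR (- z); set F := expR (- _).
set H2 := _ ^+ 2; set z2 := z ^+ 2; nra.
Qed.


(** Recentring by the bridge gains h ell t / t, and the growth of [ell] costs at most (15/14) h/t.
    With [ell t >= 15/2] the surplus covers 6h/t, the price of the constant -6, which the bridge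
    does not contract. *)
Lemma lower_drift t (h := 1 / 4 : R) (d := h * ell t / t - (ell (t + h) - ell t)) :
  200 <= Num.sqrt t -> 15 / 2 <= ell t -> 6 * h / t <= d <= 1 / 100.
Proof.
move=> s0 l8.
have t0 : 0 < t by rewrite -sqrtr_gt0; lra.
have /andP[c1 c2] := @ell_coef R.
have h0 : 0 <= h by rewrite /h; lra.
have Lh := ln_ratio_le t0 h0.
have Le : ell (t + h) - ell t = 3 / (2 * lam) * (ln (t + h) - ln t) by rewrite /ell mulrBr.
have Lm : ell t <= ell (t + h) by apply: le_ell => //; lra.
have ht0 : 0 < h / t by rewrite divr_gt0// /h; lra.
apply/andP; split.
  have -> : 6 * h / t = 6 * (h / t) by rewrite mulrA.
  have E : h * ell t / t = ell t * (h / t) by rewrite (mulrC h) -mulrA.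
  rewrite /d Le E; nra.
have Ls := ln_le_sqrt t0.
have st : Num.sqrt t ^+ 2 = t by rewrite sqr_sqrtr ?ltW.
have : h * ell t / t <= 1 / 100.
  rewrite ler_pdivrMr// /h /ell.
  set q := Num.sqrt t in s0 Ls st *; set L := ln t in Ls *; set k := 3 / _ in c1 c2 *.
  have L0 : k * L <= 15 / 14 * (2 * q).
    by apply: (le_trans (ler_wpM2l _ Ls)); [lra|rewrite ler_wpM2r//; nra].
  nra.
rewrite /d; lra.
Qed.

(** [lower_drift] settles the linear part. For the rest, e^(v/2) exceeds 1 by about 1/8, which
    outweighs the loss 1/64, the factor e^d <= 51/50 and e^(2v - z) <= 1/32. *)
Lemma lower_final t y (h := 1 / 4 : R) (d := h * ell t / t - (ell (t + h) - ell t))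
    (q := t / (t + h)) (z := q * (y + d)) (v := t * h / (t + h)) :
  200 <= Num.sqrt t -> 15 / 2 <= ell t -> 0 < lower_profile y ->
  q * lower_profile y <=
  - 6 + z + (1 - 1 / 64) * expR (- z + v / 2) - expR (- 2 * z + 2 * v).
Proof.
move=> s0 l8 Hy.
have t0 : 0 < t by rewrite -sqrtr_gt0; lra.
have t1 : 100 <= t by rewrite -[t]sqr_sqrtr ?(ltW t0)//; nra.
have /andP[d1 d2] := lower_drift s0 l8; rewrite -/h -/d in d1 d2.
have y6 : 23 / 4 < y by have := lower_profile_le y; lra.
have d0 : 0 <= d by apply: (le_trans _ d1); rewrite divr_ge0// /h; lra.
have th0 : 0 < t + h by rewrite /h; lra.
have qv : v = q * h by rewrite /v /q mulrAC.
have q1 : 99 / 100 <= q by rewrite /q ler_pdivlMr// /h; lra.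
have q2 : q <= 1 by rewrite /q ler_pdivrMr// /h; lra.
have zy : z <= y + d by rewrite /z ler_piMl//; clear -y6 d0; lra.
have z5 : 11 / 2 <= z by rewrite /z; clear -y6 d0 q1; nra.
have A1 : q * (y - 6) <= - 6 + z.
  rewrite /z -subr_ge0 (_ : _ - _ = q * d - (1 - q) * 6); last by ring.
  rewrite subr_ge0 (_ : 1 - q = h / (t + h)); last by rewrite /q; field; rewrite gt_eqF.
  rewrite (_ : h / (t + h) * 6 = q * (6 * h / t)); last first.
    by rewrite /q; field; rewrite !gt_eqF.
  by rewrite ler_wpM2l//; lra.
have v1 : 12 / 50 <= v <= 1 / 4 by rewrite qv /h; clear -q1 q2; lra.
have A2 : expR (- y) <= expR (- z) * expR d by rewrite -expRD ler_expR; clear -zy; lra.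
have ed : expR d <= 51 / 50.
  apply: (le_trans (expR_le_inv _)); first by clear -d2; lra.
  by rewrite -[leLHS]div1r ler_pdivrMr; clear -d2; lra.
have ev : 1 + v / 2 <= expR (v / 2) by exact: expR_ge1Dx.
have e5 : expR (2 * v - z) <= 1 / 32.
  apply: (@le_trans _ _ (expR (- 5))); first by rewrite ler_expR; clear -z5 v1; lra.
  rewrite expRN div1r lef_pV2 ?posrE ?expR_gt0//.
  have := expRM_natl 5 (1 : R); rewrite mulr1 => ->.
  have : 2 <= expR (1 : R) by have := expR_ge1Dx (1 : R); clear; lra.
  move=> e1; rewrite (_ : 32 = 2 ^+ 5); last by ring.
  by rewrite lerXn2r// ?nnegrE// expR_ge0.
have ez := expR_gt0 (- z); have ey := expR_gt0 (- y); have e2y := expR_gt0 (- 2 * y).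
rewrite expRD.
have -> : expR (- 2 * z + 2 * v) = expR (- z) * expR (2 * v - z).
  by rewrite -expRD; congr expR; ring.
have B : expR (- y) <= (1 - 1 / 64) * (expR (- z) * expR (v / 2)) - expR (- z) * expR (2 * v - z).
  apply: (le_trans A2).
  have -> : (1 - 1 / 64) * (expR (- z) * expR (v / 2)) - expR (- z) * expR (2 * v - z) =
    expR (- z) * ((1 - 1 / 64) * expR (v / 2) - expR (2 * v - z)) by ring.
  by rewrite ler_pM2l//; clear -ed ev e5 v1; lra.
have : q * (expR (- y) - expR (- 2 * y)) <= expR (- y).
  by have := ltW e2y; clear -q1 q2 ey; nra.
rewrite /lower_profile; clear -A1 B; lra.
Qed.

End lower_barrier.

Section lower_barrier_step.
Context d (T : measurableType d) (R : realType) (P : probability T R).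
Variables (tau : seq bool -> {RV P >-> R}) (B : seq bool -> R -> {RV P >-> R}).
Hypothesis hB : branching_brownian_motion tau B.
Local Notation u := (surv tau B).
Local Notation lam := (@lam R).

(* Up to [e], this is [t^(-3/2) e^t e^(-x^2/2t)] times the positive part of a
   nearly linear profile: at the front the heat kernel with absorption. *)
Definition lower_barrier (e t x : R) : R :=
  e * expR (t - 3 / 2 * ln t) * expR (- x ^+ 2 / (2 * t)) *
  Num.max (lower_profile (x - lam * t + ell t)) 0.

(** Expanding x^2/2t around x = lam t, lam^2 = 2 cancels e^t and lam ell t = (3/2) ln t cancels
    t^(-3/2). *)
Lemma barrier_weight (t x : R) (z := x - lam * t + ell t) : 0 < t ->
  expR (t - 3 / 2 * ln t) * expR (- x ^+ 2 / (2 * t)) =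
  expR (- lam * z) * expR (- (z - ell t) ^+ 2 / (2 * t)).
Proof.
move=> t0; rewrite -!expRD; congr expR; rewrite -lam_ell.
rewrite (_ : - lam * z + _ = t * (lam ^+ 2 / 2) - lam * ell t - x ^+ 2 / (2 * t)).
  by rewrite lam_sqr divff// mulr1 mulNr.
by rewrite /z; field; rewrite gt_eqF.
Qed.

Lemma lower_step (e t s : R) : 0 <= e <= 1 / 1000 -> 0 <= s ->
  200 <= Num.sqrt t -> 15 / 2 <= ell t ->
  (forall x, lower_barrier e t x <= u s x) ->
  forall x, lower_barrier e (t + 1 / 4) x <= u (s + 1 / 4) x.
Proof.
move=> e01 s0 t1 l8 IH x.
have t0 : 0 < t by rewrite -sqrtr_gt0; lra.
have e0 : 0 <= e by case/andP: e01.
set h : R := 1 / 4; have h0 : 0 < h by rewrite /h; lra.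
have th0 : 0 < t + h by lra.
rewrite {1}/lower_barrier; set y := x - lam * (t + h) + ell (t + h).
have [Hy|Hy] := leP (lower_profile y) 0.
  by rewrite mulr0; case/andP: (surv01 hB (s + h) x).
set C := e * expR (t - 3 / 2 * ln t); set o := x - lam * t + ell t.
have v0 : 0 < t * h / (t + h) by rewrite divr_gt0// mulr_gt0.
(* The coefficients of [lower_profile], that of e^(-z) lowered by the 1/64 of [lower_pointwise]. *)
have G := gauss_mean_form (h * x / (t + h)) o (- 6) 1 (1 - 1 / 64) (- 1) v0.
have Bt := gauss_meanZ C (gauss_mean_bridge t0 h0 G).
apply: (le_trans _ (surv_step_lower hB s0 _ Bt)).
  have F := lower_final t1 l8 Hy; rewrite -/h in F.
  set q := t / (t + h) in F *; set dd := h * ell t / t - _ in F.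
  (* In the old frame the bridge contracts the position by [q] and advances it by [dd]. *)
  have -> : o - h * x / (t + h) = q * (y + dd).
    rewrite /o /y /q /dd; field; rewrite !gt_eqF//.
  have q0 : 0 < q by rewrite /q divr_gt0.
  (* The prefactor changes by q^(3/2): [Num.sqrt q] is matched by the bridge, [q] by the contraction
     in [lower_final]. *)
  have -> : expR (t + h - 3 / 2 * ln (t + h)) =
     expR h * expR (t - 3 / 2 * ln t) * (Num.sqrt q * q).
    have ql : q = expR (ln t - ln (t + h)) by rewrite -ln_div ?posrE// lnK.
    rewrite {1}/q sqrt_ratio ?(ltW h0)// ql -!expRD; congr expR; by field.
  rewrite -/h [1 * (q * _)]mul1r mulN1r; set E := _ + _ in F *.
  set a := expR h; set b := expR (t - _); set w := expR (- x ^+ 2 / _).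
  have -> : a * (C * (Num.sqrt q * w * E)) = (a * C * Num.sqrt q * w) * E by ring.
  have -> : e * (a * b * (Num.sqrt q * q)) * w * lower_profile y =
    (a * C * Num.sqrt q * w) * (q * lower_profile y) by rewrite /C -/b; ring.
  by rewrite ler_wpM2l// !mulr_ge0// ?expR_ge0// sqrtr_ge0.
move=> y'; set z := o - y'.
have zE : z = (x - y') - lam * t + ell t by rewrite /z /o; ring.
exists (lower_barrier e t (x - y')).
  rewrite IH andbT /lower_barrier !mulr_ge0// ?expR_ge0// le_max lexx orbT//.
rewrite /lower_barrier -zE -/C mulrA.
have := @lower_pointwise R (C * expR (- (x - y') ^+ 2 / (2 * t))) e z _ e01.
rewrite (_ : lower_profile z - _ = - 6 + 1 * z + (1 - 1 / 64) * expR (- z) + - 1 * expR (- 2 * z)).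
  apply; rewrite mulr_ge0 ?mulr_ge0 ?expR_ge0//= /C -mulrA ler_wpM2l//.
  rewrite barrier_weight// -zE ler_piMr ?expR_ge0// -expR0 ler_expR.
  by rewrite mulNr oppr_le0 divr_ge0 ?sqr_ge0// mulr_ge0// ltW.
rewrite /lower_profile; ring.
Qed.

End lower_barrier_step.

(** * Comparison with a single Brownian path at bounded times *)

Section gaussian_comparison.
Context {R : realType}.
Implicit Types b t x : R.

(** Titu's inequality for the denominator (2t+1) + 1. As 2t+1 still exceeds 2t, a Gaussian factor is
    left over to absorb the factor [x] of the barrier. *)
Lemma titu_shift t x : 0 < t ->
  (x + 1) ^+ 2 / (2 * (t + 1)) <= x ^+ 2 / (2 * t + 1) + 1.
Proof.
move=> t0; rewrite ler_pdivrMr; last lra.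
rewrite (_ : (x ^+ 2 / (2 * t + 1) + 1) * (2 * (t + 1)) =
  (x + 1) ^+ 2 + (x - (2 * t + 1)) ^+ 2 / (2 * t + 1)).
  by rewrite lerDl divr_ge0 ?sqr_ge0//; lra.
by field; rewrite gt_eqF//; lra.
Qed.

Lemma le_expR_sqr (k x : R) : 0 < k <= 1 -> k * x <= expR (k * x ^+ 2).
Proof.
move=> /andP[k0 k1]; apply: (le_trans _ (expR_ge1Dx _)).
by have := sqr_ge0 (x - 1); nra.
Qed.

Lemma gaussian_comparison b t x : 1 <= t <= b -> 0 <= x ->
  expR t * expR (- x ^+ 2 / (2 * t)) * x <=
  expR (2 * b + 2) * Num.sqrt (2 * pi * (b + 1)) * (2 * b * (2 * b + 1)) *
    (expR (- (t + 1)) * gaussian 0 (t + 1) (x + 1)).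
Proof.
move=> /andP[t1 tb] x0; have t0 : 0 < t by lra.
have t10 : 0 < t + 1 by lra.
have titu := titu_shift x t0.
have s0 : 0 < Num.sqrt (2 * pi * (b + 1)).
  by rewrite sqrtr_gt0 mulr_gt0 ?mulr_gt0 ?pi_gt0//; lra.
have tt : 1 <= 2 * t * (2 * t + 1) <= 2 * b * (2 * b + 1) by apply/andP; split; nra.
(* The gap 1/(2t) - 1/(2t+1) between the two Gaussian rates. *)
pose k := (2 * t * (2 * t + 1))^-1.
have kE : k * x ^+ 2 = x ^+ 2 / (2 * t) - x ^+ 2 / (2 * t + 1).
  by rewrite /k; field; rewrite !gt_eqF//; lra.
set c := 2 * b * (2 * b + 1) in tt *; set c' := 2 * t * (2 * t + 1) in tt k kE *.
have /andP[c1 cc] := tt; have c'0 : 0 < c' by clear -c1; lra.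
have c0 : 0 < c by clear -c'0 cc; lra.
have xk : x <= c * expR (k * x ^+ 2).
  have k01 : 0 < k <= 1 by rewrite /k invr_gt0 c'0 invf_le1.
  rewrite (le_trans _ (ler_wpM2r (expR_ge0 _) cc))// -ler_pdivrMl//.
  exact: le_expR_sqr.
apply: (le_trans (ler_wpM2l _ xk)); first by rewrite mulr_ge0// expR_ge0.
set S := Num.sqrt (2 * pi * (t + 1)).
have S0 : 0 < S by rewrite /S sqrtr_gt0 mulr_gt0 ?mulr_gt0 ?pi_gt0.
have SS : 1 <= Num.sqrt (2 * pi * (b + 1)) / S.
  rewrite ler_pdivlMr// mul1r ler_wsqrtr// ler_wpM2l ?mulr_ge0 ?pi_ge0//.
  by rewrite lerD2r.
have -> : expR (2 * b + 2) * Num.sqrt (2 * pi * (b + 1)) * c *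
    (expR (- (t + 1)) * gaussian 0 (t + 1) (x + 1)) =
    c * (expR (2 * b + 2) * expR (- (t + 1)) *
    expR (- (x + 1 - 0) ^+ 2 / (2 * (t + 1)))) * (Num.sqrt (2 * pi * (b + 1)) / S).
  by rewrite /gaussian -/S; ring.
have cE0 : 0 <= c * (expR (2 * b + 2) * expR (- (t + 1)) *
    expR (- (x + 1 - 0) ^+ 2 / (2 * (t + 1)))).
  by rewrite mulr_ge0 ?(ltW c0)// !mulr_ge0 ?expR_ge0.
apply: (le_trans _ (ler_peMr cE0 SS)).
rewrite mulrCA ler_pM2l// -!expRD ler_expR subr0.
by rewrite kE !mulNr; clear -titu tb; lra.
Qed.

End gaussian_comparison.

Section lower_bound.
Context d (T : measurableType d) (R : realType) (P : probability T R).
Variables (tau : seq bool -> {RV P >-> R}) (B : seq bool -> R -> {RV P >-> R}).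
Hypothesis hB : branching_brownian_motion tau B.
Local Notation u := (surv tau B).
Local Notation W := (root_motion B).
Local Notation lam := (@lam R).

Let u0 t x : 0 <= u t x. Proof. by case/andP: (surv01 hB t x). Qed.

(** The density decreases on the unit interval from x to x + 1, so its value at the right end bounds
    the integral below. *)
Lemma root_tail_ge (s x : R) : 0 < s -> 0 <= x ->
  ((gaussian 0 s (x + 1))%:E <= P [set w | x < W s w]%R)%E.
Proof.
move=> s0 x0.
have mx : measurable_fun setT (fun y : R => ((x < y)%R%:R : R)%:E).
  by apply: measurable_natb; exact: measurable_fun_ltr.
have -> : P [set w | x < W s w] = (\int[P]_w ((x < B [::] s w)%R%:R : R)%:E)%E.
  rewrite ge0_integral_bool; last by apply: measurable_fun_ltr.
  by congr (P _); apply/seteqP; split => w; rewrite /= /root_motion max_l// ltW.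
rewrite (brownian_ge0_integral (f := fun y => ((x < y)%R%:R : R)%:E) (bbm_motion hB _) s0)//.
have -> : ((gaussian 0 s (x + 1))%:E =
    \int[lebesgue_measure]_(y in `]x, (x + 1)%R]) (gaussian 0 s (x + 1))%:E)%E.
  rewrite integral_cst// [X in (_ * X)%E](lebesgue_measure_itv `]x, (x + 1)%R]%R)/= lte_fin ltrDl ltr01.
  by rewrite -EFinD addrAC subrr add0r mule1.
rewrite integral_mkcond; apply: ge0_le_integral => //.
- by move=> y _; rewrite patchE; case: ifP; rewrite ?lee_fin ?gaussian_ge0.
- by apply/measurable_restrict => //; rewrite setIT; exact: measurable_cst.
- apply: emeasurable_funM => //; apply/measurable_EFinP; exact: measurable_normal_pdf.
move=> y _; rewrite patchE mem_setE in_itv/=; case: ifPn => [/andP[xy yx]|_]; last first.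
  by rewrite mule_ge0 ?lee_fin// normal_pdf_ge0.
rewrite xy mul1e lee_fin gaussianE// /gaussian !subr0.
rewrite ler_wpM2r ?invr_ge0// ler_expR !mulNr lerN2 ler_wpM2r ?invr_ge0//.
  by rewrite mulr_ge0// ltW.
by rewrite lerXn2r ?nnegrE//; lra.
Qed.

Lemma surv_ge_gaussian (s x : R) : 0 < s -> 0 <= x ->
  expR (- s) * gaussian 0 s (x + 1) <= u s x.
Proof.
move=> s0 x0; rewrite -lee_fin; apply: (le_trans _ (surv_ge_root hB x (ltW s0))).
by rewrite EFinM lee_wpmul2l ?lee_fin ?expR_ge0//; exact: root_tail_ge.
Qed.

(** An unbranched path suffices: it reaches time t + 1 with probability e^(-(t+1)), and its wider
    Gaussian dominates the barrier for all x and all t in [1, b] once [e] is small. *)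
Lemma lower_base (b : R) : 1 <= b -> exists2 e : R, 0 < e <= 1 / 1000 &
  forall t x, 1 <= t <= b -> lower_barrier e t x <= u (t + 1) x.
Proof.
move=> b1.
pose D := expR (2 * b + 2) * Num.sqrt (2 * pi * (b + 1)) * (2 * b * (2 * b + 1)).
have s0 : 0 < Num.sqrt (2 * pi * (b + 1)).
  by rewrite sqrtr_gt0 mulr_gt0 ?mulr_gt0 ?pi_gt0//; lra.
have D0 : 0 < D by rewrite /D !mulr_gt0 ?expR_gt0//; lra.
exists (Num.min (1 / 1000) D^-1).
  by rewrite lt_min invr_gt0 D0 ge_min lexx !andbT; lra.
set e := Num.min _ _; have e0 : 0 <= e by rewrite le_min invr_ge0 (ltW D0) andbT; lra.
move=> t x /andP[t1 tb]; rewrite /lower_barrier; set z := x - lam * t + ell t.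
have t0 : 0 < t by lra.
have [Hz|Hz] := leP (lower_profile z) 0; first by rewrite mulr0.
have Hz' := lower_profile_le z.
have xz : z <= x.
  have /andP[l1 _] := @lam_bounds R; have /andP[c1 c2] := @ell_coef R.
  have lt := ln_sublinear t0; have ln0 := ln_ge0 t1.
  suff : ell t <= lam * t by rewrite /z; lra.
  rewrite /ell; set k := 3 / _ in c1 c2 *; set l := lam in l1 *.
  by rewrite (@le_trans _ _ (15 / 14 * ln t))//; [rewrite ler_wpM2r|nra].
have x0 : 0 <= x by lra.
have t10 : 0 < t + 1 by lra.
apply: (le_trans _ (surv_ge_gaussian t10 x0)).
apply: (@le_trans _ _ (e * (expR t * expR (- x ^+ 2 / (2 * t)) * x))).
  rewrite -!mulrA ler_wpM2l//; apply: ler_pM; rewrite ?expR_ge0//.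
  - by rewrite mulr_ge0 ?expR_ge0// ltW.
  - by rewrite ler_expR; have := ln_ge0 t1; lra.
  - by rewrite ler_wpM2l ?expR_ge0//; lra.
set r := expR (- (t + 1)) * _.
suff H : expR t * expR (- x ^+ 2 / (2 * t)) * x <= D * r.
  apply: (@le_trans _ _ (D^-1 * (D * r))); last by rewrite mulKf// gt_eqF.
  apply: (le_trans (ler_wpM2l e0 H)); rewrite ler_wpM2r ?ge_min ?lexx ?orbT//.
  by rewrite mulr_ge0 ?(ltW D0)// /r mulr_ge0 ?expR_ge0 ?gaussian_ge0.
apply: gaussian_comparison => //.
by rewrite t1.
Qed.

(** [e] is fixed on the window from b to b + 1/4; every later time is reached from there by quarter
    steps, none of which changes [e]. *)
Lemma lower_barrier_le (b : R) : 1 <= b ->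
  (forall t, b <= t -> 200 <= Num.sqrt t /\ 15 / 2 <= ell t) ->
  exists2 e : R, 0 < e & forall t x, b <= t -> lower_barrier e t x <= u (t + 1) x.
Proof.
move=> b1 large; have [|e /andP[e0 e1] He] := @lower_base (b + 1 / 4); first lra.
exists e => // t x bt.
have [n tn] : exists n : nat, t <= b + n.+1%:R / 4.
  exists (Num.truncn (4 * (t - b))).
  have : 4 * (t - b) < (Num.truncn (4 * (t - b))).+1%:R by exact: truncnS_gt.
  lra.
elim: n t x bt tn => [|n IH] t x bt tn; first by apply: He; lra.
have [tn'|tn'] := leP t (b + n.+1%:R / 4); first exact: IH.
have bt' : b <= t - 1 / 4 by move: tn'; rewrite -natr1; have : 0 <= n%:R :> R by []; lra.
have tn4 : t - 1 / 4 <= b + n.+1%:R / 4 by move: tn; rewrite -[n.+2%:R]natr1; lra.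
have [s1 l1] := large _ bt'.
have := @lower_step _ _ _ _ _ _ hB e (t - 1 / 4) (t - 1 / 4 + 1) _ _ s1 l1
  (fun y => IH _ y bt' tn4) x.
by rewrite subrK addrAC subrK; apply; lra.
Qed.

Lemma lower_large : exists2 b : R, 1 <= b &
  forall t, b <= t -> 200 <= Num.sqrt t /\ 15 / 2 <= ell t.
Proof.
have [c c1 c2] : exists2 c : R, 1 <= c & c = 200 ^+ 2.
  by exists (200 ^+ 2); rewrite ?exprn_ege1// ler1n.
have e0 := expR_gt0 (15 / 2 : R).
exists (c + expR (15 / 2)); first lra.
move=> t bt; have t0 : 0 < t by lra.
split.
  have -> : 200 = Num.sqrt c :> R by rewrite c2 sqrtr_sqr ger0_norm// ler0n.
  by rewrite ler_wsqrtr//; lra.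
have /andP[k1 _] := @ell_coef R.
have : 15 / 2 <= ln t by rewrite -[leLHS]expRK ler_ln ?posrE//; lra.
rewrite /ell; set k := 3 / _ in k1 *; nra.
Qed.

(** At z = 7 the profile is at least 1, and the Gaussian factor is at least e^(-3) because (7 - ell
    t)^2 <= (ell t)^2 <= (15/7)^2 t < 6t. *)
Lemma surv_front_ge : exists2 a : R, 0 < a & exists b : R, forall t, b <= t ->
  1 <= t /\ a <= u (t + 1) (lam * t - ell t + 7).
Proof.
have [b b1 large] := lower_large; have [e e0 He] := lower_barrier_le b1 large.
exists (e * expR (- lam * 7 - 3)); first by rewrite mulr_gt0// expR_gt0.
exists b => t bt; split; first exact: le_trans bt.
have [s200 l7] := large _ bt; have t0 : 0 < t by lra.
apply: (le_trans _ (He t _ bt)).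
have x7 : lam * t - ell t + 7 - lam * t + ell t = 7 by ring.
have BW := barrier_weight (lam * t - ell t + 7) t0; rewrite x7 -[RHS]expRD in BW.
rewrite /lower_barrier x7 -(mulrA e) BW -mulrA ler_wpM2l ?(ltW e0)//.
have H1 : 1 <= Num.max (lower_profile 7) 0 :> R.
  rewrite le_max /lower_profile expRM2; apply/orP; left.
  have := expR_gt0 (- 7 : R); have : expR (- 7) <= 1 :> R by rewrite expR_le1; lra.
  nra.
apply: (@le_trans _ _ (expR (- lam * 7 + - (7 - ell t) ^+ 2 / (2 * t)))); last first.
  by rewrite ler_peMr// expR_ge0.
rewrite ler_expR lerD2l mulNr lerN2 ler_pdivrMr; last lra.
have /andP[c1 c2] := @ell_coef R; have Ls := ln_le_sqrt t0.
have : ell t <= 15 / 7 * Num.sqrt t.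
  rewrite /ell; set k := 3 / _ in c1 c2 *; set q := Num.sqrt t in Ls s200 *; nra.
have tq : Num.sqrt t ^+ 2 = t by rewrite sqr_sqrtr ?ltW.
rewrite -[X in _ <= 3 * (2 * X)]tq; set q := Num.sqrt t; set l := ell t in l7 *.
move=> lq; have : l ^+ 2 <= (15 / 7 * q) ^+ 2 by rewrite lerXn2r ?nnegrE//; lra.
by have := sqr_ge0 q; lra.
Qed.

(** By monotonicity [u] is at least [a] everywhere left of [x], and from x - 10 a step of variance
    1/4 sees almost nothing else. The indicator of y >= -10 is replaced by its minorant 1 - e^(-10 -
    y), whose mean is explicit. The gain is (81/64)(5/6)(99/100) > 26/25. *)
Lemma surv_amplify (s x a : R) : 0 <= s -> 0 <= a <= 1 / 2 -> a <= u s x ->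
  26 / 25 * a <= u (s + 1 / 4) (x - 10).
Proof.
move=> s0 /andP[a0 a2] au.
have h0 : (0 : R) < 1 / 4 by lra.
have G := gauss_meanZ (a - a ^+ 2 / 3) (gauss_meanD (gauss_mean1 0 h0)
  (gauss_meanZ (- expR (- 10)) (gauss_mean_exp 0 (- 1) h0))).
apply: (le_trans _ (surv_step_lower hB s0 _ G)).
  have e4 : 81 / 64 <= expR (1 / 4) :> R.
    by have := @expR_ge_sqr R _ (ltW h0); lra.
  have E9 : 100 <= expR (9 : R).
    have /expR_ge_sqr : 0 <= 9 / 2 :> R by lra.
    rewrite (_ : expR 9 = expR (9 / 2) ^+ 2); first by nra.
    by rewrite -expRM_natl; congr expR; field.
  rewrite mulNr; set p := expR (- 10) * _.
  have p1 : p <= 1 / 100.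
    apply: (@le_trans _ _ (expR (- 9))); first by rewrite /p -expRD ler_expR; lra.
    by rewrite expRN div1r lef_pV2 ?posrE ?expR_gt0// ltr0n.
  set g := (a - _) * _.
  have g1 : 33 / 40 * a <= g.
    rewrite (_ : 33 / 40 * a = 5 / 6 * a * (99 / 100)); last by field.
    by apply: ler_pM; [lra|lra|nra|lra].
  by apply: (@le_trans _ _ (81 / 64 * g)); [lra|rewrite ler_wpM2r//; lra].
move=> y; have [y10|y10] := leP (- 10) y.
  exists a; first by rewrite a0 (le_trans au)// surv_noninc//; lra.
  rewrite ler_piMr//; first nra.
exists 0; first by rewrite lexx u0.
rewrite expr0n/= mul0r subr0 mulr_ge0_le0//; first nra.
rewrite mulNr subr_le0 -expRD -[leLHS]expR0 ler_expR; lra.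
Qed.

Lemma surv_amplify_half (a : R) : 0 < a -> exists n : nat, forall s x : R,
  0 <= s -> a <= u s x -> 1 / 2 <= u (s + n%:R / 4) (x - 10 * n%:R).
Proof.
move=> a0; pose n := (Num.truncn (25 / a)).+1.
have na : 1 / 2 <= (26 / 25) ^+ n * a.
  have : 25 / a < n%:R by exact: truncnS_gt.
  rewrite ltr_pdivrMr// => H.
  have : 1 + n%:R / 25 <= (26 / 25) ^+ n :> R.
    elim: (n) => [|k IH]; first by rewrite expr0 mul0r addr0.
    by rewrite exprS -natr1; have : 0 <= k%:R :> R by []; lra.
  move=> H2; apply: (le_trans _ (ler_wpM2r (ltW a0) H2)); lra.
exists n => s x s0 ax.
(* Capped at 1/2, the range in which [surv_amplify] applies. *)
suff : Num.min (1 / 2) ((26 / 25) ^+ n * a) <= u (s + n%:R / 4) (x - 10 * n%:R).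
  by rewrite min_l.
elim: (n) => [|k IH].
  by rewrite expr0 !mulr0n mul0r addr0 mulr0 subr0 ge_min [1 * a]mul1r ax orbT.
have k0 : 0 <= k%:R :> R by [].
set m := Num.min _ _ in IH.
have m01 : 0 <= m <= 1 / 2.
  rewrite /m ge_min lexx le_min /=; apply/andP; split => //.
  by apply/andP; split; [lra|rewrite mulr_ge0 ?exprn_ge0 ?ltW//; lra].
have sk : 0 <= s + k%:R / 4 by lra.
have := surv_amplify sk m01 IH.
rewrite (_ : s + k%:R / 4 + 1 / 4 = s + k.+1%:R / 4); last by rewrite -natr1; field.
rewrite (_ : x - 10 * k%:R - 10 = x - 10 * k.+1%:R); last by rewrite -natr1; ring.
apply: le_trans; rewrite exprS -mulrA /m; set w := _ * a; case: (leP (1 / 2) w) => ?.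
  by rewrite ge_min; apply/orP; left; lra.
by rewrite ge_min lexx orbT.
Qed.

Lemma surv_front_ge_half : exists C b : R, forall t, b <= t ->
  1 / 2 <= u t (lam * t - ell t - C).
Proof.
have [a a0 [b Hb]] := surv_front_ge; have [n Hn] := surv_amplify_half a0.
(* One unit of time for the offset of the barrier, n/4 for the amplification. *)
pose c : R := 1 + n%:R / 4; have c1 : 1 <= c by rewrite /c lerDl divr_ge0.
exists (lam * c + 10 * n%:R - 7), (b + c) => t bt.
have /Hb[t1 ua] : b <= t - c by lra.
have := Hn (t - c + 1) _ _ ua; rewrite (_ : t - c + 1 + n%:R / 4 = t); last by rewrite /c; ring.
move=> H; apply: (le_trans (H _)); first lra.
apply: surv_noninc => //.
have : ell (t - c) <= ell t by apply: le_ell; lra.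
lra.
Qed.

End lower_bound.

(** * Upper bound *)

Section upper_barrier.
Context {R : realType}.
Implicit Types (t z v K : R).
Local Notation lam := (@lam R).

(** With e^(-z) subtracted, averaging lowers the profile; 2 e^(-2z) keeps it at least 1/2 on the
    whole line, so that no positive part is taken. *)
Definition upper_profile z : R := z - expR (- z) + 2 * expR (- 2 * z).

(** The displacement of the front over one unit of time. Taken as exponential rate, it makes the
    tilted step follow the frame exactly, so that recentring is a pure contraction. *)
Definition slope t : R := lam - (ell (t + 1) - ell t).

(** A variance growing by more than 1 per unit of time: the surplus yields a gain of order z^2
    t^(-5/2) against the variation of [slope], which costs z t^(-2). *)
Definition spread t : R := t + Num.sqrt t.

Definition upper_exponent K t z : R :=
  - K / Num.sqrt t - slope t * z - z ^+ 2 / (2 * spread t).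

Lemma upper_profile_ge z : 1 / 2 <= upper_profile z.
Proof.
rewrite /upper_profile expRM2; have := expR_ge1Dx (- z).
have := sqr_ge0 (expR (- z) - 1 / 2); nra.
Qed.

Lemma upper_profile_ge0 z : 0 <= upper_profile z.
Proof. by apply: le_trans (upper_profile_ge z); rewrite divr_ge0. Qed.

Lemma upper_profile_le z : 0 <= z -> upper_profile z <= z + 2.
Proof.
move=> z0; have : expR (- 2 * z) <= 1 by rewrite expR_le1; lra.
by have := expR_gt0 (- z); rewrite /upper_profile; lra.
Qed.

(** After factoring e^(-vz), the gain 1 + v/2 minus the loss 2 e^(2v - vz) <= 1/2 is still at least
    v. *)
Lemma upper_profile_mean v z : 1 / 2 <= v <= 1 -> 8 <= z ->
  v * z - expR (- (v * z) + v / 2) + 2 * expR (- 2 * (v * z) + 2 * v) <=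
  v * upper_profile z.
Proof.
move=> /andP[v1 v2] z8.
have ez := expR_gt0 (- z); have e2z := expR_gt0 (- 2 * z).
have A1 : expR (- z) <= expR (- (v * z)) by rewrite ler_expR; nra.
have A2 : 1 + v / 2 <= expR (v / 2) by exact: expR_ge1Dx.
have A3 : expR (2 * v - v * z) <= 1 / 4.
  apply: (@le_trans _ _ (expR (- 3))); first by rewrite ler_expR; nra.
  rewrite expRN div1r lef_pV2 ?posrE ?expR_gt0//.
  by have := expR_ge1Dx (3 : R); lra.
rewrite expRD (_ : expR (- 2 * (v * z) + 2 * v) = expR (- (v * z)) * expR (2 * v - v * z)).
  rewrite /upper_profile; set e := expR (- (v * z)) in A1 *.
  set a := expR (v / 2) in A2 *; set b := expR (_ - _) in A3 *.
  have : v * expR (- z) <= e * (a - 2 * b).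
    by rewrite mulrC; apply: ler_pM => //; lra.
  have : 0 <= v * expR (- 2 * z) by rewrite mulr_ge0 ?(ltW e2z)//; lra.
  lra.
by rewrite -expRD; congr expR; ring.
Qed.

Lemma slope_bounds t : 10 <= t -> 1 <= slope t <= 3 / 2.
Proof.
move=> t10; have /andP[l1 l2] := @lam_bounds R; have /andP[c1 c2] := @ell_coef R.
have t0 : 0 < t by lra.
have L0 : ell t <= ell (t + 1) by apply: le_ell; lra.
have := ln_ratio_le t0 ler01; rewrite /slope => L1.
have : 1 / t <= 1 / 10 by rewrite ler_pdivrMr//; lra.
have : ell (t + 1) - ell t = 3 / (2 * lam) * (ln (t + 1) - ln t) by rewrite /ell mulrBr.
have : 0 <= ln (t + 1) - ln t by rewrite subr_ge0 ler_ln ?posrE//; lra.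
set k := 3 / _ in c1 c2 *; nra.
Qed.

Lemma sqrt_increment (q p : R) : 10 <= q -> 0 < p -> p ^+ 2 = q ^+ 2 + 1 ->
  [/\ q < p, p <= 3 / 2 * q & q^-1 / 3 <= p - q].
Proof.
move=> q10 p0 p2; have q0 : 0 < q by lra.
have qp : q < p by nra.
have pq : p <= 3 / 2 * q by nra.
split => //; rewrite -(ler_pM2r (_ : 0 < 3 * q)); last by rewrite mulr_gt0.
by rewrite (_ : q^-1 / 3 * (3 * q) = 1); [nra|field; rewrite gt_eqF].
Qed.

Lemma inv_sqrt_gain K (q p : R) : 150 <= K -> 10 <= q -> 0 < p ->
  p ^+ 2 = q ^+ 2 + 1 -> 100 / 3 * q^-1 ^+ 3 <= K / q - K / p.
Proof.
move=> K150 q10 p0 p2; have [qp pq pq3] := sqrt_increment q10 p0 p2.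
have q0 : 0 < q by clear -q10; lra.
rewrite (_ : K / q - K / p = K * ((p - q) * (p * q)^-1)); last first.
  by field; rewrite !gt_eqF.
rewrite (_ : 100 / 3 * q^-1 ^+ 3 = 150 * (q^-1 / 3 * (3 / 2 * q * q)^-1)); last first.
  by field; rewrite gt_eqF.
have q3 : q^-1 / 3 * (3 / 2 * q * q)^-1 <= (p - q) * (p * q)^-1.
  rewrite ler_pM ?invr_ge0 ?divr_ge0 ?invr_ge0 ?mulr_ge0 ?(ltW q0)//.
  by rewrite lef_pV2 ?posrE ?mulr_gt0// ler_pM2r.
by rewrite ler_pM// ?ler0n// ?mulr_ge0 ?invr_ge0 ?mulr_ge0 ?(ltW q0).
Qed.

Lemma inv_spread_gain (q p : R) : 10 <= q -> 0 < p -> p ^+ 2 = q ^+ 2 + 1 ->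
  q^-1 ^+ 5 / 24 <= 1 / (2 * (q ^+ 2 + q + 1)) - 1 / (2 * (q ^+ 2 + 1 + p)).
Proof.
move=> q10 p0 p2; have [qp pq pq3] := sqrt_increment q10 p0 p2.
have q0 : 0 < q by clear -q10; lra.
have q2 : 0 < q ^+ 2 by rewrite exprn_gt0.
have s0 : 0 < q ^+ 2 + q + 1 by clear -q0 q2; lra.
have s1 : 0 < q ^+ 2 + 1 + p by clear -p0 q2; lra.
have s2 : q ^+ 2 + q + 1 <= 2 * q ^+ 2 by clear -q10; nra.
have s3 : q ^+ 2 + 1 + p <= 2 * q ^+ 2 by clear -q10 pq; nra.
set a := _ + 1 in s0 s2 *; set c := _ + p in s1 s3 *.
rewrite (_ : 1 / (2 * a) - 1 / (2 * c) = (p - q) * (2 * a * c)^-1); last first.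
  rewrite (_ : p - q = c - a); last by rewrite /a /c; ring.
  by field; rewrite !gt_eqF.
rewrite (_ : q^-1 ^+ 5 / 24 = q^-1 / 3 * (8 * q ^+ 4)^-1); last by field; rewrite gt_eqF.
rewrite ler_pM ?invr_ge0 ?divr_ge0 ?invr_ge0 ?mulr_ge0 ?exprn_ge0 ?(ltW q0)//.
rewrite lef_pV2 ?posrE ?mulr_gt0 ?exprn_gt0//.
rewrite (_ : 8 * q ^+ 4 = 2 * (2 * q ^+ 2) * (2 * q ^+ 2)); last by ring.
by apply: ler_pM; rewrite ?mulr_ge0 ?(ltW s0) ?(ltW s1)// ler_pM2l.
Qed.

Lemma slope_increment t : 100 <= t -> slope (t + 1) - slope t <= 15 / 7 * t^-1 ^+ 2.
Proof.
move=> t100; have t0 : 0 < t by lra.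
have T0 : 0 < t + 1 by lra.
have L1 := ln_ratio_le t0 ler01; have L2 := ln_ratio_ge T0 ler01.
have /andP[c1 c2] := @ell_coef R.
rewrite (_ : slope (t + 1) - slope t = 3 / (2 * lam) * (ln (t + 1) - ln t -
  (ln (t + 1 + 1) - ln (t + 1)))); last by rewrite /slope /ell; ring.
have : 1 / t - 1 / (t + 1 + 1) <= 2 * t^-1 ^+ 2.
  rewrite (_ : _ - _ = 2 * (t * (t + 2))^-1); last by field; rewrite !gt_eqF//; lra.
  rewrite exprVn ler_pM2l// lef_pV2 ?posrE ?mulr_gt0 ?exprn_gt0//; last lra.
  by rewrite expr2 ler_pM2l//; lra.
have : 0 <= t^-1 ^+ 2 by rewrite sqr_ge0.
set x := t^-1 ^+ 2; set k := 3 / _ in c1 c2 *; set w := _ - (_ - _).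
move=> x0 h; have wx : w <= 2 * x by rewrite /w; lra.
by apply: (le_trans (ler_wpM2l _ wx)); [clear -c1; lra|clear -c2 x0; nra].
Qed.

(** The logarithms for t and s nearly cancel, as ((t+1)/t)(s/(s+1)) = 1 + 1/(sqrt t (s+1)): using s
    in place of t costs only order t^(-3/2). *)
Lemma slope_loss t (s := spread t) : 100 <= t ->
  1 - slope t ^+ 2 / 2 + 3 / 2 * ln (s / (s + 1)) <= 3 / 2 * (Num.sqrt t)^-1 ^+ 3.
Proof.
move=> t100; have t0 : 0 < t by lra.
have T0 : 0 < t + 1 by lra.
have lE : lam * (ell (t + 1) - ell t) = 3 / 2 * (ln (t + 1) - ln t).
  by rewrite mulrBr !lam_ell -mulrBr.
have -> : 1 - slope t ^+ 2 / 2 = 3 / 2 * (ln (t + 1) - ln t) - (ell (t + 1) - ell t) ^+ 2 / 2.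
  by rewrite -lE /slope sqrrB lam_sqr; field.
have e2 := sqr_ge0 (ell (t + 1) - ell t); clear lE.
set q := Num.sqrt t; have q0 : 0 < q by rewrite /q sqrtr_gt0.
have q2 : q ^+ 2 = t by rewrite /q sqr_sqrtr// ltW.
have sE : s = q ^+ 2 + q by rewrite /s /spread -/q q2.
have s0 : 0 < s by rewrite /s /spread addr_gt0.
have s1 : 0 < s + 1 by clear -s0; lra.
suff : ln (t + 1) - ln t + ln (s / (s + 1)) <= q^-1 ^+ 3 by clear -e2; lra.
rewrite -ln_div ?posrE// -lnM ?posrE ?divr_gt0//.
rewrite (_ : _ * _ = 1 + q^-1 / (s + 1)); last first.
  by rewrite -q2 sE; field; rewrite -sE !gt_eqF.
have qs : 0 <= q^-1 / (s + 1) by rewrite divr_ge0 ?invr_ge0 ?(ltW q0) ?(ltW s1).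
apply: (le_trans (le_ln1Dx _)); first by rewrite (lt_le_trans _ qs)// ltrN10.
rewrite (_ : q^-1 ^+ 3 = q^-1 * (q ^+ 2)^-1); last by field; rewrite gt_eqF.
rewrite ler_wpM2l ?invr_ge0 ?(ltW q0)// lef_pV2 ?posrE ?exprn_gt0//.
by rewrite sE; clear -q0; lra.
Qed.

(* The gain of [- K / sqrt t] over one unit of time, of order [t^(-3/2)], pays for
   the errors in the exponent. *)
Lemma upper_exponent_step K t z (s := spread t) : 150 <= K -> 100 <= t -> 0 <= z ->
  1 - K / Num.sqrt t - slope t ^+ 2 / 2 - slope t * z - z ^+ 2 / (2 * (s + 1)) +
    3 / 2 * ln (s / (s + 1)) + (t * Num.sqrt t)^-1 <=
  upper_exponent K (t + 1) z.
Proof.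
move=> K150 t100 z0; have t0 : 0 < t by lra.
have T0 : 0 < t + 1 by lra.
have l_le := slope_loss t100; rewrite -/s in l_le.
have a_le := slope_increment t100.
rewrite /upper_exponent [spread (t + 1)]/spread.
set q := Num.sqrt t in l_le *; set p := Num.sqrt (t + 1).
have q0 : 0 < q by rewrite /q sqrtr_gt0.
have p0 : 0 < p by rewrite /p sqrtr_gt0.
have q2 : q ^+ 2 = t by rewrite /q sqr_sqrtr// ltW.
have p2 : p ^+ 2 = q ^+ 2 + 1 by rewrite q2 /p sqr_sqrtr// ltW.
have q10 : 10 <= q by clear -t100 q0 q2; nra.
have K_ge := inv_sqrt_gain K150 q10 p0 p2.
have b_ge := inv_spread_gain q10 p0 p2.
have sE : s + 1 = q ^+ 2 + q + 1 by rewrite /s /spread -/q q2.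
rewrite -sE q2 in b_ge; rewrite -[in t^-1]q2 -exprVn -exprM in a_le.
rewrite (_ : (t * q)^-1 = q^-1 ^+ 3); last by rewrite -q2; field; rewrite gt_eqF.
set i := q^-1 in l_le a_le b_ge K_ge *.
have i0 : 0 < i by rewrite /i invr_gt0.
(* The gain from [spread] against the loss from [slope], by completing the square in z / sqrt t; the
   maximum is 1350/49 < 28. *)
have quad : 15 / 7 * i ^+ 4 * z - i ^+ 5 / 24 * z ^+ 2 <= 28 * i ^+ 3.
  rewrite -subr_ge0 (_ : _ - _ = i ^+ 3 * (28 - 15 / 7 * (i * z) + (i * z) ^+ 2 / 24)).
    rewrite mulr_ge0 ?exprn_ge0 ?(ltW i0)//.
    by have := sqr_ge0 (i * z - 180 / 7); set w := i * z; clear; lra.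
  by field.
have az : (slope (t + 1) - slope t) * z <= 15 / 7 * i ^+ 4 * z by rewrite ler_wpM2r.
have bz := ler_wpM2r (sqr_ge0 z) b_ge.
have i3 : 0 < i ^+ 3 by rewrite exprn_gt0.
have -> : z ^+ 2 / (2 * (s + 1)) = 1 / (2 * (s + 1)) * z ^+ 2 by rewrite mulrC div1r.
have -> : z ^+ 2 / (2 * (t + 1 + p)) = 1 / (2 * (t + 1 + p)) * z ^+ 2 by rewrite mulrC div1r.
(* The balance in units of t^(-3/2) is 3/2 + 28 + 1 <= 100/3. *)
rewrite mulNr; clear -K_ge l_le quad az bz i3; lra.
Qed.

(** This bounds the contribution of the far left, where [u] is only known to be at most 1: k^2/2
    exceeds the exponent of the barrier by enough to leave e^(-(2t+1)), well below the slack of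
    order t^(-3/2). *)
Lemma upper_tail K t z (k : R) : 0 <= K -> 100 <= t -> 0 <= z -> z + 2 * t <= k ->
  expR (1 - k ^+ 2 / 2) <=
  expR (K + 48) * expR (upper_exponent K (t + 1) z) * ((t * Num.sqrt t)^-1 / 2).
Proof.
move=> K0 t100 z0 kt; have t0 : 0 < t by lra.
have q1 : 1 <= Num.sqrt t by rewrite -[leLHS]sqrtr1 ler_sqrt//; lra.
have tq0 : 0 < t * Num.sqrt t by rewrite mulr_gt0//; lra.
have gE : expR (- (2 * t + 1)) <= (t * Num.sqrt t)^-1 / 2.
  rewrite (_ : _ / 2 = (2 * (t * Num.sqrt t))^-1); last by rewrite [RHS]invfM mulrC.
  rewrite expRN lef_pV2 ?posrE ?expR_gt0 ?(mulr_gt0 _ tq0)// [leRHS]expRD mulrC.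
  have h1 : 2 <= expR (1 : R) by have := expR_ge1Dx (1 : R); lra.
  have /expR_ge_sqr h2 : 0 <= 2 * t by lra.
  have qt : Num.sqrt t <= t.
    rewrite -[leRHS](sqr_sqrtr (ltW t0)); set q := Num.sqrt t in q1 *; nra.
  apply: ler_pM => //; [by rewrite ltW|]; nra.
have zz : (z + 2 * t) ^+ 2 <= k ^+ 2 by rewrite lerXn2r ?nnegrE//; lra.
have tz : z <= t * z by rewrite ler_peMl//; lra.
have tt : t <= t ^+ 2 by nra.
have /andP[b1 b2] : 1 <= slope (t + 1) <= 3 / 2 by apply: slope_bounds; lra.
have p1 : 1 <= Num.sqrt (t + 1) by rewrite -[leLHS]sqrtr1 ler_sqrt//; lra.
have h1 : K / Num.sqrt (t + 1) <= K by rewrite ler_pdivrMr ?ler_peMr// (lt_le_trans _ p1).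
have h2 : z ^+ 2 / (2 * spread (t + 1)) <= z ^+ 2 / 2.
  by rewrite ler_wpM2l ?sqr_ge0// lef_pV2 ?posrE /spread; lra.
have h3 : slope (t + 1) * z <= 3 / 2 * z by rewrite ler_wpM2r.
apply: (@le_trans _ _ (expR (K + 48) * expR (upper_exponent K (t + 1) z) * expR (- (2 * t + 1)))).
  rewrite -!expRD ler_expR /upper_exponent mulNr; clear -t100 z0 zz tz tt h1 h2 h3; lra.
by rewrite ler_wpM2l// mulr_ge0 ?expR_ge0.
Qed.

(** A gap [g] in the exponent frees the fraction g/2 of the barrier, enough for the remainder [r]
    because y >= 1/2. *)
Lemma exponent_absorb (e1 e2 f g y r : R) : 0 <= f -> 0 < g <= 1 -> 1 / 2 <= y ->
  e1 + g <= e2 -> r <= f * expR e2 * (g / 2) ->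
  2 * f * expR e1 * y + r <= 2 * f * expR e2 * y.
Proof.
move=> f0 /andP[g0 g1] y2 e12; have e0 := expR_gt0 e2.
have E12 : expR e1 <= expR e2 * (1 - g / 2).
  apply: (@le_trans _ _ (expR e2 * expR (- g))); first by rewrite -expRD ler_expR; lra.
  rewrite ler_pM2l// expRN.
  apply: (@le_trans _ _ (1 + g)^-1).
    by rewrite lef_pV2 ?posrE ?expR_gt0 ?expR_ge1Dx//; lra.
  by rewrite -div1r ler_pdivrMr; nra.
set x1 := expR e1 in E12 *; set x2 := expR e2 in e0 E12 *.
have h1 : f * y * x1 <= f * y * (x2 * (1 - g / 2)) by rewrite ler_wpM2l// mulr_ge0//; lra.
have h2 : 0 <= f * x2 * (g / 2) * (2 * y - 1).
  by rewrite !mulr_ge0 ?(ltW e0)//; lra.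
lra.
Qed.

End upper_barrier.

(** * Induction for the upper barrier *)

Section upper_bound.
Context d (T : measurableType d) (R : realType) (P : probability T R).
Variables (tau : seq bool -> {RV P >-> R}) (B : seq bool -> R -> {RV P >-> R}).
Hypothesis hB : branching_brownian_motion tau B.
Local Notation u := (surv tau B).
Local Notation lam := (@lam R).
Variable K : R.
Hypothesis K150 : 150 <= K.

Let K0 : 0 <= K. Proof. by apply: le_trans K150; rewrite ler0n. Qed.

Let u0 t x : 0 <= u t x. Proof. by case/andP: (surv01 hB t x). Qed.
Let u1 t x : u t x <= 1. Proof. by case/andP: (surv01 hB t x). Qed.

(* The factor [2 e^(K + 48)] makes the barrier at least 1 for [z <= 8]. *)
Definition upper_barrier (t z : R) : R :=
  2 * expR (K + 48) * expR (upper_exponent K t z) * upper_profile z.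

(** Apart from the K term, the exponent is concave in z with zeros at 0 and -2 slope spread, and at
    z = 8 it is at least -12 - 32. The left zero is where the induction stops comparing [u] with the
    barrier. *)
Lemma upper_barrier_ge1 (t z : R) : 100 <= t ->
  - 2 * slope t * spread t <= z <= 8 -> 1 <= upper_barrier t z.
Proof.
move=> t100 /andP[z1 z8]; have /andP[a1 a2] : 1 <= slope t <= 3 / 2 by apply: slope_bounds; lra.
have t0 : 0 < t by lra.
have q1 : 1 <= Num.sqrt t by rewrite -[leLHS]sqrtr1 ler_sqrt//; lra.
have s1 : 1 <= spread t by rewrite /spread; lra.
have K1 : K / Num.sqrt t <= K by rewrite ler_pdivrMr ?ler_peMr// (lt_le_trans _ q1).
have e1 : - 48 <= - slope t * z - z ^+ 2 / (2 * spread t).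
  set a := slope t in z1 a1 a2 *; set s := spread t in z1 s1 *.
  rewrite -(ler_pM2r (_ : 0 < 2 * s)); last lra.
  rewrite [leRHS]mulrBl divfK; last by rewrite gt_eqF//; lra.
  have [z0|z0] := leP 0 z; nra.
have e0 : 1 <= expR (K + 48) * expR (upper_exponent K t z).
  rewrite -expRD -[leLHS]expR0 ler_expR /upper_exponent; lra.
have := upper_profile_ge z; rewrite /upper_barrier -(mulrA 2); nra.
Qed.

Lemma upper_step (t r : R) : 100 <= t -> 0 <= r ->
  (forall x, - 2 * slope t * spread t <= x - lam * t + ell t ->
     u r x <= upper_barrier t (x - lam * t + ell t)) ->
  forall x, - 2 * slope (t + 1) * spread (t + 1) <= x - lam * (t + 1) + ell (t + 1) ->
     u (r + 1) x <= upper_barrier (t + 1) (x - lam * (t + 1) + ell (t + 1)).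
Proof.
move=> t100 r0 IH x; set z := x - lam * (t + 1) + ell (t + 1) => zlow.
have [z8|z8] := leP z 8.
  by apply: (le_trans (u1 _ _)); apply: upper_barrier_ge1; [lra|rewrite zlow].
have /andP[a1 a2] : 1 <= slope t <= 3 / 2 by apply: slope_bounds; lra.
have t0 : 0 < t by lra.
set a := slope t in IH a1 a2 *; set s := spread t in IH *.
have q1 : 1 <= Num.sqrt t by rewrite -[leLHS]sqrtr1 ler_sqrt//; lra.
have st : t + 1 <= s by rewrite /s /spread; lra.
have s0 : 0 < s by lra.
have s10 : 0 < s + 1 by lra.
(* [o] is the position of [x] in the frame of time t; steps y > k land left of the range of the
   induction hypothesis. *)
pose o := z + a; pose k := o + 2 * a * s.
(* Completing the square, -a(o - y) - (o - y)^2/2s = a^2 s/2 - (xs - y)^2/2s: the tilted weight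
   becomes a Gaussian in xs - y, to which the bridge formula applies. *)
pose C := 2 * expR (K + 48) * expR (- K / Num.sqrt t + a ^+ 2 * s / 2).
pose xs := o + a * s.
have C0 : 0 < C by rewrite /C mulr_gt0 ?mulr_gt0 ?expR_gt0.
have ats : s <= a * s by rewrite ler_peMl// ltW.
have kt : z + 2 * t <= k by rewrite /k /o; lra.
have k0 : 0 <= k by rewrite /k /o; lra.
have v0 : 0 < s * 1 / (s + 1) by rewrite divr_gt0// mulr_gt0.
have oE y : o - y = x - y - lam * t + ell t by rewrite /o /z /a /slope; ring.
have G := gauss_mean_form (1 * xs / (s + 1)) o 0 1 (- 1) 2 v0.
have G1 := gauss_meanZ C (gauss_mean_bridge s0 ltr01 G).
(* The Chernoff majorant e^(k(y - k)) of the indicator of y > k. *)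
have G2 := gauss_meanZ (expR (- k ^+ 2)) (gauss_mean_exp 0 k ltr01).
have form0 w : 0 + 1 * w + - 1 * expR (- w) + 2 * expR (- 2 * w) = upper_profile w.
  by rewrite /upper_profile; ring.
have := surv_step_upper hB r0 ltr01 _ (gauss_meanD G1 G2) => /(_ x) step.
apply: (le_trans (step _)) => [y|].
  rewrite form0.
  have F1 : 0 <= C * (expR (- (xs - y) ^+ 2 / (2 * s)) * upper_profile (o - y)).
    by rewrite mulr_ge0 ?(ltW C0)// mulr_ge0 ?expR_ge0// upper_profile_ge0.
  have F2 : 0 <= expR (- k ^+ 2) * expR (k * y) by rewrite mulr_ge0 ?expR_ge0.
  have [low|low] := leP (- 2 * a * s) (o - y); last first.
    apply: (le_trans (u1 _ _)); rewrite -[leLHS]add0r lerD//.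
    rewrite -expRD -[leLHS]expR0 ler_expR.
    by rewrite (_ : _ + _ = k * (y - k)) ?mulr_ge0//; [rewrite /k; lra|ring].
  apply: (@le_trans _ _ (upper_barrier t (o - y))).
    by rewrite oE; apply: IH; rewrite -oE.
  rewrite -[leLHS]addr0 lerD// /upper_barrier /C -!(mulrA (2 * _)) ler_wpM2l//.
  rewrite mulrA -expRD ler_wpM2r ?upper_profile_ge0//.
  rewrite ler_expR le_eqVlt /upper_exponent /xs -/a -/s; apply/orP; left; apply/eqP.
  by field; rewrite !gt_eqF// (lt_le_trans _ q1).
have v1 : 1 / 2 <= s * 1 / (s + 1) <= 1.
  by rewrite ler_pdivlMr// ler_pdivrMr//; lra.
(* Rate and displacement are both [a], so they cancel and no additive term remains. *)
have mE : o - 1 * xs / (s + 1) = s * 1 / (s + 1) * z.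
  by rewrite /xs /o; field; rewrite gt_eqF.
have M := upper_profile_mean v1 (ltW z8).
rewrite mE; set v := s * 1 / (s + 1) in M v0 *.
set E := 0 + 1 * (v * z) + _ + _; have {M} EH : E <= v * upper_profile z.
  by rewrite (_ : E = v * z - expR (- (v * z) + v / 2) + 2 * expR (- 2 * (v * z) + 2 * v))//;
    rewrite /E; ring.
have vE : v = expR (ln s - ln (s + 1)) by rewrite -ln_div ?posrE// lnK ?posrE ?divr_gt0// /v mulr1.
set e1 := 1 - K / Num.sqrt t - a ^+ 2 / 2 - a * z - z ^+ 2 / (2 * (s + 1)) + 3 / 2 * ln (s / (s + 1)).
have z0 : 0 <= z by rewrite (le_trans _ (ltW z8)).
have := upper_exponent_step K150 t100 z0; rewrite -/a -/s -/e1.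
set e2 := upper_exponent _ _ _; set g := (t * Num.sqrt t)^-1 => eg.
have H0 := upper_profile_ge z.
have T1 : expR 1 * (C * (Num.sqrt (s / (s + 1)) * expR (- xs ^+ 2 / (2 * (s + 1))) * E)) <=
    2 * expR (K + 48) * expR e1 * upper_profile z.
  apply: (@le_trans _ _ (expR 1 * (C * (Num.sqrt (s / (s + 1)) *
      expR (- xs ^+ 2 / (2 * (s + 1))) * (v * upper_profile z))))).
    rewrite ler_pM2l ?expR_gt0// ler_pM2l// ler_wpM2l// mulr_ge0 ?expR_ge0//.
  rewrite /C sqrt_ratio// vE; set l := _ - ln (s + 1).
  have -> : expR e1 = expR 1 * expR (- K / Num.sqrt t + a ^+ 2 * s / 2) *
      expR (l / 2) * expR (- xs ^+ 2 / (2 * (s + 1))) * expR l.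
    rewrite -!expRD; congr expR; rewrite /e1 /xs /o ln_div ?posrE// -/l.
    by field; rewrite !gt_eqF// (lt_le_trans _ q1).
  by rewrite le_eqVlt; apply/orP; left; apply/eqP; ring.
rewrite mulrDr; apply: (le_trans (lerD T1 (_ : _ <= expR (1 - k ^+ 2 / 2)))).
  by rewrite -!expRD ler_expR; lra.
apply: exponent_absorb (upper_tail K0 t100 z0 kt) => //.
have tq1 : 1 <= t * Num.sqrt t by rewrite mulr_ege1//; lra.
by rewrite invr_gt0 invf_le1 (lt_le_trans _ tq1).
Qed.

(** Chernoff's bound with rate [x], for one step from time 0, where [u] vanishes at nonnegative
    positions. *)
Lemma surv_le_gaussian (r x : R) : 0 <= r <= 1 -> 0 <= x -> u r x <= expR (1 - x ^+ 2 / 2).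
Proof.
move=> /andP[r0 r1] x0; move: r0; rewrite le_eqVlt => /predU1P[<-|r0].
  by rewrite surv_time0// expR_ge0.
have G := gauss_meanZ (expR (- x ^+ 2)) (gauss_mean_exp 0 x r0).
have := surv_step_upper hB (lexx 0) r0 _ G => /(_ x) step; rewrite add0r in step.
apply: (le_trans (step _)) => [y|].
  have [xy|xy] := leP 0 (x - y); first by rewrite surv_time0// mulr_ge0 ?expR_ge0.
  apply: (le_trans (u1 _ _)); rewrite -expRD -[leLHS]expR0 ler_expR; nra.
rewrite -!expRD ler_expR; have := sqr_ge0 x; nra.
Qed.

(** The process lags the barrier by [b]: it has run for at most one unit of time, so its tail e^(1 -
    x^2/2) lies below a barrier of variance [spread t]. *)
Lemma upper_base (b t x : R) (z := x - lam * t + ell t) : 100 <= b -> b <= t <= b + 1 ->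
  - 2 * slope t * spread t <= z -> u (t - b) x <= upper_barrier t z.
Proof.
move=> b100 /andP[bt tb] zlow; have t0 : 0 < t by lra.
have [z8|z8] := leP z 8.
  by apply: (le_trans (u1 _ _)); apply: upper_barrier_ge1; [lra|rewrite zlow].
have /andP[a1 a2] : 1 <= slope t <= 3 / 2 by apply: slope_bounds; lra.
have q0 : 0 < Num.sqrt t by rewrite sqrtr_gt0.
have q2 : Num.sqrt t ^+ 2 = t by rewrite sqr_sqrtr// ltW.
have q1 : 10 <= Num.sqrt t by set q := Num.sqrt t in q0 q2 *; nra.
have xz : z + 2 <= x.
  have /andP[l1 _] := @lam_bounds R; have /andP[c1 c2] := @ell_coef R.
  have lt := ln_le_sqrt t0.
  have e1 : ell t <= 15 / 7 * Num.sqrt t.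
    by rewrite /ell; set k := 3 / _ in c1 c2 *; set q := Num.sqrt t in q0 lt *; nra.
  have : ell t + 2 <= lam * t.
    have : 7 / 5 * t <= lam * t by rewrite ler_wpM2r// ltW.
    have : 10 * Num.sqrt t <= t by rewrite -[leRHS]q2 expr2 ler_wpM2r// ltW.
    lra.
  by rewrite /z; lra.
have x0 : 0 <= x by lra.
have s1 : 1 <= spread t by rewrite /spread; lra.
apply: (le_trans (surv_le_gaussian _ x0)); first lra.
have K1 : K / Num.sqrt t <= K by rewrite ler_pdivrMr ?ler_peMr// (le_trans _ q1)// ler1n.
rewrite /upper_barrier -(mulrA 2) -expRD.
apply: (@le_trans _ _ (expR (K + 48 + upper_exponent K t z))); last first.
  have := expR_gt0 (K + 48 + upper_exponent K t z); have := upper_profile_ge z; nra.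
rewrite ler_expR /upper_exponent.
have : z ^+ 2 / (2 * spread t) <= z ^+ 2 / 2.
  by rewrite ler_wpM2l ?sqr_ge0// lef_pV2 ?posrE; lra.
nra.
Qed.

Lemma surv_le_upper_barrier (b : R) : 100 <= b -> forall t x, b <= t ->
  - 2 * slope t * spread t <= x - lam * t + ell t ->
  u (t - b) x <= upper_barrier t (x - lam * t + ell t).
Proof.
move=> b100 t x bt.
have [n tn] : exists n : nat, t <= b + n.+1%:R.
  exists (Num.truncn (t - b)).
  have : t - b < (Num.truncn (t - b)).+1%:R by exact: truncnS_gt.
  lra.
elim: n t x bt tn => [|n IH] t x bt tn; first by apply: upper_base; lra.
have [tn'|tn'] := leP t (b + n.+1%:R); first exact: IH.
have n0 : 0 <= n%:R :> R by [].
have bt' : b <= t - 1 by move: tn'; rewrite -natr1; lra.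
have tn1 : t - 1 <= b + n.+1%:R by move: tn; rewrite -[n.+2%:R]natr1; lra.
have := @upper_step (t - 1) (t - 1 - b) _ _ (fun y => IH (t - 1) y bt' tn1) x.
rewrite !subrK (_ : t - 1 - b + 1 = t - b); last by ring.
by apply; lra.
Qed.

Lemma surv_front_lt_half : exists C b : R, forall t, b <= t ->
  u t (lam * t - ell t + C) < 1 / 2.
Proof.
pose A : R := 2 * expR (K + 48); have A0 : 0 < A by rewrite /A mulr_gt0// expR_gt0.
(* As e^(-c) <= 4/(c+2)^2, the barrier at z = c is at most 4A/(c+2), which c = 8A makes less than
   1/2. *)
pose c := 8 * A; pose b : R := 100.
(* The lag [b] of the process behind the barrier shifts the threshold by [lam * b]. *)
exists (lam * b + c), 1 => t t1; have b0 : 0 < b by [].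
have bt : b <= t + b by lra.
have t0 : 0 < t by lra.
have c0 : 0 < c by rewrite /c mulr_gt0.
have /andP[a1 a2] : 1 <= slope (t + b) <= 3 / 2 by apply: slope_bounds; rewrite /b; lra.
have s0 : 0 < spread (t + b) by rewrite /spread ltr_wpDr ?sqrtr_ge0//; lra.
pose x := lam * (t + b) - ell (t + b) + c.
have xE : x - lam * (t + b) + ell (t + b) = c by rewrite /x; ring.
have := surv_le_upper_barrier (lexx b) (t := t + b) (x := x) bt.
rewrite xE addrK => H; have {H} : u t x <= upper_barrier (t + b) c.
  apply: H; apply: (@le_trans _ _ 0); last exact: ltW.
  by rewrite !mulNr oppr_le0 !mulr_ge0// ?ltW//; lra.
have ltb : ell t <= ell (t + b) by apply: le_ell; lra.
have : u t (lam * t - ell t + (lam * b + c)) <= u t x.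
  by apply: surv_noninc => //; rewrite /x; lra.
suff : upper_barrier (t + b) c < 1 / 2 by lra.
rewrite /upper_barrier -/A.
have E1 : expR (upper_exponent K (t + b) c) <= expR (- c).
  rewrite ler_expR /upper_exponent.
  have h1 : 0 <= K / Num.sqrt (t + b) by rewrite divr_ge0.
  have h2 : 0 <= c ^+ 2 / (2 * spread (t + b)) by rewrite divr_ge0 ?sqr_ge0//; lra.
  rewrite !mulNr; nra.
have E2 : expR (- c) <= 4 / (c + 2) ^+ 2.
  rewrite expRN -invf_div lef_pV2 ?posrE ?expR_gt0//; last first.
    by rewrite divr_gt0// exprn_gt0//; lra.
  by have := expR_ge_sqr (ltW c0); lra.
have P1 := upper_profile_le (ltW c0); have P0 := upper_profile_ge c.
apply: (@le_lt_trans _ _ (A * (4 / (c + 2) ^+ 2) * (c + 2))).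
  apply: ler_pM => //; [by rewrite mulr_ge0 ?expR_ge0// ltW|lra|].
  by rewrite ler_wpM2l ?(ltW A0)// (le_trans E1).
rewrite (_ : A * _ * _ = c / 2 / (c + 2)); last first.
  by rewrite /c; field; rewrite gt_eqF//; lra.
by rewrite ltr_pdivrMr; lra.
Qed.

End upper_bound.

Theorem theorem1 (d : measure_display) (T : measurableType d) (R : realType)
    (P : probability T R)
    (tau : seq bool -> {RV P >-> R}) (B : seq bool -> R -> {RV P >-> R})
    (hBBM : branching_brownian_motion tau B) :
  exists C : R, \forall t \near +oo,
    `| median tau B t - (Num.sqrt 2 * t - 3 / (2 * Num.sqrt 2) * ln t) | <= C.
Proof.
have [C1 [b1 H1]] := surv_front_ge_half hBBM.
have [C2 [b2 H2]] := surv_front_lt_half hBBM (lexx 150).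
exists (`|C1| + `|C2|); near=> t.
have t0 : 0 <= t by near: t; exact: (nbhs_pinfty_ge (num_real _)).
have /H1 h1 : b1 <= t by near: t; exact: (nbhs_pinfty_ge (num_real _)).
have /H2 h2 : b2 <= t by near: t; exact: (nbhs_pinfty_ge (num_real _)).
pose f := lam * t - ell t : R; rewrite -/lam -/(ell t) -/f in h1 h2 *.
(* P(M_t <= x) <= 1/2 reads u(t, x) >= 1/2; the two front estimates provide an element and an upper
   bound of this set. *)
pose S := [set x : R | 1 / 2 <= surv tau B t x].
have -> : median tau B t = sup S.
  rewrite /median; congr sup; apply/seteqP; split => x /=;
  by rewrite (measurable_rightmost_set hBBM)// lee_fin /S /= => ?; lra.
have S1 : S (f - C1) by [].
have S2 : ubound S (f + C2).
  move=> x; rewrite /S /= => Sx; rewrite leNgt; apply/negP => /ltW fx.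
  by have := surv_noninc hBBM t fx; lra.
have := ub_le_sup (ex_intro _ _ S2) S1.
have := sup_le_ub (ex_intro _ _ S1) S2.
have := ler_norm C1; have := ler_norm C2; have := ler_norm (- C1); have := ler_norm (- C2).
rewrite !normrN ler_norml; lra.
Unshelve. all: by end_near.
Qed.
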